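(* The following are provable in $\mathbf{ZF}$: (i) $\mathbf{IQDI}$ implies that: every infinite Boolean algebra has a tower if and only if every infinite Boolean algebra expressible as a denumerable union of finite sets has a tower. (ii) The conjunction of $\mathbf{IQDI}$ and $\mathbf{QPKW}(\infty,<\aleph_0)$ implies that every infinite Boolean algebra has a tower. (iii) $\mathbf{QPKW}(\infty,<\aleph_0)$ implies that, for every topological space $\mathbf{X}$, if $\mathbf{X}$ has a regular matrix, then $\mathbf{X}$ admits a denumerable cellular family.
   Context: The base theory is $\mathbf{ZF}$, with no form of the axiom of choice assumed. A set is infinite if it is not equipotent with any $n\in\omega$, denumerable if it is equipotent with $\omega$, and countable if it is equipotent with a subset of $\omega$. $\mathbf{IQDI}$: for every infinite set $X$, the set $[X]^{<\omega}$ of all finite subsets of $X$ has a denumerable subset. $\mathbf{QPKW}(\infty,<\aleph_0)$: for every infinite set $J$ and every family $\{A_j: j\in J\}$ of finite sets such that $|A_j|\ge 2$ for every $j\in J$, if $J$ is a countable union of finite sets, then there exist an infinite subset $I$ of $J$ and a family $\{B_j: j\in I\}$ of non-empty sets such that, for every $j\in I$, $B_j$ is a proper subset of $A_j$. A tower of a Boolean algebra is a strictly decreasing sequence $(t_n)_{n\in\omega}$ of its elements with respect to the order $x\le y\leftrightarrow x=x\cdot y$. A cellular family of a topological space is a set of pairwise disjoint non-empty open subsets of it. A set $U$ is regular open in $\mathbf{X}$ if $U=int(\overline{U})$. A regular matrix of $\mathbf{X}$ is a collection $\{\mathcal{C}_n: n\in\mathbb{N}\}$ of finite cellular families of $\mathbf{X}$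 such that $\mathcal{C}_m\neq\mathcal{C}_n$ whenever $m\ne n$ and, for each $n\in\mathbb{N}$, all members of $\mathcal{C}_n$ are regular open and $\bigcup\mathcal{C}_n$ is dense in $\mathbf{X}$. *)

(* Defs.v *)
(* Rocq itself proves choice principles once the usual classical axioms are
   added, so "provable in ZF" is rendered literally: ZF is a first-order theory
   in the language {=, ∈}, given by its axioms and axiom schemas, and provability
   is derivability in a classical natural deduction calculus. *)

From Stdlib Require Import List.
Import ListNotations.

Set Implicit Arguments.

(* De Bruijn indices.  The language has no function symbols, so the only terms
   are variables and substitutions are renamings. *)
Inductive form : Type :=
| Bot : form
| Eq  : nat -> nat -> form
| Mem : nat -> nat -> form
| Imp : form -> form -> form
| All : form -> form.

Definition scons (x : nat) (s : nat -> nat) : nat -> nat :=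
  fun k => match k with 0 => x | S j => s j end.

Fixpoint ren (s : nat -> nat) (f : form) : form :=
  match f with
  | Bot => Bot
  | Eq x y => Eq (s x) (s y)
  | Mem x y => Mem (s x) (s y)
  | Imp f g => Imp (ren s f) (ren s g)
  | All f => All (ren (scons 0 (fun k => S (s k))) f)
  end.

(* Replaces variable 0 by x and lowers the other variables. *)
Definition subst0 (x : nat) (f : form) : form := ren (scons x (fun k => k)) f.

(* [prv T G f]: f is derivable from the hypotheses G and the non-logical axioms
   T.  As usual, an axiom with free variables stands for its universal closure;
   hence the renaming in [prv_ax]. *)
Inductive prv (T : form -> Prop) : list form -> form -> Prop :=
| prv_ax   : forall G f s, T f -> prv T G (ren s f)
| prv_hyp  : forall G f, In f G -> prv T G f
| prv_impI : forall G f g, prv T (f :: G) g -> prv T G (Imp f g)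
| prv_impE : forall G f g, prv T G (Imp f g) -> prv T G f -> prv T G g
| prv_allI : forall G f, prv T (map (ren S) G) f -> prv T G (All f)
| prv_allE : forall G f x, prv T G (All f) -> prv T G (subst0 x f)
| prv_dne  : forall G f, prv T G (Imp (Imp f Bot) Bot) -> prv T G f
| prv_refl : forall G x, prv T G (Eq x x)
| prv_eqE  : forall G f x y,
    prv T G (Eq x y) -> prv T G (subst0 x f) -> prv T G (subst0 y f).

(* A variable is represented by the number of quantifiers above its binder (its
   de Bruijn level), and a formula by a function of the number n of enclosing
   quantifiers; level x has index n - (x + 1).  Thus bound variables can be
   written as Rocq variables. *)
Definition var := nat.
Definition hform := nat -> form.
Definition idx (n : nat) (x : var) : nat := n - S x.

Definition hbot : hform := fun _ => Bot.
Definition heq (x y : var) : hform := fun n => Eq (idx n x) (idx n y).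
Definition hmem (x y : var) : hform := fun n => Mem (idx n x) (idx n y).
Definition himp (P Q : hform) : hform := fun n => Imp (P n) (Q n).
Definition hall (P : var -> hform) : hform := fun n => All (P n (S n)).

Definition hnot (P : hform) : hform := himp P hbot.
Definition hor (P Q : hform) : hform := himp (hnot P) Q.
Definition hand (P Q : hform) : hform := hnot (himp P (hnot Q)).
Definition hiff (P Q : hform) : hform := hand (himp P Q) (himp Q P).
Definition hex (P : var -> hform) : hform := hnot (hall (fun x => hnot (P x))).
Definition hall_in (A : var) (P : var -> hform) : hform :=
  hall (fun x => himp (hmem x A) (P x)).
Definition hex_in (A : var) (P : var -> hform) : hform :=
  hex (fun x => hand (hmem x A) (P x)).

Definition sentence (P : hform) : form := P 0.

(* Instances of a schematic formula f: the free variables 0 (and 1) of f become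
   x (and y); the other ones are parameters and are left free. *)
Definition inst1 (f : form) (x : var) : hform :=
  fun n => ren (scons (idx n x) (fun k => n + k)) f.
Definition inst2 (f : form) (x y : var) : hform :=
  fun n => ren (scons (idx n x) (scons (idx n y) (fun k => n + k))) f.

Declare Scope zf_scope.
Delimit Scope zf_scope with zf.
Bind Scope zf_scope with hform.

Notation "x ≈ y" := (heq x y) (at level 70, no associativity) : zf_scope.
Notation "x ∈ y" := (hmem x y) (at level 70, no associativity) : zf_scope.
Notation "¬ P" := (hnot P) (at level 75, right associativity) : zf_scope.
Notation "P ∧ Q" := (hand P Q) (at level 80, right associativity) : zf_scope.
Notation "P ∨ Q" := (hor P Q) (at level 85, right associativity) : zf_scope.
Notation "P ⇒ Q" := (himp P Q) (at level 99, Q at level 200, right associativity) : zf_scope.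
Notation "P ⇔ Q" := (hiff P Q) (at level 95, no associativity) : zf_scope.
Notation "∀ x , P" := (hall (fun x => P))
  (at level 200, x name, P at level 200) : zf_scope.
Notation "∃ x , P" := (hex (fun x => P))
  (at level 200, x name, P at level 200) : zf_scope.
Notation "∀ x ∈ A , P" := (hall_in A (fun x => P))
  (at level 200, x name, A at level 60, P at level 200) : zf_scope.
Notation "∃ x ∈ A , P" := (hex_in A (fun x => P))
  (at level 200, x name, A at level 60, P at level 200) : zf_scope.

Local Open Scope zf_scope.

(* [IsFoo s ...] says that s is the set denoted by the operation Foo. *)

Definition Subset (A B : var) : hform := ∀ x ∈ A, x ∈ B.
Definition IsEmpty (A : var) : hform := ∀ x, ¬ x ∈ A.
Definition Nonempty (A : var) : hform := ∃ x, x ∈ A.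
Definition Disjoint (A B : var) : hform := ¬ ∃ x, x ∈ A ∧ x ∈ B.
Definition IsUpair (p x y : var) : hform := ∀ z, z ∈ p ⇔ (z ≈ x ∨ z ≈ y).
Definition IsUnion (U F : var) : hform := ∀ x, x ∈ U ⇔ ∃ A ∈ F, x ∈ A.
Definition IsInter2 (C A B : var) : hform := ∀ x, x ∈ C ⇔ (x ∈ A ∧ x ∈ B).
Definition IsSucc (s x : var) : hform := ∀ z, z ∈ s ⇔ (z ∈ x ∨ z ≈ x).

Definition Inductive_set (I : var) : hform :=
  (∃ e ∈ I, IsEmpty e) ∧ (∀ x ∈ I, ∃ s ∈ I, IsSucc s x).
Definition IsOmega (w : var) : hform :=
  ∀ x, x ∈ w ⇔ (∀ I, Inductive_set I ⇒ x ∈ I).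

Definition IsPair (p x y : var) : hform :=
  ∃ a, ∃ b, IsUpair a x x ∧ IsUpair b x y ∧ IsUpair p a b.
Definition IsProd (P A B : var) : hform :=
  ∀ p, p ∈ P ⇔ ∃ x ∈ A, ∃ y ∈ B, IsPair p x y.

(* f(x) = y *)
Definition App (f x y : var) : hform := ∃ p ∈ f, IsPair p x y.
(* f(x,y) = z *)
Definition App2 (f x y z : var) : hform := ∃ p, IsPair p x y ∧ App f p z.

(* f is a function with domain A, i.e. a family indexed by A *)
Definition IsFamily (f A : var) : hform :=
  (∀ p ∈ f, ∃ x ∈ A, ∃ y, IsPair p x y)
  ∧ (∀ x ∈ A, ∃ y, App f x y ∧ ∀ z, App f x z ⇒ z ≈ y).
Definition IsFun (f A B : var) : hform :=
  IsFamily f A ∧ (∀ x ∈ A, ∀ y, App f x y ⇒ y ∈ B).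
Definition IsBij (f A B : var) : hform :=
  IsFun f A B
  ∧ (∀ y ∈ B, ∃ x ∈ A, App f x y ∧ ∀ z ∈ A, App f z y ⇒ z ≈ x).

Definition Equipotent (A B : var) : hform := ∃ f, IsBij f A B.
Definition Finite (A : var) : hform :=
  ∃ w, IsOmega w ∧ ∃ n ∈ w, Equipotent A n.
Definition Infinite (A : var) : hform := ¬ Finite A.
Definition Denumerable (A : var) : hform :=
  ∃ w, IsOmega w ∧ Equipotent A w.
Definition Countable (A : var) : hform :=
  ∃ w, IsOmega w ∧ ∃ s, Subset s w ∧ Equipotent A s.

Definition DenumUnionOfFinite (A : var) : hform :=
  ∃ F, Denumerable F ∧ (∀ x ∈ F, Finite x) ∧ IsUnion A F.
Definition CountableUnionOfFinite (A : var) : hform :=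
  ∃ F, Countable F ∧ (∀ x ∈ F, Finite x) ∧ IsUnion A F.

Inductive ZF : form -> Prop :=
| ZF_extensionality :
    ZF (sentence (∀ x, ∀ y, (∀ z, z ∈ x ⇔ z ∈ y) ⇒ x ≈ y))
| ZF_foundation :
    ZF (sentence (∀ x, Nonempty x ⇒ ∃ y ∈ x, Disjoint y x))
| ZF_pairing :
    ZF (sentence (∀ x, ∀ y, ∃ p, IsUpair p x y))
| ZF_union :
    ZF (sentence (∀ F, ∃ U, IsUnion U F))
| ZF_power :
    ZF (sentence (∀ A, ∃ P, ∀ x, x ∈ P ⇔ Subset x A))
| ZF_infinity :
    ZF (sentence (∃ I, Inductive_set I))
| ZF_separation : forall f : form,
    ZF (sentence (∀ A, ∃ B, ∀ x, x ∈ B ⇔ (x ∈ A ∧ inst1 f x)))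
| ZF_replacement : forall f : form,
    ZF (sentence
      ((∀ x, ∀ y, ∀ z, inst2 f x y ∧ inst2 f x z ⇒ y ≈ z) ⇒
       ∀ A, ∃ B, ∀ y, y ∈ B ⇔ ∃ x ∈ A, inst2 f x y)).

Definition ZF_proves (P : hform) : Prop := prv ZF [] (sentence P).

(* Algebraic expressions: an expression takes a property to the formula saying
   that its value (exists and) has this property. *)
Definition expr := (var -> hform) -> hform.
Definition evar (x : var) : expr := fun k => k x.
Definition eop1 (f : var) (s : expr) : expr :=
  fun k => s (fun a => ∃ b, App f a b ∧ k b).
Definition eop2 (f : var) (s t : expr) : expr :=
  fun k => s (fun a => t (fun b => ∃ c, App2 f a b c ∧ k c)).
Definition eeq (s t : expr) : hform := s (fun a => t (fun b => a ≈ b)).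
Coercion evar : var >-> expr.
Notation "s ≡ t" := (eeq s t) (at level 70, no associativity) : zf_scope.

Definition IsBooleanAlgebra (B add mul neg zero one : var) : hform :=
  let p s t := eop2 add s t in
  let m s t := eop2 mul s t in
  let c s := eop1 neg s in
  (∃ P, IsProd P B B ∧ IsFun add P B ∧ IsFun mul P B)
  ∧ IsFun neg B B ∧ zero ∈ B ∧ one ∈ B
  ∧ (∀ x ∈ B, ∀ y ∈ B, ∀ z ∈ B,
       p x (p y z) ≡ p (p x y) z ∧ m x (m y z) ≡ m (m x y) z
       ∧ p x y ≡ p y x           ∧ m x y ≡ m y x
       ∧ p x (m x y) ≡ x         ∧ m x (p x y) ≡ x
       ∧ m x (p y z) ≡ p (m x y) (m x z)
       ∧ p x (m y z) ≡ m (p x y) (p x z)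
       ∧ p x (c x) ≡ one         ∧ m x (c x) ≡ zero).

Definition BA_lt (mul x y : var) : hform := x ≡ eop2 mul x y ∧ ¬ x ≈ y.

(* On ω, membership is the strict order. *)
Definition IsTower (B mul t : var) : hform :=
  ∃ w, IsOmega w ∧ IsFun t w B
  ∧ (∀ n ∈ w, ∀ m ∈ w, m ∈ n ⇒
       ∃ a, ∃ b, App t m a ∧ App t n b ∧ BA_lt mul b a).

Definition EveryInfiniteBAHasTower : hform :=
  ∀ B, ∀ add, ∀ mul, ∀ neg, ∀ zero, ∀ one,
    IsBooleanAlgebra B add mul neg zero one ⇒ Infinite B ⇒
    ∃ t, IsTower B mul t.

Definition EveryInfiniteDenumUnionBAHasTower : hform :=
  ∀ B, ∀ add, ∀ mul, ∀ neg, ∀ zero, ∀ one,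
    IsBooleanAlgebra B add mul neg zero one ⇒ Infinite B ⇒
    DenumUnionOfFinite B ⇒
    ∃ t, IsTower B mul t.

Definition IsFinitePowerset (P X : var) : hform :=
  ∀ x, x ∈ P ⇔ (Subset x X ∧ Finite x).

Definition IQDI : hform :=
  ∀ X, Infinite X ⇒
    ∃ P, IsFinitePowerset P X ∧ ∃ D, Subset D P ∧ Denumerable D.

Definition AtLeastTwo (A : var) : hform := ∃ x ∈ A, ∃ y ∈ A, ¬ x ≈ y.
Definition ProperSubset (A B : var) : hform := Subset A B ∧ ¬ A ≈ B.

Definition QPKW : hform :=
  ∀ J, ∀ A, Infinite J ⇒ IsFamily A J ⇒
    (∀ j ∈ J, ∃ a, App A j a ∧ Finite a ∧ AtLeastTwo a) ⇒
    CountableUnionOfFinite J ⇒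
    ∃ I, ∃ B, Subset I J ∧ Infinite I ∧ IsFamily B I
    ∧ (∀ j ∈ I, ∃ a, ∃ b, App A j a ∧ App B j b
                          ∧ Nonempty b ∧ ProperSubset b a).

(* O is a topology on X, given as its set of open sets. *)
Definition IsTopology (X O : var) : hform :=
  (∀ U ∈ O, Subset U X) ∧ X ∈ O ∧ (∃ e ∈ O, IsEmpty e)
  ∧ (∀ U ∈ O, ∀ V ∈ O, ∃ W ∈ O, IsInter2 W U V)
  ∧ (∀ F, Subset F O ⇒ ∃ W ∈ O, IsUnion W F).

Definition IsClosure (X O C A : var) : hform :=
  ∀ x, x ∈ C ⇔ (x ∈ X ∧ ∀ U ∈ O, x ∈ U ⇒ ∃ y, y ∈ U ∧ y ∈ A).
Definition IsInterior (X O I A : var) : hform :=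
  ∀ x, x ∈ I ⇔ (x ∈ X ∧ ∃ U ∈ O, x ∈ U ∧ Subset U A).
Definition RegularOpen (X O U : var) : hform :=
  Subset U X ∧ ∃ C, IsClosure X O C U ∧ IsInterior X O U C.
Definition Dense (X O D : var) : hform :=
  Subset D X ∧ IsClosure X O X D.

Definition Cellular (O C : var) : hform :=
  (∀ U ∈ C, U ∈ O ∧ Nonempty U)
  ∧ (∀ U ∈ C, ∀ V ∈ C, ¬ U ≈ V ⇒ Disjoint U V).

Definition IsRegularMatrix (X O M : var) : hform :=
  ∃ w, IsOmega w ∧ IsFamily M w
  ∧ (∀ n ∈ w, ∃ C, App M n C ∧ Finite C ∧ Cellular O C
       ∧ (∀ U ∈ C, RegularOpen X O U)
       ∧ ∃ D, IsUnion D C ∧ Dense X O D)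
  ∧ (∀ m ∈ w, ∀ n ∈ w, ¬ m ≈ n ⇒ ¬ ∃ C, App M m C ∧ App M n C).

Definition RegularMatrixGivesDenumerableCellularFamily : hform :=
  ∀ X, ∀ O, IsTopology X O ⇒
    (∃ M, IsRegularMatrix X O M) ⇒
    ∃ C, Cellular O C ∧ Denumerable C.

(* Main.v *)
(** By the completeness theorem for the calculus [prv] (Henkin's construction), it
    suffices to show that the three implications hold in every model of ZF. Inside a
    model one can reason with ordinary logic, even with choice for elements of the model;
    only separation and replacement are restricted, to predicates that are definable
    with parameters.

    In a model, [IQDI] or a regular matrix yields an injective sequence [(F_n)] of finite
    subsets of an infinite Boolean algebra [B] (for a matrix, [B] is the algebra of
    regular open sets). The subalgebra [B_n] generated by [F_0, ..., F_n] is finite, and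
    the union of the increasing chain [(B_n)] is infinite; this gives (i). For (ii) and
    (iii), let [J] consist of the pairs [(n, a)] with [a] an atom of [B_n] but not of
    [B_(n+1)], and apply [QPKW] to the sets of atoms of [B_(n+1)] below [a]. The join
    [c_n] of all the atoms selected at level [n] lies in [B_(n+1)], and not in [B_n] if
    anything was selected, since at every selected [(n, a)] some atom below [a] is
    omitted. So [(c_n)] takes infinitely many values. Given [t] such that [(t c_n)] takes
    infinitely many values, one of [t c_n], [t (- c_n)] has the same property for the
    least [n] with [t c_n] distinct from [0] and [t]; iterating this from [1] defines a
    tower without any choice. For (iii), the differences of consecutive members of the
    tower form the cellular family. *)

From Stdlib Require Import List Lia PeanoNat Cantor.
From Stdlib Require Import Classical ClassicalEpsilon FunctionalExtensionality PropExtensionality.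
Require Import Defs.
Import ListNotations.

Set Implicit Arguments.

(** * Completeness of the calculus *)

(** The obstacle is that a sequence built inside a model must be a set of that model, so each of its
    steps has to come from a definable function; choices made outside cannot be repeated along the
    model's [om], which may contain nonstandard numbers. Canonical objects therefore replace
    arbitrary ones: the intersection of all subalgebras instead of some finite subalgebra, the least
    upper bound inside a finite subalgebra instead of an iterated join, the least suitable index.
    For the same reason induction along [om] is restricted to definable predicates. Definability is
    treated semantically, as a property of predicates on environments with closure lemmas, so that
    the tactic [dfn] can read it off the shape of a predicate. Boolean algebras are reduced to meet
    and complement: for regular open sets these are simply intersection and exterior, whereas the
    join is not the union. *)

Definition up (s : nat -> nat) : nat -> nat := scons 0 (fun k => S (s k)).

Lemma up_comp s t : (fun k => up s (up t k)) = up (fun k => s (t k)).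
Proof. extensionality k; now destruct k. Qed.

Lemma ren_ren s t f : ren s (ren t f) = ren (fun k => s (t k)) f.
Proof.
  revert s t; induction f; intros s t; simpl; f_equal; auto.
  fold (up t) (up s) (up (fun k => s (t k))).
  now rewrite IHf, up_comp.
Qed.

Lemma ren_id f : ren (fun k => k) f = f.
Proof.
  induction f; simpl; f_equal; auto.
  rewrite <- IHf at 2; f_equal; extensionality k; now destruct k.
Qed.

Lemma ren_subst0 s x f : ren s (subst0 x f) = subst0 (s x) (ren (up s) f).
Proof.
  unfold subst0; rewrite !ren_ren; f_equal.
  extensionality k; now destruct k.
Qed.

(** All free variables of [f] are below this number, so the variable [bound f] is fresh. Under a
    quantifier the indices drop by one, hence [pred]. *)
Fixpoint bound (f : form) : nat :=
  match f with
  | Bot => 0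
  | Eq x y | Mem x y => S (max x y)
  | Imp f g => max (bound f) (bound g)
  | All f => pred (bound f)
  end.

Lemma ren_bound f s t : (forall k, k < bound f -> s k = t k) -> ren s f = ren t f.
Proof.
  revert s t; induction f; intros s t H; simpl in *; auto.
  - f_equal; apply H; lia.
  - f_equal; apply H; lia.
  - f_equal; [apply IHf1 | apply IHf2]; intros; apply H; lia.
  - f_equal; apply IHf; intros [|k] Hk; simpl; auto.
    f_equal; apply H; lia.
Qed.

Fixpoint bounds (G : list form) : nat :=
  match G with [] => 0 | f :: G => max (bound f) (bounds G) end.

Lemma bounds_In f G : In f G -> bound f <= bounds G.
Proof.
  induction G as [|g G IH]; simpl; [easy|].
  intros [<- | H]; [lia | specialize (IH H); lia].
Qed.

Section Derivations.
Context (T : form -> Prop).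

Lemma prv_weak G G' f : prv T G f -> incl G G' -> prv T G' f.
Proof.
  intros H; revert G'; induction H; intros G' HG.
  - now apply prv_ax.
  - apply prv_hyp; auto.
  - apply prv_impI, IHprv; intros h [<- | Hh]; simpl; auto.
  - eapply prv_impE; eauto.
  - apply prv_allI, IHprv; now apply incl_map.
  - apply prv_allE; auto.
  - apply prv_dne; auto.
  - apply prv_refl.
  - eapply prv_eqE; eauto.
Qed.

Lemma prv_ren G f s : prv T G f -> prv T (map (ren s) G) (ren s f).
Proof.
  intros H; revert s; induction H; intros t.
  - rewrite ren_ren; now apply prv_ax.
  - apply prv_hyp; now apply in_map.
  - apply prv_impI; apply (IHprv t).
  - eapply prv_impE; [apply (IHprv1 t) | apply IHprv2].
  - apply prv_allI; fold (up t).
    replace (map (ren S) (map (ren t) G)) with (map (ren (up t)) (map (ren S) G)); auto.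
    rewrite !map_map; apply map_ext; intros h; now rewrite !ren_ren.
  - rewrite ren_subst0; apply prv_allE; apply (IHprv t).
  - apply prv_dne; apply (IHprv t).
  - apply prv_refl.
  - rewrite ren_subst0.
    apply prv_eqE with (t x); [apply (IHprv1 t) | rewrite <- ren_subst0; auto].
Qed.

Lemma prv_exfalso G f : prv T G Bot -> prv T G f.
Proof.
  intros H; apply prv_dne, prv_impI; eapply prv_weak; [exact H | now right].
Qed.

Lemma prv_contra G f : prv T (Imp f Bot :: G) Bot -> prv T G f.
Proof. intros H; now apply prv_dne, prv_impI. Qed.

Lemma prv_cut G f g : prv T G f -> prv T (f :: G) g -> prv T G g.
Proof. intros Hf Hg; eapply prv_impE; [apply prv_impI, Hg | exact Hf]. Qed.

(** Generalization over a named fresh variable, the form that Henkin witnesses need. The axioms of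
    [T] impose no freshness condition, since all their renamings are derivable. *)
Lemma prv_gen G f c : bound f <= S c -> bounds G <= c -> prv T G (subst0 c f) -> prv T G (All f).
Proof.
  intros Hf HG H; apply prv_allI.
  (* This renaming moves [c] to the place of the bound variable and shifts everything else: it
     undoes [subst0 c] on [f] and acts on [G] as [S]. *)
  apply (prv_ren (fun k => if Nat.eq_dec k c then 0 else S k)) in H.
  replace (map (ren S) G) with (map (ren (fun k => if Nat.eq_dec k c then 0 else S k)) G).
  - replace f with (ren (fun k => if Nat.eq_dec k c then 0 else S k) (subst0 c f)); auto.
    rewrite <- (ren_id f) at 2; unfold subst0; rewrite ren_ren; apply ren_bound.
    intros [|k] Hk; simpl; destruct (Nat.eq_dec _ _); lia.
  - apply map_ext_in; intros h Hh; apply ren_bound; intros k Hk.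
    apply bounds_In in Hh; destruct (Nat.eq_dec _ _); lia.
Qed.

End Derivations.

(** The fuel makes the recursion structural. Only surjectivity matters, so [enum] runs through all
    pairs of a fuel and a code. *)
Fixpoint decode (fuel n : nat) : form :=
  match fuel with
  | 0 => Bot
  | S fuel =>
      let (tag, r) := Cantor.of_nat n in
      let (a, b) := Cantor.of_nat r in
      match tag with
      | 0 => Bot
      | 1 => Eq a b
      | 2 => Mem a b
      | 3 => Imp (decode fuel a) (decode fuel b)
      | _ => All (decode fuel a)
      end
  end.

Lemma decode_surj f : exists N n, forall fuel, N <= fuel -> decode fuel n = f.
Proof.
  induction f as [|x y|x y|f [N [n H]] g [N' [n' H']]|f [N [n H]]].
  - exists 1, (Cantor.to_nat (0, 0)); intros [|fuel] ?; [lia|].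
    cbn -[Cantor.of_nat Cantor.to_nat]; now rewrite !Cantor.cancel_of_to.
  - exists 1, (Cantor.to_nat (1, Cantor.to_nat (x, y))); intros [|fuel] ?; [lia|].
    cbn -[Cantor.of_nat Cantor.to_nat]; now rewrite !Cantor.cancel_of_to.
  - exists 1, (Cantor.to_nat (2, Cantor.to_nat (x, y))); intros [|fuel] ?; [lia|].
    cbn -[Cantor.of_nat Cantor.to_nat]; now rewrite !Cantor.cancel_of_to.
  - exists (S (max N N')), (Cantor.to_nat (3, Cantor.to_nat (n, n'))); intros [|fuel] ?; [lia|].
    cbn -[Cantor.of_nat Cantor.to_nat]; rewrite !Cantor.cancel_of_to.
    rewrite H, H'; auto; lia.
  - exists (S N), (Cantor.to_nat (4, Cantor.to_nat (n, 0))); intros [|fuel] ?; [lia|].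
    cbn -[Cantor.of_nat Cantor.to_nat]; rewrite !Cantor.cancel_of_to.
    rewrite H; auto; lia.
Qed.

Definition enum (m : nat) : form := let (fuel, n) := Cantor.of_nat m in decode fuel n.

Lemma enum_surj f : exists m, enum m = f.
Proof.
  destruct (decode_surj f) as [N [n H]].
  exists (Cantor.to_nat (N, n)); unfold enum; rewrite Cantor.cancel_of_to; auto.
Qed.

Definition consD {M : Type} (d : M) (e : nat -> M) : nat -> M :=
  fun k => match k with 0 => d | S j => e j end.

Fixpoint sat {M : Type} (E : M -> M -> Prop) (e : nat -> M) (f : form) : Prop :=
  match f with
  | Bot => False
  | Eq x y => e x = e y
  | Mem x y => E (e x) (e y)
  | Imp f g => sat E e f -> sat E e g
  | All f => forall d, sat E (consD d e) f
  end.

Lemma sat_ren M (E : M -> M -> Prop) f s e : sat E e (ren s f) <-> sat E (fun k => e (s k)) f.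
Proof.
  revert s e; induction f; intros s e; simpl; try tauto.
  - rewrite IHf1, IHf2; tauto.
  - assert (H : forall d, sat E (consD d e) (ren (up s) f) <-> sat E (consD d (fun k => e (s k))) f).
    { intros d; rewrite IHf.
      now replace (fun k => consD d e (up s k)) with (consD d (fun k => e (s k)))
        by (extensionality k; now destruct k). }
    split; intros H' d; apply H, H'.
Qed.

(** * Henkin's construction of a countermodel *)

Section Henkin.
Context (T : form -> Prop) (phi : form).
Context (unprovable : ~ prv T [] phi).

(** A rejected universal statement receives a counterexample at once. Variables serve as the
    witnesses: a stage is a finite list, so [bounds (f :: G)] is always a fresh one. *)
Definition henkin_step (f : form) (G : list form) : list form :=
  if excluded_middle_informative (prv T (f :: G) Bot) then G else
    match f with
    | Imp (All g) Bot => Imp (subst0 (bounds (f :: G)) g) Bot :: f :: G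
    | _ => f :: G
    end.

Fixpoint stage (n : nat) : list form :=
  match n with
  | 0 => [Imp phi Bot]
  | S n => henkin_step (enum n) (stage n)
  end.

Definition henkin (f : form) : Prop := exists n, In f (stage n).

Lemma henkin_step_incl f G : incl G (henkin_step f G).
Proof.
  intros h Hh; unfold henkin_step.
  destruct (excluded_middle_informative _); auto.
  destruct f as [| | |[| | | |g] [| | | |]|]; simpl; auto.
Qed.

(** If the witness made the stage inconsistent, [f :: G] would derive the instance of [g] at a fresh
    variable, hence [All g], which [f] denies. *)
Lemma henkin_step_consistent f G : ~ prv T G Bot -> ~ prv T (henkin_step f G) Bot.
Proof.
  intros HG; unfold henkin_step.
  destruct (excluded_middle_informative _) as [|Hf]; auto.
  destruct f as [| | |[| | | |g] [| | | |]|]; auto.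
  intros H; apply Hf; eapply prv_impE; [apply prv_hyp; now left|].
  apply prv_gen with (bounds (Imp (All g) Bot :: G)); simpl; try lia.
  apply prv_contra, H.
Qed.

Lemma stage_consistent n : ~ prv T (stage n) Bot.
Proof.
  induction n as [|n IH]; simpl.
  - intros H; now apply unprovable, prv_contra.
  - now apply henkin_step_consistent.
Qed.

Lemma stage_mono m n : m <= n -> incl (stage m) (stage n).
Proof.
  induction 1; [apply incl_refl | eapply incl_tran; [eassumption | apply henkin_step_incl]].
Qed.

(** When [f] is enumerated at step [m], refusing it would mean that [f :: stage m] is inconsistent;
    then so would be the stage [max m n], which derives [f]. *)
Lemma henkin_prv n f : prv T (stage n) f -> henkin f.
Proof.
  intros H; destruct (enum_surj f) as [m Hm].
  exists (S m); simpl; unfold henkin_step; rewrite Hm.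
  destruct (excluded_middle_informative _) as [Hi|_].
  - destruct (@stage_consistent (max m n)).
    apply prv_cut with f.
    + eapply prv_weak; [exact H | apply stage_mono; lia].
    + eapply prv_weak; [exact Hi |].
      intros h [<- | Hh]; [now left | right; revert h Hh; apply stage_mono; lia].
  - destruct f as [| | |[| | | |g] [| | | |]|]; simpl; auto.
Qed.

Lemma henkin_closed G f : prv T G f -> (forall h, In h G -> henkin h) -> henkin f.
Proof.
  intros H HG.
  assert (Hn : exists n, incl G (stage n)).
  { clear H; induction G as [|h G IH]; [now exists 0|].
    destruct IH as [n Hn]; [intros; apply HG; now right|].
    destruct (HG h) as [m Hm]; [now left|].
    exists (max m n); intros k [<- | Hk].
    - revert Hm; apply stage_mono; lia.
    - apply Hn in Hk; revert Hk; apply stage_mono; lia. }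
  destruct Hn as [n Hn]; apply (@henkin_prv n); eapply prv_weak; eauto.
Qed.

Lemma henkin_consistent : ~ henkin Bot.
Proof. intros [n Hn]; now apply (@stage_consistent n), prv_hyp. Qed.

Lemma henkin_imp f g : henkin (Imp f g) <-> (henkin f -> henkin g).
Proof.
  split.
  - intros H Hf; apply henkin_closed with [Imp f g; f].
    + eapply prv_impE; apply prv_hyp; simpl; auto.
    + intros h [<- | [<- | []]]; auto.
  - intros H; destruct (classic (henkin f)) as [Hf|Hf].
    + apply henkin_closed with [g]; [apply prv_impI, prv_hyp; simpl; auto|].
      intros h [<- | []]; auto.
    (* A formula that never entered was refused when it was enumerated, so it is refuted by that
       stage and implies everything. *)
    + destruct (enum_surj f) as [m Hm].
      assert (Hi : prv T (f :: stage m) Bot).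
      { apply NNPP; intros Hc; apply Hf; exists (S m); simpl; unfold henkin_step; rewrite Hm.
        destruct (excluded_middle_informative _); [easy|].
        destruct f as [| | |[| | | |k] [| | | |]|]; simpl; auto. }
      apply (@henkin_prv m), prv_impI, prv_exfalso, Hi.
Qed.

Lemma henkin_all g : henkin (All g) <-> forall x, henkin (subst0 x g).
Proof.
  split.
  - intros H x; apply henkin_closed with [All g]; [apply prv_allE, prv_hyp; now left|].
    intros h [<- | []]; auto.
  - intros H; apply NNPP; intros Hg.
    assert (Hn : henkin (Imp (All g) Bot)) by now apply henkin_imp.
    destruct (enum_surj (Imp (All g) Bot)) as [m Hm].
    assert (Hw : exists x, henkin (Imp (subst0 x g) Bot)).
    { exists (bounds (Imp (All g) Bot :: stage m)), (S m); simpl; unfold henkin_step; rewrite Hm.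
      destruct (excluded_middle_informative _) as [Hi|_]; [|now left].
      destruct Hn as [n Hn]; destruct (@stage_consistent (max m n)).
      apply prv_cut with (Imp (All g) Bot).
      - apply prv_hyp; revert Hn; apply stage_mono; lia.
      - eapply prv_weak; [exact Hi|].
        intros h [<- | Hh]; [now left | right; revert h Hh; apply stage_mono; lia]. }
    destruct Hw as [x Hx]; rewrite henkin_imp in Hx.
    now apply henkin_consistent, Hx.
Qed.

Lemma henkin_eqE x y f : henkin (Eq x y) -> henkin (subst0 x f) -> henkin (subst0 y f).
Proof.
  intros H Hf; apply henkin_closed with [Eq x y; subst0 x f].
  - eapply prv_eqE; apply prv_hyp; simpl; auto.
  - intros h [<- | [<- | []]]; auto.
Qed.

Lemma henkin_refl x : henkin (Eq x x).
Proof. apply (@henkin_prv 0), prv_refl. Qed.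

(** Leibniz's rule for the formula [Eq 0 (S x)]: index 0 is the hole, and [S x] is [x] seen under
    it. *)
Lemma henkin_sym x y : henkin (Eq x y) -> henkin (Eq y x).
Proof. intros H; exact (@henkin_eqE x y (Eq 0 (S x)) H (henkin_refl x)). Qed.

Lemma henkin_trans x y z : henkin (Eq x y) -> henkin (Eq y z) -> henkin (Eq x z).
Proof. intros H H'; exact (@henkin_eqE y z (Eq (S x) 0) H' H). Qed.

(* Equality has to be interpreted by genuine equality, so the domain consists of
   chosen representatives of the classes of variables that are provably equal. *)
Definition repr (x : nat) : nat := epsilon (inhabits 0) (fun y => henkin (Eq x y)).

Lemma repr_eq x : henkin (Eq x (repr x)).
Proof. unfold repr; apply epsilon_spec; exists x; apply henkin_refl. Qed.

Lemma repr_ext x y : henkin (Eq x y) -> repr x = repr y.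
Proof.
  intros H; unfold repr; f_equal; extensionality z; apply propositional_extensionality.
  split; intros H'; eapply henkin_trans; eauto using henkin_sym.
Qed.

Definition hdom : Type := {x : nat | repr x = x}.
Definition hcls (x : nat) : hdom := exist _ (repr x) (eq_sym (repr_ext (repr_eq x))).
Definition hmodel (a b : hdom) : Prop := henkin (Mem (proj1_sig a) (proj1_sig b)).

Lemma hcls_eq x y : hcls x = hcls y <-> henkin (Eq x y).
Proof.
  split.
  - intros H; apply (f_equal (@proj1_sig _ _)) in H; simpl in H.
    apply henkin_trans with (repr x); [apply repr_eq | rewrite H; apply henkin_sym, repr_eq].
  - intros H; apply repr_ext in H; apply eq_sig_hprop; [intros; apply proof_irrelevance | exact H].
Qed.

Lemma hcls_surj (d : hdom) : exists x, d = hcls x.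
Proof.
  exists (proj1_sig d); apply eq_sig_hprop; [intros; apply proof_irrelevance|].
  destruct d as [x Hx]; simpl; auto.
Qed.

Lemma hmodel_cls x y : hmodel (hcls x) (hcls y) <-> henkin (Mem x y).
Proof.
  assert (H : forall x x' y y', henkin (Eq x x') -> henkin (Eq y y') -> henkin (Mem x y) -> henkin (Mem x' y')).
  { intros a a' b b' Ha Hb H.
    apply (@henkin_eqE b b' (Mem (S a') 0) Hb).
    exact (@henkin_eqE a a' (Mem 0 (S b)) Ha H). }
  split; apply H; auto using repr_eq, henkin_sym.
Qed.

(** The truth lemma. It is stated for all renamings [s] because the quantifier case extends the
    environment, and every extension is again of this form by [hcls_surj]. *)
Lemma sat_hmodel f s : sat hmodel (fun k => hcls (s k)) f <-> henkin (ren s f).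
Proof.
  revert s; induction f as [| | |f IHf g IHg|f IHf]; intros s; simpl.
  - split; [easy | apply henkin_consistent].
  - apply hcls_eq.
  - apply hmodel_cls.
  - now rewrite IHf, IHg, henkin_imp.
  - rewrite henkin_all.
    assert (H : forall x, sat hmodel (consD (hcls x) (fun k => hcls (s k))) f <->
      henkin (subst0 x (ren (up s) f))).
    { intros x; unfold subst0; rewrite ren_ren, <- IHf.
      now replace (fun k => hcls (scons x (fun k => k) (up s k))) with
        (consD (hcls x) (fun k => hcls (s k))) by (extensionality k; now destruct k). }
    split.
    + intros Ha x; apply H, Ha.
    + intros Ha d; destruct (hcls_surj d) as [x ->]; apply H, Ha.
Qed.

Lemma henkin_theory f (e : nat -> hdom) : T f -> sat hmodel e f.
Proof.
  intros H.
  replace e with (fun k => hcls (proj1_sig (e k))).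
  - apply sat_hmodel, (@henkin_prv 0); now apply prv_ax.
  - extensionality k; destruct (hcls_surj (e k)) as [x ->].
    apply hcls_eq, henkin_sym, repr_eq.
Qed.

Lemma henkin_refutes : ~ sat hmodel hcls phi.
Proof.
  intros H; apply (sat_hmodel phi (fun k => k)) in H; rewrite ren_id in H.
  assert (H' : henkin (Imp phi Bot)) by (exists 0; now left).
  rewrite henkin_imp in H'; now apply henkin_consistent, H'.
Qed.

End Henkin.

Theorem completeness T phi :
  (forall (M : Type) (E : M -> M -> Prop) (e : nat -> M),
     (forall f e', T f -> sat E e' f) -> sat E e phi) ->
  prv T [] phi.
Proof.
  intros H; apply NNPP; intros Hn.
  apply (henkin_refutes Hn), H; intros; now apply henkin_theory.
Qed.

(** * Definable predicates and models of ZF *)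

Section Definability.
Context {M : Type} (E : M -> M -> Prop).

(* Even variables are arguments, odd ones are parameters. *)
Definition mix (e r : nat -> M) : nat -> M :=
  fun k => if Nat.even k then e (Nat.div2 k) else r (Nat.div2 k).

(** Predicates on whole environments allow the closure lemmas to pass under binders. The parameters
    [r] form an infinite sequence, so that two of them can be merged into one by [mix]. *)
Definition definable (P : (nat -> M) -> Prop) : Prop :=
  exists f r, forall e, P e <-> sat E (mix e r) f.

Lemma mix_even e r k : mix e r (2 * k) = e k.
Proof. unfold mix; rewrite Nat.even_even, Nat.div2_double; auto. Qed.

Lemma mix_odd e r k : mix e r (S (2 * k)) = r k.
Proof.
  unfold mix; rewrite <- Nat.add_1_r, Nat.even_odd, Nat.add_1_r, Nat.div2_succ_double; auto.
Qed.

Lemma even_or_odd k : exists j, k = 2 * j \/ k = S (2 * j).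
Proof. destruct (Nat.Even_or_Odd k) as [[j H]|[j H]]; exists j; lia. Qed.

Definition on_even (f : nat -> nat) (g : nat -> nat) (k : nat) : nat :=
  if Nat.even k then f (Nat.div2 k) else g (Nat.div2 k).

Lemma on_even_even f g k : on_even f g (2 * k) = f k.
Proof. unfold on_even; rewrite Nat.even_even, Nat.div2_double; auto. Qed.

Lemma on_even_odd f g k : on_even f g (S (2 * k)) = g k.
Proof.
  unfold on_even; rewrite <- Nat.add_1_r, Nat.even_odd, Nat.add_1_r, Nat.div2_succ_double; auto.
Qed.

Lemma env_on_even (e0 : nat -> M) f g e r :
  (forall k, e0 (f k) = e k) -> (forall k, e0 (g k) = r k) ->
  (fun k => e0 (on_even f g k)) = mix e r.
Proof.
  intros Hf Hg; extensionality k; destruct (even_or_odd k) as [j [-> | ->]].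
  - now rewrite on_even_even, mix_even.
  - now rewrite on_even_odd, mix_odd.
Qed.

Lemma definable_ext P Q : (forall e, P e <-> Q e) -> definable P -> definable Q.
Proof. intros H [f [r Hf]]; exists f, r; intros e; now rewrite <- H. Qed.

Lemma definable_rename P s : definable P -> definable (fun e => P (fun k => e (s k))).
Proof.
  intros [f [r Hf]].
  exists (ren (on_even (fun k => 2 * s k) (fun k => S (2 * k))) f), r; intros e.
  rewrite sat_ren, env_on_even with (e := fun k => e (s k)) (r := r); auto.
  - intros k; apply mix_even.
  - intros k; apply mix_odd.
Qed.

Context (d0 : M).

Lemma definable_bot : definable (fun _ => False).
Proof. exists Bot, (fun _ => d0); now simpl. Qed.

(** Arguments keep their places; the parameters of [f] move to the even positions of [mix r r'] and
    those of [g] to the odd ones. *)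
Lemma definable_imp P Q : definable P -> definable Q -> definable (fun e => P e -> Q e).
Proof.
  intros [f [r Hf]] [g [r' Hg]].
  exists (Imp (ren (on_even (fun k => 2 * k) (fun k => S (2 * (2 * k)))) f)
              (ren (on_even (fun k => 2 * k) (fun k => S (2 * (S (2 * k))))) g)), (mix r r').
  intros e; cbn [sat]; rewrite !sat_ren.
  rewrite env_on_even with (e := e) (r := r), env_on_even with (e := e) (r := r').
  - now rewrite Hf, Hg.
  - intros k; apply mix_even.
  - intros k; cbv beta; rewrite mix_odd; apply mix_odd.
  - intros k; apply mix_even.
  - intros k; cbv beta; rewrite mix_odd; apply mix_even.
Qed.

(** A quantifier puts its value in front of the interleaved environment and so shifts the parity of
    every other variable. This renaming restores the layout in which the new value is argument 0. *)
Definition under (k : nat) : nat := on_even (fun j => match j with 0 => 0 | S i => S (2 * i) end)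
  (fun j => S (S (2 * j))) k.

Lemma env_under d e r : (fun k => consD d (mix e r) (under k)) = mix (consD d e) r.
Proof.
  apply env_on_even.
  - intros [|k]; auto; exact (mix_even e r k).
  - intros k; exact (mix_odd e r k).
Qed.

Lemma definable_all (P : M -> (nat -> M) -> Prop) :
  definable (fun e => P (e 0) (fun k => e (S k))) -> definable (fun e => forall x, P x e).
Proof.
  intros [f [r Hf]]; exists (All (ren under f)), r; intros e; simpl.
  assert (H : forall d, sat E (consD d (mix e r)) (ren under f) <-> P d e).
  { intros d; rewrite sat_ren, env_under, <- Hf; reflexivity. }
  split; intros Ha d; apply H, Ha.
Qed.

(** Whatever [P] says, even about all of Rocq, it is equivalent to true or to false. *)
Lemma definable_const (P : Prop) : definable (fun _ => P).
Proof.
  destruct (classic P) as [H|H].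
  - apply definable_ext with (fun _ => False -> False); [tauto | apply definable_imp; apply definable_bot].
  - apply definable_ext with (fun _ => False); [tauto | apply definable_bot].
Qed.

Lemma definable_not P : definable P -> definable (fun e => ~ P e).
Proof. intros H; apply definable_imp; [exact H | apply definable_bot]. Qed.

Lemma definable_and P Q : definable P -> definable Q -> definable (fun e => P e /\ Q e).
Proof.
  intros HP HQ; apply definable_ext with (fun e => ~ (P e -> ~ Q e)).
  - intros e; tauto.
  - apply definable_not, definable_imp; auto using definable_not.
Qed.

Lemma definable_or P Q : definable P -> definable Q -> definable (fun e => P e \/ Q e).
Proof.
  intros HP HQ; apply definable_ext with (fun e => ~ P e -> Q e).
  - intros e; tauto.
  - apply definable_imp; auto using definable_not.
Qed.

Lemma definable_iff P Q : definable P -> definable Q -> definable (fun e => P e <-> Q e).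
Proof. intros HP HQ; apply definable_and; apply definable_imp; auto. Qed.

Lemma definable_ex (P : M -> (nat -> M) -> Prop) :
  definable (fun e => P (e 0) (fun k => e (S k))) -> definable (fun e => exists x, P x e).
Proof.
  intros H; apply definable_ext with (fun e => ~ forall x, ~ P x e).
  - intros e; split.
    + intros Hn; apply NNPP; intros Hx; apply Hn; intros x Hp; eauto.
    + intros [x Hx] Hn; exact (Hn x Hx).
  - apply definable_not, definable_all with (P := fun x e => ~ P x e), definable_not, H.
Qed.

(** The language has no function symbols, so a term is given by its graph, with the value in
    variable 0. Substituting a term into a predicate accordingly costs an existential quantifier. *)
Definition definable_term (t : (nat -> M) -> M) : Prop :=
  definable (fun e => e 0 = t (fun k => e (S k))).

Definition definable_pred1 (R : M -> Prop) : Prop := definable (fun e => R (e 0)).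
Definition definable_pred2 (R : M -> M -> Prop) : Prop := definable (fun e => R (e 0) (e 1)).
Definition definable_pred3 (R : M -> M -> M -> Prop) : Prop :=
  definable (fun e => R (e 0) (e 1) (e 2)).
Definition definable_fun1 (F : M -> M) : Prop := definable_term (fun e => F (e 0)).
Definition definable_fun2 (F : M -> M -> M) : Prop := definable_term (fun e => F (e 0) (e 1)).

Lemma definable_eq_var x y : definable (fun e => e x = e y).
Proof. exists (Eq (2 * x) (2 * y)), (fun _ => d0); intros e; cbn [sat]; now rewrite !mix_even. Qed.

Lemma definable_mem : definable_pred2 E.
Proof. exists (Mem (2 * 0) (2 * 1)), (fun _ => d0); intros e; cbn [sat]; now rewrite !mix_even. Qed.

Lemma definable_term_var k : definable_term (fun e => e k).
Proof. apply definable_eq_var with (x := 0) (y := S k). Qed.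

Lemma definable_term_const c : definable_term (fun _ => c).
Proof.
  exists (Eq (2 * 0) (S (2 * 0))), (fun _ => c); intros e; cbn [sat].
  now rewrite mix_even, mix_odd.
Qed.

Lemma definable_comp1 R t : definable_pred1 R -> definable_term t -> definable (fun e => R (t e)).
Proof.
  intros HR Ht; apply definable_ext with (fun e => exists x, x = t e /\ R x).
  - intros e; split; [now intros [x [-> H]] | eauto].
  - apply definable_ex with (P := fun x e => x = t e /\ R x), definable_and; auto.
Qed.

Lemma definable_comp2 R s t : definable_pred2 R -> definable_term s -> definable_term t ->
  definable (fun e => R (s e) (t e)).
Proof.
  intros HR Hs Ht; apply definable_ext with (fun e => exists x, x = s e /\ exists y, y = t e /\ R x y).
  - intros e; split; [now intros [x [-> [y [-> H]]]] | intros H; exists (s e); eauto].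
  - apply definable_ex with (P := fun x e => x = s e /\ exists y, y = t e /\ R x y), definable_and; auto.
    apply definable_ex with (P := fun y e => y = t (fun k => e (S k)) /\ R (e 0) y), definable_and.
    + exact (definable_rename (fun k => match k with 0 => 0 | S j => S (S j) end) Ht).
    + exact (definable_rename (fun k => match k with 0 => 1 | _ => 0 end) HR).
Qed.

Lemma definable_comp3 R s t u : definable_pred3 R ->
  definable_term s -> definable_term t -> definable_term u ->
  definable (fun e => R (s e) (t e) (u e)).
Proof.
  intros HR Hs Ht Hu.
  apply definable_ext with (fun e => exists x, x = s e /\ exists y, y = t e /\ exists z, z = u e /\ R x y z).
  - intros e; split; [now intros [x [-> [y [-> [z [-> H]]]]]] |].
    intros H; exists (s e); split; auto; exists (t e); eauto.
  - apply definable_ex with (P := fun x e => x = s e /\ exists y, y = t e /\ exists z, z = u e /\ R x y z).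
    apply definable_and; auto.
    apply definable_ex with
      (P := fun y e => y = t (fun k => e (S k)) /\ exists z, z = u (fun k => e (S k)) /\ R (e 0) y z).
    apply definable_and.
    { exact (definable_rename (fun k => match k with 0 => 0 | S j => S (S j) end) Ht). }
    apply definable_ex with (P := fun z e => z = u (fun k => e (S (S k))) /\ R (e 1) (e 0) z).
    apply definable_and.
    + exact (definable_rename (fun k => match k with 0 => 0 | S j => S (S (S j)) end) Hu).
    + exact (definable_rename (fun k => match k with 0 => 2 | 1 => 1 | _ => 0 end) HR).
Qed.

Lemma definable_eq : definable_pred2 eq.
Proof. apply definable_eq_var. Qed.

Lemma definable_term_comp1 F t : definable_fun1 F -> definable_term t -> definable_term (fun e => F (t e)).
Proof.
  intros HF Ht; unfold definable_term.
  apply definable_comp2 with (R := fun y x => y = F x) (s := fun e => e 0) (t := fun e => t (fun k => e (S k))).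
  - exact HF.
  - apply definable_term_var.
  - exact (definable_rename (fun k => match k with 0 => 0 | S j => S (S j) end) Ht).
Qed.

Lemma definable_term_comp2 F s t : definable_fun2 F -> definable_term s -> definable_term t ->
  definable_term (fun e => F (s e) (t e)).
Proof.
  intros HF Hs Ht; unfold definable_term.
  apply definable_comp3 with (R := fun z x y => z = F x y) (s := fun e => e 0)
    (t := fun e => s (fun k => e (S k))) (u := fun e => t (fun k => e (S k))).
  - exact HF.
  - apply definable_term_var.
  - exact (definable_rename (fun k => match k with 0 => 0 | S j => S (S j) end) Hs).
  - exact (definable_rename (fun k => match k with 0 => 0 | S j => S (S j) end) Ht).
Qed.

(* The unique [y] with [P y], and [d0] if there is none. *)
Definition the_default (P : M -> Prop) : M :=
  epsilon (inhabits d0) (fun y => (P y /\ forall z, P z -> z = y)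
    \/ (y = d0 /\ ~ exists x, P x /\ forall z, P z -> z = x)).

Lemma the_default_spec P y : y = the_default P <->
  (P y /\ forall z, P z -> z = y) \/ (y = d0 /\ ~ exists x, P x /\ forall z, P z -> z = x).
Proof.
  set (Q := fun y => (P y /\ forall z, P z -> z = y)
    \/ (y = d0 /\ ~ exists x, P x /\ forall z, P z -> z = x)).
  assert (HQ : Q (the_default P)).
  { apply (epsilon_spec (inhabits d0) Q).
    destruct (classic (exists x, P x /\ forall z, P z -> z = x)) as [[x Hx]|H].
    - exists x; now left.
    - exists d0; now right. }
  split; [now intros -> |].
  unfold Q in HQ; intros [[Hy Hu]|[-> Hn]]; destruct HQ as [[H1 H2]|[H1 H2]]; auto.
  - destruct H2; eauto.
  - destruct Hn; eauto.
Qed.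

Lemma definable_the (P : M -> (nat -> M) -> Prop) :
  definable (fun e => P (e 0) (fun k => e (S k))) ->
  definable_term (fun e => the_default (fun y => P y e)).
Proof.
  intros HP.
  assert (Hu : definable (fun e => forall z, P z (fun k => e (S k)) -> z = e 0)).
  { apply definable_all with (P := fun z e => P z (fun k => e (S k)) -> z = e 0), definable_imp.
    - exact (definable_rename (fun k => match k with 0 => 0 | S j => S (S j) end) HP).
    - apply definable_eq_var. }
  unfold definable_term; eapply definable_ext; [intros e; symmetry; apply the_default_spec|].
  apply definable_or; apply definable_and; auto.
  - exact (definable_comp2 definable_eq (definable_term_var 0) (definable_term_const d0)).
  - apply definable_not.
    apply definable_ex with
      (P := fun x e => P x (fun k => e (S k)) /\ forall z, P z (fun k => e (S k)) -> z = x).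
    apply (definable_rename (P := fun e => P (e 0) (fun k => e (S k)) /\ forall z, P z (fun k => e (S k)) -> z = e 0)
      (fun k => match k with 0 => 0 | S j => S (S j) end)), definable_and; auto.
Qed.

End Definability.

Record zf_model := {
  dom :> Type;
  mem : dom -> dom -> Prop;
  d0 : dom;
  zf_ext : forall x y, (forall z, mem z x <-> mem z y) -> x = y;
  zf_pair : forall x y, exists p, forall z, mem z p <-> z = x \/ z = y;
  zf_union : forall F, exists U, forall x, mem x U <-> exists A, mem A F /\ mem x A;
  zf_power : forall A, exists P, forall x, mem x P <-> forall z, mem z x -> mem z A;
  zf_infinity : exists I, (exists e, mem e I /\ forall z, ~ mem z e) /\
    forall x, mem x I -> exists s, mem s I /\ forall z, mem z s <-> mem z x \/ z = x;
  zf_separation : forall P, definable_pred1 mem P ->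
    forall A, exists B, forall x, mem x B <-> mem x A /\ P x;
  zf_replacement : forall R, definable_pred2 mem R ->
    (forall x y z, R x y -> R x z -> y = z) ->
    forall A, exists B, forall y, mem y B <-> exists x, mem x A /\ R x y
}.
Arguments mem {_} _ _.
Arguments d0 {_}.

(** * Set theory in a model *)

Unset Strict Implicit.
Create HintDb dfn discriminated.

Declare Scope model_scope.
Notation "x ∈ y" := (mem x y) (at level 70, no associativity) : model_scope.
Notation "x ∉ y" := (~ mem x y) (at level 70, no associativity) : model_scope.
Notation dpred1 := (definable_pred1 mem).
Notation dpred2 := (definable_pred2 mem).
Notation dpred3 := (definable_pred3 mem).
Notation dfun1 := (definable_fun1 mem).
Notation dfun2 := (definable_fun2 mem).
Notation dterm := (definable_term mem).
Notation the := (the_default d0).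
Local Open Scope model_scope.

#[export] Hint Resolve definable_eq definable_mem : dfn.

Ltac dfn_hint := solve [ assumption | auto 3 using d0 with dfn ].

(* Redefined below, once the binders [sep] and [img] are available. *)
Ltac dfn_binder_term := fail.

(** Second-order patterns expose how a predicate depends on the environment. The constant case
    precedes the connectives, so that a part free of [e] is settled at once; relations and functions
    with a name are looked up among the hints. *)
Ltac dfn :=
  cbv beta;
  match goal with
  | |- definable_pred1 _ _ => unfold definable_pred1; dfn
  | |- definable_pred2 _ _ => unfold definable_pred2; dfn
  | |- definable_pred3 _ _ => unfold definable_pred3; dfn
  | |- definable_fun1 _ _ => unfold definable_fun1; dfn
  | |- definable_fun2 _ _ => unfold definable_fun2; dfn
  | |- definable _ (fun _ => ?P) => exact (definable_const _ d0 P)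
  | |- definable _ (fun e => @?P e /\ @?Q e) => apply (definable_and d0); dfn
  | |- definable _ (fun e => @?P e \/ @?Q e) => apply (definable_or d0); dfn
  | |- definable _ (fun e => @?P e <-> @?Q e) => apply (definable_iff d0); dfn
  | |- definable _ (fun e => ~ @?P e) => apply (definable_not d0); dfn
  | |- definable _ (fun e => @?P e -> @?Q e) => apply definable_imp; dfn
  | |- definable _ (fun e => ex _) => apply (definable_ex d0); dfn
  | |- definable _ (fun e => forall x, _) => apply definable_all; dfn
  | |- definable _ (fun e => ?R (@?s e) (@?t e) (@?u e)) =>
      apply (@definable_comp3 _ _ d0 R); [dfn_hint | dfn ..]
  | |- definable _ (fun e => ?R (@?s e) (@?t e)) =>
      apply (@definable_comp2 _ _ d0 R); [dfn_hint | dfn ..]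
  | |- definable _ (fun e => ?R (@?s e)) =>
      apply (@definable_comp1 _ _ d0 R); [dfn_hint | dfn ..]
  | |- definable_term _ (fun e => e _) => apply (definable_term_var _ d0)
  | |- definable_term _ (fun _ => ?c) => exact (definable_term_const _ c)
  | |- definable_term _ (fun e => the_default _ _) => apply (definable_the d0); dfn
  | |- definable_term _ _ => dfn_binder_term; dfn
  | |- definable_term _ (fun e => ?F (@?s e) (@?t e)) =>
      apply (@definable_term_comp2 _ _ d0 F); [dfn_hint | dfn ..]
  | |- definable_term _ (fun e => ?F (@?s e)) =>
      apply (@definable_term_comp1 _ _ d0 F); [dfn_hint | dfn ..]
  end.

Section SetTheory.
Context {M : zf_model}.
Implicit Types x y z A B p n m : M.

Lemma the_eq (P : M -> Prop) y : P y -> (forall z, P z -> z = y) -> the P = y.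
Proof. intros H Hu; symmetry; apply the_default_spec; auto. Qed.

Definition sub A B : Prop := forall x, x ∈ A -> x ∈ B.
Lemma dpred_sub : dpred2 sub. Proof. unfold sub; dfn. Qed.

Lemma the_set (P : M -> Prop) : (exists A, forall x, x ∈ A <-> P x) ->
  forall x, x ∈ the (fun A => forall x, x ∈ A <-> P x) <-> P x.
Proof.
  intros [A HA] x.
  rewrite (@the_eq (fun A => forall x, x ∈ A <-> P x) A); auto.
  intros B HB; apply zf_ext; intros z; now rewrite HA, HB.
Qed.

(** Total in [P]: for a predicate that is not definable the set may fail to exist, and then the
    value is [d0]. Hence the hypothesis of [in_sep]. *)
Definition sep A (P : M -> Prop) : M := the (fun B => forall x, x ∈ B <-> x ∈ A /\ P x).
Lemma in_sep A P x : dpred1 P -> x ∈ sep A P <-> x ∈ A /\ P x.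
Proof. intros HP; unfold sep; rewrite the_set; [reflexivity | now apply (zf_separation M)]. Qed.
(** In the body, variables 0 and 1 are the tested element and the set being described; the renamings
    shift the other variables past them. *)
Lemma dterm_sep t (P : M -> (nat -> M) -> Prop) :
  dterm t -> definable mem (fun e => P (e 0) (fun k => e (S k))) ->
  dterm (fun e => sep (t e) (fun x => P x e)).
Proof.
  intros Ht HP; unfold sep; apply (definable_the d0), definable_all, (definable_iff d0); [dfn|].
  apply (definable_and d0).
  - apply (@definable_comp2 _ _ d0 mem); [dfn_hint | dfn |].
    exact (definable_rename (fun k => match k with 0 => 0 | S j => S (S (S j)) end) Ht).
  - exact (definable_rename (fun k => match k with 0 => 0 | S j => S (S j) end) HP).
Qed.

Definition img (F : M -> M) A : M := the (fun B => forall y, y ∈ B <-> exists x, x ∈ A /\ y = F x).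
Lemma in_img F A y : dfun1 F -> y ∈ img F A <-> exists x, x ∈ A /\ y = F x.
Proof.
  intros HF; unfold img; rewrite the_set; [reflexivity|].
  apply (@zf_replacement M (fun x y => y = F x)); [dfn | congruence].
Qed.
Lemma dterm_img t (F : M -> (nat -> M) -> M) :
  dterm t -> dterm (fun e => F (e 0) (fun k => e (S k))) ->
  dterm (fun e => img (fun x => F x e) (t e)).
Proof.
  intros Ht HF; unfold img; apply (definable_the d0), definable_all, (definable_iff d0); [dfn|].
  apply (definable_ex d0), (definable_and d0).
  - apply (@definable_comp2 _ _ d0 mem); [dfn_hint | dfn |].
    exact (definable_rename (fun k => match k with 0 => 0 | S j => S (S (S (S j))) end) Ht).
  - exact (definable_rename (fun k => match k with 0 => 1 | 1 => 0 | S (S j) => S (S (S j)) end) HF).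
Qed.

End SetTheory.

Ltac dfn_binder_term ::=
  match goal with
  | |- definable_term _ (fun e => sep _ _) => apply dterm_sep
  | |- definable_term _ (fun e => img _ _) => apply dterm_img
  end.
#[export] Hint Resolve dpred_sub : dfn.

Section SetTheory.
Context {M : zf_model}.
Implicit Types f x y z A B p n m : M.

Definition emp : M := the (fun A => forall x, x ∈ A <-> False).
Lemma in_emp x : x ∈ emp -> False.
Proof.
  intros H; unfold emp in H; apply (@the_set M (fun _ => False)) in H; auto.
  destruct (zf_infinity M) as [I [[e [_ He]] _]]; exists e; intros z; split; [apply He | easy].
Qed.

Definition upair x y : M := the (fun p => forall z, z ∈ p <-> z = x \/ z = y).
Lemma in_upair x y z : z ∈ upair x y <-> z = x \/ z = y.
Proof. unfold upair; rewrite the_set; [reflexivity | apply zf_pair]. Qed.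
Lemma dfun_upair : dfun2 upair. Proof. unfold upair; dfn. Qed.

Definition union A : M := the (fun U => forall x, x ∈ U <-> exists B, B ∈ A /\ x ∈ B).
Lemma in_union A x : x ∈ union A <-> exists B, B ∈ A /\ x ∈ B.
Proof. unfold union; rewrite the_set; [reflexivity | apply zf_union]. Qed.
Lemma dfun_union : dfun1 union. Proof. unfold union; dfn. Qed.

Definition power A : M := the (fun P => forall x, x ∈ P <-> sub x A).
Lemma in_power A x : x ∈ power A <-> sub x A.
Proof. unfold power; rewrite the_set; [reflexivity | apply zf_power]. Qed.
Lemma dfun_power : dfun1 power. Proof. unfold power; dfn. Qed.

Hint Resolve dfun_upair dfun_union dfun_power : dfn.

Definition cup A B : M := union (upair A B).
Lemma in_cup A B x : x ∈ cup A B <-> x ∈ A \/ x ∈ B.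
Proof.
  unfold cup; rewrite in_union; split.
  - intros [C [HC Hx]]; apply in_upair in HC as [-> | ->]; auto.
  - intros [H | H]; [exists A | exists B]; rewrite in_upair; auto.
Qed.
Lemma dfun_cup : dfun2 cup. Proof. unfold cup; dfn. Qed.

Definition add A x : M := cup A (upair x x).
Lemma in_add A x y : y ∈ add A x <-> y ∈ A \/ y = x.
Proof. unfold add; rewrite in_cup, in_upair; tauto. Qed.
Hint Resolve dfun_cup : dfn.
Lemma dfun_add : dfun2 add. Proof. unfold add; dfn. Qed.

Definition pair x y : M := upair (upair x x) (upair x y).
Lemma dfun_pair : dfun2 pair. Proof. unfold pair; dfn. Qed.
Lemma pair_inj x y x' y' : pair x y = pair x' y' -> x = x' /\ y = y'.
Proof.
  intros H.
  assert (H1 : upair x x = upair x' x' \/ upair x x = upair x' y').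
  { apply in_upair; fold (pair x' y'); rewrite <- H; apply in_upair; auto. }
  assert (H2 : upair x y = upair x' x' \/ upair x y = upair x' y').
  { apply in_upair; fold (pair x' y'); rewrite <- H; apply in_upair; auto. }
  assert (H3 : upair x' y' = upair x x \/ upair x' y' = upair x y).
  { apply in_upair; fold (pair x y); rewrite H; apply in_upair; auto. }
  assert (Hx : x = x').
  { assert (Hx : x' ∈ upair x x) by (destruct H1 as [-> | ->]; apply in_upair; auto).
    apply in_upair in Hx as [-> | ->]; auto. }
  subst x'; split; auto.
  assert (Hy : y = x \/ y = y').
  { apply (in_upair x y'); destruct H2 as [H2 | H2].
    - assert (Hy : y ∈ upair x x) by (rewrite <- H2; apply in_upair; auto).
      apply in_upair in Hy; apply in_upair; tauto.
    - rewrite <- H2; apply in_upair; auto. }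
  assert (Hy' : y' = x \/ y' = y).
  { apply (in_upair x y); destruct H3 as [H3 | H3].
    - assert (Hy' : y' ∈ upair x x) by (rewrite <- H3; apply in_upair; auto).
      apply in_upair in Hy'; apply in_upair; tauto.
    - rewrite <- H3; apply in_upair; auto. }
  intuition congruence.
Qed.

Definition app f x : M := the (fun y => pair x y ∈ f).
Hint Resolve dfun_add dfun_pair : dfn.
Lemma dfun_app : dfun2 app. Proof. unfold app; dfn. Qed.

Definition lam A (F : M -> M) : M := img (fun x => pair x (F x)) A.
Lemma in_lam A F p : dfun1 F -> p ∈ lam A F <-> exists x, x ∈ A /\ p = pair x (F x).
Proof. intros HF; unfold lam; rewrite in_img by dfn; reflexivity. Qed.
Lemma app_lam A F x : dfun1 F -> x ∈ A -> app (lam A F) x = F x.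
Proof.
  intros HF Hx; apply the_eq.
  - apply in_lam; eauto.
  - intros z Hz; apply in_lam in Hz as [x' [_ Hp]]; auto.
    now apply pair_inj in Hp as [<- ->].
Qed.
Hint Resolve dfun_app : dfn.

End SetTheory.
#[export] Hint Resolve dfun_upair dfun_union dfun_power dfun_cup dfun_add dfun_pair dfun_app : dfn.

(** * The natural numbers of a model: induction, order, recursion *)

Section Omega.
Context {M : zf_model}.
Implicit Types f x y z A B p n m : M.

Definition suc n : M := add n n.
Lemma dfun_suc : dfun1 suc. Proof. unfold suc; dfn. Qed.
Hint Resolve dfun_suc : dfn.
Lemma in_suc n x : x ∈ suc n <-> x ∈ n \/ x = n.
Proof. apply in_add. Qed.
Lemma suc_refl n : n ∈ suc n.
Proof. apply in_suc; auto. Qed.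

Definition inductive I : Prop := emp ∈ I /\ forall x, x ∈ I -> suc x ∈ I.
Lemma dpred_inductive : dpred1 inductive. Proof. unfold inductive; dfn. Qed.
Hint Resolve dpred_inductive : dfn.

Definition om : M := the (fun w => forall x, x ∈ w <-> forall I, inductive I -> x ∈ I).
Lemma in_om x : x ∈ om <-> forall I, inductive I -> x ∈ I.
Proof.
  unfold om; rewrite the_set; [reflexivity|].
  destruct (zf_infinity M) as [I [[e [HeI He]] HI]].
  assert (H : inductive I).
  { split.
    - replace emp with e; auto; apply zf_ext; intros z.
      split; intros Hz; [destruct (He _ Hz) | destruct (in_emp Hz)].
    - intros y Hy; destruct (HI y Hy) as [s [Hs Hz]].
      replace (suc y) with s; auto; apply zf_ext; intros z; now rewrite Hz, in_suc. }
  exists (sep I (fun y => forall I, inductive I -> y ∈ I)); intros y.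
  rewrite in_sep by dfn; intuition.
Qed.

Lemma om_emp : emp ∈ om.
Proof. apply in_om; intros I [H _]; exact H. Qed.
Lemma om_suc n : n ∈ om -> suc n ∈ om.
Proof. rewrite !in_om; intros H I HI; apply HI, H, HI. Qed.

(** [P] must cut out a set, since [om] is contained only in those inductive classes that are sets of
    the model. *)
Lemma om_ind (P : M -> Prop) : dpred1 P ->
  P emp -> (forall n, n ∈ om -> P n -> P (suc n)) -> forall n, n ∈ om -> P n.
Proof.
  intros HP H0 HS n Hn.
  assert (H : inductive (sep om P)).
  { split; [apply in_sep; auto using om_emp|].
    intros x; rewrite !in_sep by auto; intros [Hx Hp]; auto using om_suc. }
  rewrite in_om in Hn; apply Hn, in_sep in H; tauto.
Qed.

Lemma om_trans n : n ∈ om -> forall m x, m ∈ n -> x ∈ m -> x ∈ n.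
Proof.
  revert n; apply (@om_ind (fun n => forall m x, m ∈ n -> x ∈ m -> x ∈ n)); [dfn| |].
  - intros m x H; destruct (in_emp H).
  - intros n Hn IH m x; rewrite !in_suc; intros [Hm | ->] Hx; eauto.
Qed.

Lemma om_down n : n ∈ om -> forall m, m ∈ n -> m ∈ om.
Proof.
  revert n; apply (@om_ind (fun n => forall m, m ∈ n -> m ∈ om)); [dfn| |].
  - intros m H; destruct (in_emp H).
  - intros n Hn IH m; rewrite in_suc; intros [Hm | ->]; auto.
Qed.

Lemma om_irrefl n : n ∈ om -> n ∈ n -> False.
Proof.
  revert n; apply (@om_ind (fun n => n ∉ n)); [dfn | intros H; exact (in_emp H) |].
  intros n Hn IH H; apply IH.
  apply in_suc in H as [H | H].
  - eapply om_trans; eauto using suc_refl.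
  - rewrite <- H at 2; apply suc_refl.
Qed.

Lemma om_asym m n : n ∈ om -> m ∈ n -> n ∈ m -> False.
Proof. intros Hn H H'; eapply om_irrefl; eauto using om_trans. Qed.

Lemma suc_inj m n : m ∈ om -> n ∈ om -> suc m = suc n -> m = n.
Proof.
  intros Hm Hn H.
  assert (H1 : m ∈ suc n) by (rewrite <- H; apply suc_refl).
  assert (H2 : n ∈ suc m) by (rewrite H; apply suc_refl).
  rewrite in_suc in H1, H2; destruct H1 as [H1|], H2 as [H2|]; auto.
  destruct (om_asym Hn H1 H2).
Qed.

Lemma suc_neq_emp n : suc n = emp -> False.
Proof. intros H; apply (@in_emp M n); rewrite <- H; apply suc_refl. Qed.

Lemma om_emp_min n : n ∈ om -> n = emp \/ emp ∈ n.
Proof.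
  revert n; apply (@om_ind (fun n => n = emp \/ emp ∈ n)); [dfn | auto |].
  intros n Hn [-> | H]; right; apply in_suc; auto.
Qed.

Lemma om_suc_mono n : n ∈ om -> forall m, m ∈ n -> suc m ∈ n \/ suc m = n.
Proof.
  revert n; apply (@om_ind (fun n => forall m, m ∈ n -> suc m ∈ n \/ suc m = n)); [dfn | |].
  - intros m H; destruct (in_emp H).
  - intros n Hn IH m; rewrite !in_suc; intros [H | ->]; auto.
Qed.

Lemma om_total m n : m ∈ om -> n ∈ om -> m ∈ n \/ m = n \/ n ∈ m.
Proof.
  intros Hm; revert n; apply (@om_ind (fun n => m ∈ n \/ m = n \/ n ∈ m)); [dfn | |].
  - destruct (om_emp_min Hm); auto.
  - intros n Hn [H | [-> | H]].
    + left; apply in_suc; auto.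
    + left; apply suc_refl.
    + destruct (om_suc_mono Hm H); auto.
Qed.

Lemma om_least (P : M -> Prop) : dpred1 P -> (exists n, n ∈ om /\ P n) ->
  exists n, n ∈ om /\ P n /\ forall m, m ∈ n -> ~ P m.
Proof.
  intros HP [n [Hn Pn]].
  (* A bound on the witness is introduced so that plain induction on the bound suffices. *)
  enough (H : forall n, n ∈ om -> (exists m, m ∈ n /\ P m) ->
    exists n, n ∈ om /\ P n /\ forall m, m ∈ n -> ~ P m).
  { apply (H (suc n)); [now apply om_suc | exists n; split; auto using suc_refl]. }
  clear n Hn Pn.
  apply (@om_ind (fun n => (exists m, m ∈ n /\ P m) ->
    exists n, n ∈ om /\ P n /\ forall m, m ∈ n -> ~ P m)); [dfn | |].
  - intros [m [H _]]; destruct (in_emp H).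
  - intros n Hn IH [m [Hm Pm]].
    destruct (classic (exists m, m ∈ n /\ P m)) as [H|H]; auto.
    apply in_suc in Hm as [Hm | ->]; [exfalso; eauto|].
    exists n; repeat split; auto; intros m Hm Hp; eauto.
Qed.

(* The approximations up to [n] agree at [n]; [h] takes their common value there. *)
Lemma recursion a (G : M -> M) : dfun1 G ->
  exists h, app h emp = a /\ forall n, n ∈ om -> app h (suc n) = G (app h n).
Proof.
  intros HG.
  (* Only the values of [g] at numbers up to [n] are constrained, so uniqueness is claimed for the
     value at [n] and not for [g]. *)
  pose (approx n g := app g emp = a /\ forall k, k ∈ n -> app g (suc k) = G (app g k)).
  assert (Da : dpred2 approx) by (unfold approx; dfn).
  assert (Huniq : forall n, n ∈ om -> forall g g', approx n g -> approx n g' -> app g n = app g' n).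
  { apply (@om_ind (fun n => forall g g', approx n g -> approx n g' -> app g n = app g' n)); [dfn| |].
    - intros g g' [H _] [H' _]; congruence.
    - intros n Hn IH g g' [H Hs] [H' Hs'].
      rewrite Hs, Hs' by apply suc_refl; f_equal; apply IH; split; auto;
        intros k Hk; [apply Hs | apply Hs']; apply in_suc; auto. }
  assert (Hex : forall n, n ∈ om -> exists g, approx n g).
  { apply (@om_ind (fun n => exists g, approx n g)); [dfn | |].
    - exists (lam (suc emp) (fun _ => a)); split.
      + apply app_lam; [dfn | apply suc_refl].
      + intros k Hk; destruct (in_emp Hk).
    - intros n Hn [g [H Hs]].
      pose (F := fun k => the (fun y => (k = suc n /\ y = G (app g n)) \/ (k <> suc n /\ y = app g k))).
      assert (DF : dfun1 F) by (unfold F; dfn).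
      assert (F1 : F (suc n) = G (app g n)).
      { apply the_eq; intuition. }
      assert (F2 : forall k, k <> suc n -> F k = app g k).
      { intros k Hk; apply the_eq; intuition. }
      (* The domain is {0, ..., n + 1}, all that an approximation up to [suc n] has to cover. *)
      exists (lam (suc (suc n)) F); split.
      + rewrite app_lam; auto.
        * rewrite F2; auto; intros E; symmetry in E; exact (suc_neq_emp E).
        * destruct (@om_emp_min (suc (suc n))) as [E|E]; auto using om_suc.
          destruct (suc_neq_emp E).
      + intros k Hk.
        assert (Hko : k ∈ om) by (eapply om_down; [|eauto]; auto using om_suc).
        assert (Hks : k <> suc n) by (intros ->; eapply om_irrefl; [|eauto]; auto using om_suc).
        rewrite !app_lam; auto.
        * apply in_suc in Hk as [Hk | ->]; [| rewrite F1, F2; auto].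
          rewrite !F2; auto; intros E; apply suc_inj in E; auto.
          subst k; now apply (om_irrefl Hn).
        * apply in_suc; auto.
        * destruct (@om_suc_mono (suc n) (om_suc Hn) k Hk) as [H1 | ->]; [apply in_suc; auto | apply suc_refl]. }
  pose (H := fun n => the (fun x => exists g, approx n g /\ x = app g n)).
  assert (DH : dfun1 H) by (unfold H; dfn).
  assert (HH : forall n g, n ∈ om -> approx n g -> H n = app g n).
  { intros n g Hn Hg; apply the_eq; [eauto|]; intros z [g' [Hg' ->]]; eauto. }
  exists (lam om H); split.
  - rewrite app_lam by auto using om_emp.
    destruct (Hex emp om_emp) as [g Hg]; rewrite (HH _ _ om_emp Hg); apply Hg.
  - intros n Hn; rewrite !app_lam by auto using om_suc.
    destruct (Hex (suc n) (om_suc Hn)) as [g Hg].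
    assert (Hg' : approx n g) by (destruct Hg as [H1 H2]; split; auto; intros k Hk; apply H2, in_suc; auto).
    rewrite (HH _ _ (om_suc Hn) Hg), (HH _ _ Hn Hg'); apply Hg, suc_refl.
Qed.

End Omega.
#[export] Hint Resolve dfun_suc : dfn.

(** * Finite sets *)

Section Finite.
Context {M : zf_model}.
Implicit Types f x y z A B p n m : M.

(** Phrased through [app f] alone, so [f] may contain anything besides its graph over [A]. The
    decoding of equipotence trims it to [lam A (app f)]. *)
Definition bij f A B : Prop :=
  (forall x, x ∈ A -> app f x ∈ B)
  /\ (forall x x', x ∈ A -> x' ∈ A -> app f x = app f x' -> x = x')
  /\ (forall y, y ∈ B -> exists x, x ∈ A /\ app f x = y).
Lemma dpred_bij : dpred3 bij. Proof. unfold bij; dfn. Qed.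
Hint Resolve dpred_bij : dfn.

Definition equip A B : Prop := exists f, bij f A B.
Lemma dpred_equip : dpred2 equip. Proof. unfold equip; dfn. Qed.
Hint Resolve dpred_equip : dfn.

Lemma equip_intro A B (F : M -> M) : dfun1 F ->
  (forall x, x ∈ A -> F x ∈ B) ->
  (forall x x', x ∈ A -> x' ∈ A -> F x = F x' -> x = x') ->
  (forall y, y ∈ B -> exists x, x ∈ A /\ F x = y) -> equip A B.
Proof.
  intros DF H1 H2 H3; exists (lam A F); repeat split.
  - intros x Hx; rewrite app_lam; auto.
  - intros x x' Hx Hx'; rewrite !app_lam; auto.
  - intros y Hy; destruct (H3 y Hy) as [x [Hx <-]]; exists x; rewrite app_lam; auto.
Qed.

Lemma equip_trans A B C : equip A B -> equip B C -> equip A C.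
Proof.
  intros [f [F1 [F2 F3]]] [g [G1 [G2 G3]]].
  apply equip_intro with (fun x => app g (app f x)); [dfn | auto | |].
  - intros x x' Hx Hx' E; apply F2; auto; apply G2; auto.
  - intros z Hz; destruct (G3 z Hz) as [y [Hy <-]]; destruct (F3 y Hy) as [x [Hx <-]]; eauto.
Qed.

Lemma equip_sym A B : equip A B -> equip B A.
Proof.
  intros [f [F1 [F2 F3]]].
  pose (G := fun y => the (fun x => x ∈ A /\ app f x = y)).
  assert (HG : forall x, x ∈ A -> G (app f x) = x).
  { intros x Hx; apply the_eq; auto; intros z [Hz E]; auto. }
  apply equip_intro with G; [unfold G; dfn | | |].
  - intros y Hy; destruct (F3 y Hy) as [x [Hx <-]]; now rewrite HG.
  - intros y y' Hy Hy'; destruct (F3 y Hy) as [x [Hx <-]]; destruct (F3 y' Hy') as [x' [Hx' <-]].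
    rewrite !HG; congruence.
  - intros x Hx; exists (app f x); auto.
Qed.

Definition Fin A : Prop := exists n, n ∈ om /\ equip A n.
Lemma dpred_Fin : dpred1 Fin. Proof. unfold Fin; dfn. Qed.
Hint Resolve dpred_Fin : dfn.

Lemma Fin_equip A B : equip A B -> Fin A -> Fin B.
Proof. intros H [n [Hn Hf]]; exists n; split; eauto using equip_trans, equip_sym. Qed.

Lemma Fin_emp : Fin emp.
Proof.
  exists emp; split; [apply om_emp|].
  apply equip_intro with (fun x => x); [dfn | auto | auto | intros y Hy; destruct (in_emp Hy)].
Qed.

Lemma add_absorb A x : x ∈ A -> add A x = A.
Proof. intros H; apply zf_ext; intros z; rewrite in_add; intuition congruence. Qed.

Lemma Fin_add A x : Fin A -> Fin (add A x).
Proof.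
  intros [n [Hn [f [F1 [F2 F3]]]]].
  destruct (classic (x ∈ A)) as [Hx|Hx].
  { rewrite add_absorb; auto; exists n; split; auto; exists f; repeat split; auto. }
  exists (suc n); split; [now apply om_suc|].
  pose (F := fun y => the (fun z => (y = x /\ z = n) \/ (y <> x /\ z = app f y))).
  assert (Fx : F x = n) by (apply the_eq; intuition).
  assert (FA : forall y, y ∈ A -> F y = app f y).
  { intros y Hy; assert (y <> x) by (intros ->; auto); apply the_eq; intuition. }
  apply equip_intro with F; [unfold F; dfn | | |].
  - intros y Hy; apply in_suc; apply in_add in Hy as [Hy | ->]; auto.
    rewrite FA; auto.
  - intros y y' Hy Hy' E; rewrite in_add in Hy, Hy'.
    destruct Hy as [Hy | ->], Hy' as [Hy' | ->]; rewrite ?Fx, ?FA in E; auto.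
    + destruct (om_irrefl Hn); rewrite <- E at 1; auto.
    + destruct (om_irrefl Hn); rewrite E at 1; auto.
  - intros y Hy; apply in_suc in Hy as [Hy | ->].
    + destruct (F3 y Hy) as [z [Hz <-]]; exists z; split; [apply in_add|]; auto.
    + exists x; split; [apply in_add|]; auto.
Qed.

Lemma set_eq A B : sub A B -> sub B A -> A = B.
Proof. intros H H'; apply zf_ext; intros z; split; auto. Qed.

(** Induction on the number [n] equipotent with [A]: for [suc n], the element numbered [n] is
    removed. *)
Lemma Fin_ind (P : M -> Prop) : dpred1 P -> P emp ->
  (forall A x, Fin A -> P A -> P (add A x)) -> forall A, Fin A -> P A.
Proof.
  intros HP H0 HS A [n [Hn HA]]; revert n Hn A HA.
  apply (@om_ind M (fun n => forall A, equip A n -> P A)); [dfn | |].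
  - intros A [f [F1 _]]; replace A with (@emp M); auto.
    apply zf_ext; intros z; split; intros Hz; [destruct (in_emp Hz) |].
    destruct (in_emp (F1 z Hz)).
  - intros n Hn IH A [f [F1 [F2 F3]]].
    destruct (F3 n (suc_refl n)) as [x [Hx Ex]].
    pose (A' := sep A (fun y => y <> x)).
    assert (HA' : forall y, y ∈ A' <-> y ∈ A /\ y <> x) by (intros y; apply (@in_sep M _ (fun y => y <> x)); dfn).
    assert (HE : equip A' n).
    { exists f; repeat split.
      - intros y Hy; apply HA' in Hy as [Hy Hn'].
        destruct (proj1 (in_suc n (app f y)) (F1 y Hy)) as [H | H]; auto.
        destruct Hn'; apply F2; congruence.
      - intros y y' Hy Hy'; apply HA' in Hy, Hy'; apply F2; tauto.
      - intros k Hk; destruct (F3 k) as [y [Hy E]]; [apply in_suc; auto|].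
        exists y; split; auto; apply HA'; split; auto; intros ->.
        apply (om_irrefl Hn); congruence. }
    replace A with (add A' x).
    + apply HS; auto; exists n; auto.
    + apply zf_ext; intros z; rewrite in_add, HA'.
      destruct (classic (z = x)); intuition congruence.
Qed.

Lemma Fin_sub A B : Fin A -> sub B A -> Fin B.
Proof.
  intros H; revert A H B.
  apply (@Fin_ind (fun A => forall B, sub B A -> Fin B)); [dfn | |].
  - intros B HB; replace B with (@emp M); [apply Fin_emp|].
    apply set_eq; auto; intros z Hz; destruct (in_emp Hz).
  - intros A x HA IH B HB.
    destruct (classic (x ∈ B)) as [Hx|Hx].
    + pose (B' := sep B (fun y => y <> x)).
      assert (HB' : forall y, y ∈ B' <-> y ∈ B /\ y <> x) by (intros y; apply (@in_sep M _ (fun y => y <> x)); dfn).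
      replace B with (add B' x).
      * apply Fin_add, IH; intros y Hy; apply HB' in Hy as [Hy Hn].
        apply HB, in_add in Hy; tauto.
      * apply zf_ext; intros z; rewrite in_add, HB'.
        destruct (classic (z = x)); intuition congruence.
    + apply IH; intros y Hy; pose proof (HB y Hy) as H; apply in_add in H as [H | ->]; tauto.
Qed.

Lemma Fin_cup A B : Fin A -> Fin B -> Fin (cup A B).
Proof.
  intros HA; revert B; intros B HB; revert B HB.
  apply (@Fin_ind (fun B => Fin (cup A B))); [dfn | |].
  - replace (cup A emp) with A; auto; apply zf_ext; intros z; rewrite in_cup.
    split; [auto | intros [|Hz]; auto; destruct (in_emp Hz)].
  - intros B x HB IH; replace (cup A (add B x)) with (add (cup A B) x); [now apply Fin_add|].
    apply zf_ext; intros z; rewrite !in_add, !in_cup, in_add; tauto.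
Qed.

Lemma Fin_upair x y : Fin (upair x y).
Proof.
  replace (upair x y) with (add (add emp x) y); [apply Fin_add, Fin_add, Fin_emp|].
  apply zf_ext; intros z; rewrite !in_add, in_upair.
  split; [intros [[Hz|]|]; auto; destruct (in_emp Hz) | tauto].
Qed.

Lemma Fin_img (F : M -> M) A : dfun1 F -> Fin A -> Fin (img F A).
Proof.
  intros DF; revert A; apply (@Fin_ind (fun A => Fin (img F A))); [dfn | |].
  - replace (img F emp) with (@emp M); [apply Fin_emp|].
    apply set_eq; intros z Hz; [destruct (in_emp Hz)|].
    apply in_img in Hz as [x [Hx _]]; auto; destruct (in_emp Hx).
  - intros A x HA IH; replace (img F (add A x)) with (add (img F A) (F x)); [now apply Fin_add|].
    apply zf_ext; intros z; rewrite in_add, !in_img by auto; split.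
    + intros [[y [Hy ->]] | ->]; eexists; rewrite in_add; eauto.
    + intros [y [Hy ->]]; apply in_add in Hy as [Hy | ->]; eauto.
Qed.

Lemma Fin_union A : Fin A -> (forall x, x ∈ A -> Fin x) -> Fin (union A).
Proof.
  revert A; apply (@Fin_ind (fun A => (forall x, x ∈ A -> Fin x) -> Fin (union A))); [dfn | |].
  - intros _; replace (union emp) with (@emp M); [apply Fin_emp|].
    apply set_eq; intros z Hz; [destruct (in_emp Hz)|].
    apply in_union in Hz as [x [Hx _]]; destruct (in_emp Hx).
  - intros A x HA IH H; replace (union (add A x)) with (cup (union A) x).
    + apply Fin_cup; [apply IH; intros y Hy|]; apply H, in_add; auto.
    + apply zf_ext; intros z; rewrite in_cup, !in_union; split.
      * intros [[B [HB Hz]] | Hz]; eexists; rewrite in_add; eauto.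
      * intros [B [HB Hz]]; apply in_add in HB as [HB | ->]; eauto.
Qed.

Lemma Fin_power A : Fin A -> Fin (power A).
Proof.
  revert A; apply (@Fin_ind (fun A => Fin (power A))); [dfn | |].
  - apply Fin_sub with (upair emp emp); [apply Fin_upair|].
    intros B HB; apply in_upair; left; rewrite in_power in HB.
    apply set_eq; auto; intros z Hz; destruct (in_emp Hz).
  - intros A x HA IH.
    apply Fin_sub with (cup (power A) (img (fun B => add B x) (power A))).
    + apply Fin_cup; auto; apply Fin_img; auto; dfn.
    + intros B HB; rewrite in_power in HB; rewrite in_cup, in_img, !in_power by dfn.
      destruct (classic (x ∈ B)) as [Hx|Hx].
      * right; exists (sep B (fun y => y <> x)); split.
        -- rewrite in_power; intros y Hy; apply in_sep in Hy as [Hy Hn]; [|dfn].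
           apply HB, in_add in Hy; tauto.
        -- apply zf_ext; intros z; rewrite in_add, in_sep by dfn.
           destruct (classic (z = x)); intuition congruence.
      * left; intros y Hy; pose proof (HB y Hy) as H; apply in_add in H as [H | ->]; tauto.
Qed.

Lemma Fin_om_bounded A : Fin A -> sub A om -> exists m, m ∈ om /\ sub A m.
Proof.
  revert A; apply (@Fin_ind (fun A => sub A om -> exists m, m ∈ om /\ sub A m)); [dfn | |].
  - intros _; exists emp; split; [apply om_emp | intros z Hz; exact Hz].
  - intros A x HA IH H.
    destruct IH as [m [Hm IH]]; [intros y Hy; apply H, in_add; auto|].
    assert (Hx : x ∈ om) by (apply H, in_add; auto).
    destruct (om_total Hm Hx) as [Hmx | Hmx].
    + exists (suc x); split; [now apply om_suc|].
      intros y Hy; apply in_suc; apply in_add in Hy as [Hy | ->]; auto.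
      left; eapply om_trans; eauto.
    + exists (suc m); split; [now apply om_suc|].
      intros y Hy; apply in_suc; apply in_add in Hy as [Hy | ->]; auto.
      destruct Hmx; auto.
Qed.

Lemma om_infinite : ~ Fin om.
Proof.
  intros H; destruct (Fin_om_bounded H) as [m [Hm Hs]]; [intros x Hx; exact Hx|].
  exact (om_irrefl Hm (Hs m Hm)).
Qed.

Lemma Fin_om n : n ∈ om -> Fin n.
Proof.
  intros Hn; exists n; split; auto.
  apply equip_intro with (fun x => x); [dfn | auto | auto | eauto].
Qed.

Lemma inj_infinite A (F : M -> M) : dfun1 F -> (forall n, n ∈ om -> F n ∈ A) ->
  (forall m n, m ∈ om -> n ∈ om -> F m = F n -> m = n) -> ~ Fin A.
Proof.
  intros DF HA Hi H; apply om_infinite.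
  apply Fin_equip with (img F om).
  - apply equip_sym, equip_intro with F; auto.
    + intros n Hn; apply in_img; eauto.
    + intros y Hy; apply in_img in Hy as [n [Hn ->]]; eauto.
  - apply Fin_sub with A; auto; intros y Hy; apply in_img in Hy as [n [Hn ->]]; auto.
Qed.

Lemma Fin_minimal (R : M -> M -> Prop) : dpred2 R ->
  (forall x, ~ R x x) -> (forall x y z, R x y -> R y z -> R x z) ->
  forall A, Fin A -> (exists x, x ∈ A) -> exists m, m ∈ A /\ forall y, y ∈ A -> ~ R y m.
Proof.
  intros DR Hirr Htr.
  apply (@Fin_ind (fun A => (exists x, x ∈ A) -> exists m, m ∈ A /\ forall y, y ∈ A -> ~ R y m)); [dfn | |].
  - intros [x Hx]; destruct (in_emp Hx).
  - intros A x HA IH _.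
    destruct (classic (exists y, y ∈ A)) as [H|H].
    + destruct (IH H) as [m [Hm Hmin]].
      destruct (classic (R x m)) as [Hr|Hr].
      * exists x; rewrite in_add; split; auto; intros y Hy.
        apply in_add in Hy as [Hy | ->]; auto; intros Hr'; eapply Hmin; eauto.
      * exists m; rewrite in_add; split; auto; intros y Hy.
        apply in_add in Hy as [Hy | ->]; auto.
    + exists x; rewrite in_add; split; auto; intros y Hy.
      apply in_add in Hy as [Hy | ->]; auto; destruct H; eauto.
Qed.

Lemma increasing_sets (F : M -> M) : dfun1 F -> (forall n, n ∈ om -> sub (F n) (F (suc n))) ->
  forall n, n ∈ om -> forall m, m ∈ n -> sub (F m) (F n).
Proof.
  intros DF HF; apply (@om_ind M (fun n => forall m, m ∈ n -> sub (F m) (F n))); [dfn | |].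
  - intros m H; destruct (in_emp H).
  - intros n Hn IH m Hm x Hx; apply HF; auto.
    apply in_suc in Hm as [Hm | ->]; auto; eapply IH; eauto.
Qed.

(** Adding one element to [A] replaces the stage by the later of two, so no stages have to be chosen
    simultaneously. *)
Lemma Fin_in_stage (F : M -> M) : dfun1 F -> (forall n, n ∈ om -> forall m, m ∈ n -> sub (F m) (F n)) ->
  forall A, Fin A -> sub A (union (img F om)) -> exists n, n ∈ om /\ sub A (F n).
Proof.
  intros DF HF; apply (@Fin_ind (fun A => sub A (union (img F om)) -> exists n, n ∈ om /\ sub A (F n))).
  - dfn.
  - intros _; exists emp; split; [apply om_emp | intros z Hz; destruct (in_emp Hz)].
  - intros A x HA IH H.
    destruct IH as [n [Hn IH]]; [intros y Hy; apply H, in_add; auto|].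
    assert (Hx : x ∈ union (img F om)) by (apply H, in_add; auto).
    apply in_union in Hx as [B [HB Hx]]; apply in_img in HB as [m [Hm ->]]; auto.
    destruct (om_total Hm Hn) as [Hmn | [-> | Hmn]].
    + exists n; split; auto; intros y Hy; apply in_add in Hy as [Hy | ->]; auto.
      apply (HF n Hn m); auto.
    + exists n; split; auto; intros y Hy; apply in_add in Hy as [Hy | ->]; auto.
    + exists m; split; auto; intros y Hy; apply in_add in Hy as [Hy | ->]; auto.
      apply (HF m Hm n); auto.
Qed.

End Finite.
#[export] Hint Resolve dpred_bij dpred_equip dpred_Fin : dfn.

(** * Boolean algebras *)

(* A meet semilattice with a complement; these axioms already imply distributivity. *)
Record balg {M : zf_model} (B : M) (mul : M -> M -> M) (neg : M -> M) (zero : M) : Prop := {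
  dfun_mul : dfun2 mul;
  dfun_neg : dfun1 neg;
  ba_zero : zero ∈ B;
  ba_mul : forall x y, x ∈ B -> y ∈ B -> mul x y ∈ B;
  ba_neg : forall x, x ∈ B -> neg x ∈ B;
  mulA : forall x y z, x ∈ B -> y ∈ B -> z ∈ B -> mul x (mul y z) = mul (mul x y) z;
  mulC : forall x y, x ∈ B -> y ∈ B -> mul x y = mul y x;
  mulxx : forall x, x ∈ B -> mul x x = x;
  mulx0 : forall x, x ∈ B -> mul x zero = zero;
  mul_eq0 : forall x y, x ∈ B -> y ∈ B -> mul x y = zero <-> mul x (neg y) = x;
  negK : forall x, x ∈ B -> neg (neg x) = x
}.
Arguments mulA {M B mul neg zero} _ x y z.
Arguments mulC {M B mul neg zero} _ x y.

Section BooleanAlgebra.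
Context {M : zf_model} {B : M} {mul : M -> M -> M} {neg : M -> M} {zero : M}.
Context (HB : balg B mul neg zero).
Implicit Types a b x y z S n m : M.

Let Dmul := dfun_mul HB.
Let Dneg := dfun_neg HB.
Hint Resolve Dmul Dneg : dfn.
Let Bzero := ba_zero HB.
Let Bmul := ba_mul HB.
Let Bneg := ba_neg HB.
Hint Resolve Bzero Bmul Bneg : core.

Local Notation one := (neg zero).
Definition le x y : Prop := mul x y = x.
Lemma dpred_le : dpred2 le. Proof. unfold le; dfn. Qed.
Hint Resolve dpred_le : dfn.

Lemma le_refl x : x ∈ B -> le x x.
Proof. apply (mulxx HB). Qed.

Lemma le_trans x y z : x ∈ B -> y ∈ B -> z ∈ B -> le x y -> le y z -> le x z.
Proof.
  unfold le; intros Hx Hy Hz H H'.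
  rewrite <- H at 1; rewrite <- (mulA HB), H'; auto.
Qed.

Lemma le_antisym x y : x ∈ B -> y ∈ B -> le x y -> le y x -> x = y.
Proof. unfold le; intros Hx Hy H H'; rewrite <- H, (mulC HB); auto. Qed.

Lemma le_mul_r x y : x ∈ B -> y ∈ B -> le (mul x y) y.
Proof. unfold le; intros Hx Hy; rewrite <- (mulA HB), (mulxx HB); auto. Qed.

Lemma le_mul_l x y : x ∈ B -> y ∈ B -> le (mul x y) x.
Proof. intros Hx Hy; rewrite (mulC HB); auto; apply le_mul_r; auto. Qed.

Lemma le_mul x y z : x ∈ B -> y ∈ B -> z ∈ B -> le z x -> le z y -> le z (mul x y).
Proof. unfold le; intros Hx Hy Hz H H'; rewrite (mulA HB), H, H'; auto. Qed.

Lemma le_neg_iff x y : x ∈ B -> y ∈ B -> le x (neg y) <-> mul x y = zero.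
Proof. intros Hx Hy; symmetry; apply (mul_eq0 HB); auto. Qed.

Lemma le_iff x y : x ∈ B -> y ∈ B -> le x y <-> mul x (neg y) = zero.
Proof. intros Hx Hy; rewrite <- le_neg_iff, (negK HB); auto; reflexivity. Qed.

Lemma mul_neg x : x ∈ B -> mul x (neg x) = zero.
Proof. intros Hx; apply le_iff; auto using le_refl. Qed.

Lemma le_one x : x ∈ B -> le x one.
Proof. intros Hx; apply le_neg_iff; auto; apply (mulx0 HB); auto. Qed.

Lemma le_zero x : x ∈ B -> le x zero -> x = zero.
Proof. unfold le; intros Hx <-; apply (mulx0 HB); auto. Qed.

Lemma mulAC x y z : x ∈ B -> y ∈ B -> z ∈ B -> mul (mul x y) z = mul (mul x z) y.
Proof. intros; rewrite <- !(mulA HB), (mulC HB y z); auto. Qed.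

Lemma le_neg_self x : x ∈ B -> le x (neg x) -> x = zero.
Proof. intros Hx H; rewrite <- (mul_neg Hx); symmetry; exact H. Qed.

Lemma le_neg_sym x y : x ∈ B -> y ∈ B -> le x (neg y) -> le y (neg x).
Proof. intros Hx Hy; rewrite !le_neg_iff, (mulC HB); auto. Qed.

(** The equation [mul x b = mul a b] says that [x] and [a] agree below [b]. This agreement respects
    meets, and by [rel_neg] also complements. *)
Lemma rel_mul x y a c b : x ∈ B -> y ∈ B -> a ∈ B -> c ∈ B -> b ∈ B ->
  mul x b = mul a b -> mul y b = mul c b -> mul (mul x y) b = mul (mul a c) b.
Proof.
  intros Hx Hy Ha Hc Hb H H'.
  rewrite <- (mulA HB x y b), H', (mulA HB x c b), (mulAC Hx Hc Hb), H; auto.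
  apply mulAC; auto.
Qed.

Lemma rel_neg_le x a b : x ∈ B -> a ∈ B -> b ∈ B ->
  mul x b = mul a b -> le (mul (neg x) b) (mul (neg a) b).
Proof.
  intros Hx Ha Hb H; apply le_mul; auto using le_mul_r.
  apply le_neg_iff; auto.
  rewrite <- (mulA HB), (mulC HB b a), <- H, (mulA HB), (mulC HB (neg x) x), mul_neg, (mulC HB); auto.
  apply (mulx0 HB); auto.
Qed.

Lemma rel_neg x a b : x ∈ B -> a ∈ B -> b ∈ B ->
  mul x b = mul a b -> mul (neg x) b = mul (neg a) b.
Proof. intros; apply le_antisym; auto; apply rel_neg_le; auto. Qed.

(** The element [mul x (neg y)] is disjoint from [b] and from [neg b], hence below both, hence
    zero. *)
Lemma split_le x y b : x ∈ B -> y ∈ B -> b ∈ B ->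
  mul x b = mul y b -> mul x (neg b) = mul y (neg b) -> le x y.
Proof.
  intros Hx Hy Hb H H'; apply le_iff; auto.
  apply le_zero; auto; rewrite <- (mul_neg Hb).
  assert (Hw : forall c, c ∈ B -> mul x c = mul y c -> mul (mul x (neg y)) c = zero).
  { intros c Hc E; rewrite mulAC, E, mulAC, mul_neg, (mulC HB); auto; apply (mulx0 HB); auto. }
  apply le_mul; auto; [apply le_iff | apply le_neg_iff]; auto.
Qed.

Lemma split_inj x y b : x ∈ B -> y ∈ B -> b ∈ B ->
  mul x b = mul y b -> mul x (neg b) = mul y (neg b) -> x = y.
Proof. intros Hx Hy Hb H H'; apply le_antisym; auto; apply split_le with b; auto. Qed.

(** By [split_inj] an element is recovered from its parts below [b] and below [neg b], so [A] embeds
    in the product of two finite sets; [F] is the recovery. *)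
Lemma Fin_split b A : b ∈ B -> sub A B ->
  Fin (img (fun x => mul x b) A) -> Fin (img (fun x => mul x (neg b)) A) -> Fin A.
Proof.
  intros Hb HA H1 H2.
  pose (F := fun u v => the (fun x => x ∈ B /\ mul x b = u /\ mul x (neg b) = v)).
  apply Fin_sub with (union (img (fun u => img (fun v => F u v)
    (img (fun x => mul x (neg b)) A)) (img (fun x => mul x b) A))).
  - unfold F; apply Fin_union; [apply Fin_img; auto; dfn|].
    intros y Hy; apply in_img in Hy as [u [_ ->]]; [|dfn].
    apply Fin_img; auto; dfn.
  - intros x Hx; apply in_union; exists (img (fun v => F (mul x b) v) (img (fun x => mul x (neg b)) A)).
    unfold F; rewrite !in_img by dfn; split.
    + exists (mul x b); split; auto; rewrite in_img by dfn; eauto.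
    + exists (mul x (neg b)); split.
      * rewrite in_img by dfn; eauto.
      * symmetry; apply the_eq; [auto|]; intros z [Hz [E E']]; apply split_inj with b; auto.
Qed.

Definition subalgebra S : Prop :=
  sub S B /\ zero ∈ S /\ (forall x y, x ∈ S -> y ∈ S -> mul x y ∈ S) /\ (forall x, x ∈ S -> neg x ∈ S).
Lemma dpred_subalgebra : dpred1 subalgebra.
Proof. unfold subalgebra; dfn. Qed.
Hint Resolve dpred_subalgebra : dfn.

Lemma subalgebra_adjoin S b : Fin S -> subalgebra S -> b ∈ B ->
  exists S', Fin S' /\ subalgebra S' /\ sub S S' /\ b ∈ S'.
Proof.
  intros FS [SB [S0 [Sm Sn]]] Hb.
  (* These are the elements a b + a' (-b) with a, a' in [S], described without a join. *)
  pose (S' := sep B (fun x => (exists a, a ∈ S /\ mul x b = mul a b)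
    /\ exists a, a ∈ S /\ mul x (neg b) = mul a (neg b))).
  assert (HS' : forall x, x ∈ S' <-> x ∈ B /\ (exists a, a ∈ S /\ mul x b = mul a b)
    /\ exists a, a ∈ S /\ mul x (neg b) = mul a (neg b)).
  { intros x; unfold S'; rewrite in_sep by dfn; reflexivity. }
  assert (S'B : sub S' B) by (intros x Hx; apply HS' in Hx; tauto).
  assert (SS' : sub S S') by (intros x Hx; apply HS'; repeat split; auto; exists x; auto).
  exists S'; repeat split; auto.
  - apply Fin_split with b; auto.
    + apply Fin_sub with (img (fun x => mul x b) S); [apply Fin_img; auto; dfn|].
      intros y; rewrite !in_img by dfn; intros [x [Hx ->]].
      apply HS' in Hx as [_ [[a [Ha E]] _]]; eauto.
    + apply Fin_sub with (img (fun x => mul x (neg b)) S); [apply Fin_img; auto; dfn|].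
      intros y; rewrite !in_img by dfn; intros [x [Hx ->]].
      apply HS' in Hx as [_ [_ [a [Ha E]]]]; eauto.
  - intros x y Hx Hy; apply HS' in Hx as [Hx [[a [Ha E]] [a' [Ha' E']]]].
    apply HS' in Hy as [Hy [[c [Hc F]] [c' [Hc' F']]]].
    apply HS'; repeat split; auto; [exists (mul a c) | exists (mul a' c')]; split; auto; apply rel_mul; auto.
  - intros x Hx; apply HS' in Hx as [Hx [[a [Ha E]] [a' [Ha' E']]]].
    apply HS'; repeat split; auto; [exists (neg a) | exists (neg a')]; split; auto; apply rel_neg; auto.
  (* The new element [b] agrees with [one] below [b] and with [zero] below [neg b]. *)
  - apply HS'; repeat split; auto.
    + exists one; split; auto; rewrite (mulC HB one b), (mulxx HB); auto; symmetry; now apply le_one.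
    + exists zero; split; auto; rewrite mul_neg, (mulC HB); auto; symmetry; apply (mulx0 HB); auto.
Qed.

Lemma finite_subalgebra A : Fin A -> sub A B -> exists S, Fin S /\ subalgebra S /\ sub A S.
Proof.
  revert A; apply (@Fin_ind M (fun A => sub A B -> exists S, Fin S /\ subalgebra S /\ sub A S)); [dfn | |].
  - intros _; exists (upair zero one); repeat split.
    + apply Fin_upair.
    + intros x Hx; apply in_upair in Hx as [-> | ->]; auto.
    + apply in_upair; auto.
    + intros x y Hx Hy; apply in_upair in Hx as [-> | ->]; apply in_upair in Hy as [-> | ->]; apply in_upair.
      * left; apply (mulxx HB); auto.
      * left; apply le_one; auto.
      * left; apply (mulx0 HB); auto.
      * right; apply (mulxx HB); auto.
    + intros x Hx; apply in_upair in Hx as [-> | ->]; apply in_upair; rewrite ?(negK HB); auto.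
    + intros x Hx; destruct (in_emp Hx).
  - intros A x HA IH H.
    destruct IH as [S [FS [HS HAS]]]; [intros y Hy; apply H, in_add; auto|].
    destruct (@subalgebra_adjoin S x) as [S' [FS' [HS' [HSS' Hx]]]]; auto.
    { apply H, in_add; auto. }
    exists S'; repeat split; auto; try apply HS'.
    intros y Hy; apply in_add in Hy as [Hy | ->]; auto.
Qed.

(** [finite_subalgebra] yields some finite subalgebra around [A]; the intersection of all of them is
    canonical, and so depends definably on [A]. *)
Definition gen A : M := sep B (fun x => forall S, subalgebra S -> sub A S -> x ∈ S).
Lemma dfun_gen : dfun1 gen. Proof. unfold gen; dfn. Qed.
Lemma in_gen A x : x ∈ gen A <-> x ∈ B /\ forall S, subalgebra S -> sub A S -> x ∈ S.
Proof. unfold gen; rewrite in_sep by dfn; reflexivity. Qed.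

Lemma gen_subalgebra A : subalgebra (gen A).
Proof.
  split; [|split; [|split]].
  - intros x Hx; apply in_gen in Hx; tauto.
  - apply in_gen; split; auto; intros S HS _; apply HS.
  - intros x y Hx Hy; apply in_gen in Hx as [Hx Hx'], Hy as [Hy Hy'].
    apply in_gen; split; auto; intros S HS HA; apply HS; auto.
  - intros x Hx; apply in_gen in Hx as [Hx Hx'].
    apply in_gen; split; auto; intros S HS HA; apply HS; auto.
Qed.

Lemma sub_gen A : sub A B -> sub A (gen A).
Proof. intros H x Hx; apply in_gen; split; auto. Qed.

Lemma gen_mono A A' : sub A A' -> sub (gen A) (gen A').
Proof.
  intros H x Hx; apply in_gen in Hx as [Hx Hx']; apply in_gen; split; auto.
  intros S HS HA; apply Hx'; auto; intros y Hy; auto.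
Qed.

Lemma Fin_gen A : Fin A -> sub A B -> Fin (gen A).
Proof.
  intros FA HA; destruct (finite_subalgebra FA HA) as [S [FS [HS HAS]]].
  apply Fin_sub with S; auto; intros x Hx; apply in_gen in Hx as [_ Hx]; auto.
Qed.

Definition lt x y : Prop := x ∈ B /\ y ∈ B /\ le x y /\ x <> y.

Lemma Fin_minimal_le A : Fin A -> sub A B -> (exists x, x ∈ A) ->
  exists m, m ∈ A /\ forall y, y ∈ A -> le y m -> y = m.
Proof.
  intros FA HA Hne.
  destruct (@Fin_minimal M lt) with (A := A) as [m [Hm Hmin]]; auto.
  - unfold lt; dfn.
  - intros x [_ [_ [_ H]]]; auto.
  - intros x y z [Hx [Hy [H1 H2]]] [_ [Hz [H3 H4]]]; repeat split; auto.
    + eapply le_trans; [ | exact Hy | | |]; auto.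
    + intros <-; apply H2, le_antisym; auto.
  - exists m; split; auto; intros y Hy Hle; apply NNPP; intros Hn.
    apply (Hmin y Hy); repeat split; auto.
Qed.

Lemma Fin_least_le A : Fin A -> sub A B -> (exists x, x ∈ A) ->
  (forall x y, x ∈ A -> y ∈ A -> mul x y ∈ A) ->
  exists m, m ∈ A /\ forall y, y ∈ A -> le m y.
Proof.
  intros FA HA Hne Hm; destruct (Fin_minimal_le FA HA Hne) as [m [Hm' Hmin]].
  exists m; split; auto; intros y Hy; apply Hmin; auto using le_mul_l.
Qed.

Definition atom S a : Prop :=
  a ∈ S /\ a <> zero /\ forall x, x ∈ S -> le x a -> x = zero \/ x = a.
Lemma dpred_atom : dpred2 atom. Proof. unfold atom; dfn. Qed.
Hint Resolve dpred_atom : dfn.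

Lemma atom_below S w : Fin S -> subalgebra S -> w ∈ S -> w <> zero -> exists a, atom S a /\ le a w.
Proof.
  intros FS HS Hw Hw0.
  assert (SB : sub S B) by apply HS.
  pose (A := sep S (fun x => x <> zero /\ le x w)).
  assert (HA : forall x, x ∈ A <-> x ∈ S /\ x <> zero /\ le x w)
    by (intros x; unfold A; rewrite in_sep by dfn; reflexivity).
  destruct (@Fin_minimal_le A) as [a [Ha Hmin]].
  - apply Fin_sub with S; auto; intros x Hx; apply HA in Hx; tauto.
  - intros x Hx; apply HA in Hx; apply SB; tauto.
  - exists w; apply HA; auto using le_refl.
  - apply HA in Ha as [Ha [Ha0 Hle]]; exists a; repeat split; auto.
    intros x Hx Hxa; destruct (classic (x = zero)) as [|Hx0]; auto.
    right; apply Hmin; auto; apply HA; repeat split; auto.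
    eapply le_trans; [| apply SB; exact Ha | | |]; auto.
Qed.

(** Replaces joins, which [balg] does not provide. The upper bounds in [S] form a finite set that
    contains [one] and is closed under meets, so a minimal one is least. *)
Lemma least_above S (P : M -> Prop) : dpred1 P -> Fin S -> subalgebra S ->
  (forall x, P x -> x ∈ B) ->
  exists u, u ∈ S /\ (forall x, P x -> le x u) /\
    forall v, v ∈ S -> (forall x, P x -> le x v) -> le u v.
Proof.
  intros DP FS HS HP.
  assert (SB : sub S B) by apply HS.
  pose (A := sep S (fun v => forall x, P x -> le x v)).
  assert (HA : forall v, v ∈ A <-> v ∈ S /\ forall x, P x -> le x v)
    by (intros x; unfold A; rewrite in_sep by dfn; reflexivity).
  destruct (@Fin_least_le A) as [u [Hu Hmin]].
  - apply Fin_sub with S; auto; intros x Hx; apply HA in Hx; tauto.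
  - intros x Hx; apply HA in Hx; apply SB; tauto.
  - exists one; apply HA; split; [apply HS, HS | auto using le_one].
  - intros x y Hx Hy; apply HA in Hx as [Hx Hx'], Hy as [Hy Hy']; apply HA; split.
    + apply HS; auto.
    + intros z Hz; apply le_mul; auto.
  - exists u; apply HA in Hu as [Hu Hu']; repeat split; auto.
    intros v Hv Hv'; apply Hmin, HA; auto.
Qed.

(** Take an atom [a] below the least [w] in [S] above [z]. If [a] missed [z], then [neg a] would be
    above [z], hence above [w] and above [a] itself. *)
Lemma atom_meeting S z : Fin S -> subalgebra S -> z ∈ B -> z <> zero ->
  exists a, atom S a /\ mul a z <> zero.
Proof.
  intros FS HS Hz Hz0.
  assert (SB : sub S B) by apply HS.
  destruct (@least_above S (fun x => x = z)) as [w [Hw [Hzw Hmin]]]; auto; [dfn | now intros x -> |].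
  destruct (@atom_below S w) as [a [Ha Haw]]; auto.
  { intros ->; apply Hz0, le_zero; auto. }
  assert (HaS : a ∈ S) by apply Ha.
  exists a; split; auto; intros E; apply Ha, le_neg_self; auto.
  apply le_trans with w; auto.
  apply Hmin; [now apply HS | intros x ->].
  apply le_neg_sym; auto; apply le_neg_iff; auto.
Qed.

(** For [y] in [S'], let [u] be the least element of [S] above it. If [u] exceeded [y], some atom
    [a] of [S] would meet the difference; being still an atom of [S'], it would lie inside the
    difference, so that [neg a] is above [y], hence above [u] and [a]. *)
Lemma atoms_determine S S' : Fin S -> subalgebra S -> subalgebra S' -> sub S S' ->
  (forall a, atom S a -> atom S' a) -> sub S' S.
Proof.
  intros FS HS HS' HSS' Hat y Hy.
  assert (SB : sub S B) by apply HS.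
  assert (SB' : sub S' B) by apply HS'.
  destruct (@least_above S (fun x => x = y)) as [u [Hu [Hyu Hmin]]]; auto.
  { dfn. } { now intros x ->; auto. }
  destruct (classic (mul u (neg y) = zero)) as [E|E].
  { apply le_iff in E; auto; replace y with u; auto; apply le_antisym; auto. }
  destruct (@atom_meeting S (mul u (neg y))) as [a [Ha Haz]]; auto.
  assert (HaS : a ∈ S) by apply Ha.
  assert (Hzz : mul u (neg y) ∈ S') by (apply HS'; [auto | now apply HS']).
  destruct (Hat a Ha) as [_ [_ H]].
  destruct (H (mul a (mul u (neg y)))) as [H0|H0]; try contradiction.
  { apply HS'; auto. }
  { apply le_mul_l; auto. }
  assert (Hau : le a u).
  { apply le_trans with (mul u (neg y)); auto using le_mul_l. }
  assert (Hay : le a (neg y)).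
  { apply le_trans with (mul u (neg y)); auto using le_mul_r. }
  destruct Ha as [_ [Ha0 _]]; destruct Ha0; apply le_neg_self; auto.
  apply le_trans with u; auto.
  apply Hmin; [now apply HS | intros x ->; apply le_neg_sym; auto].
Qed.

(** An atom [u] below [a] differs from [a], so the rest [mul a (neg u)] is nonzero and contains a
    second atom. *)
Lemma two_atoms S' a : Fin S' -> subalgebra S' -> a ∈ S' -> a <> zero -> ~ atom S' a ->
  exists u v, atom S' u /\ le u a /\ atom S' v /\ le v a /\ u <> v.
Proof.
  intros FS HS Ha Ha0 Hna.
  assert (SB : sub S' B) by apply HS.
  destruct (@atom_below S' a) as [u [Hu Hua]]; auto.
  assert (HuS : u ∈ S') by apply Hu.
  destruct (@atom_below S' (mul a (neg u))) as [v [Hv Hva]]; auto.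
  - apply HS; auto; now apply HS.
  - intros E; apply le_iff in E; auto; apply Hna.
    now replace a with u by (apply le_antisym; auto).
  - assert (HvS : v ∈ S') by apply Hv.
    exists u, v; repeat split; try apply Hu; try apply Hv; auto.
    + apply le_trans with (mul a (neg u)); auto using le_mul_l.
    + intros ->; apply Hu, le_neg_self; auto.
      apply le_trans with (mul a (neg v)); auto using le_mul_r.
Qed.

Lemma atoms_disjoint S u v : subalgebra S -> atom S u -> atom S v -> u <> v -> mul u v = zero.
Proof.
  intros HS Hu Hv Hne.
  assert (SB : sub S B) by apply HS.
  assert (HuS : u ∈ S) by apply Hu.
  assert (HvS : v ∈ S) by apply Hv.
  destruct Hu as [_ [_ Hu]].
  destruct (Hu (mul u v)) as [|E]; auto; [apply HS | apply le_mul_l |]; auto.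
  destruct Hv as [_ [_ Hv]].
  destruct (Hv u HuS E) as [-> |]; [|contradiction].
  rewrite (mulC HB); auto; apply (mulx0 HB); auto.
Qed.

End BooleanAlgebra.

(** * Towers *)

(** The principle as it is applied: the family is a definable function, the finite pieces are
    indexed by [om] with repetitions allowed, and properness is given by an omitted element. *)
Definition qpkw (M : zf_model) : Prop :=
  forall (J : M) (A : M -> M), dfun1 A -> ~ Fin J ->
    (forall j, j ∈ J -> Fin (A j) /\ exists x y, x ∈ A j /\ y ∈ A j /\ x <> y) ->
    (exists F : M -> M, dfun1 F /\ (forall n, n ∈ om -> Fin (F n)) /\ J = union (img F om)) ->
    exists I b, sub I J /\ ~ Fin I /\
      forall j, j ∈ I -> (exists u, u ∈ app b j) /\ sub (app b j) (A j) /\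
        exists v, v ∈ A j /\ v ∉ app b j.

Section Towers.
Context {M : zf_model} {B : M} {mul : M -> M -> M} {neg : M -> M} {zero : M}.
Context (HB : balg B mul neg zero).
Implicit Types a b x y z t S n m : M.

Let Dmul := dfun_mul HB.
Let Dneg := dfun_neg HB.
Hint Resolve Dmul Dneg : dfn.
Let Bzero := ba_zero HB.
Let Bmul := ba_mul HB.
Let Bneg := ba_neg HB.
Hint Resolve Bzero Bmul Bneg : core.
Let Dle := dpred_le HB.
Let Dsub := dpred_subalgebra HB.
Let Dgen := dfun_gen HB.
Let Datom := dpred_atom HB.
Hint Resolve Dle Dsub Dgen Datom : dfn.
Local Notation le := (@le M mul).
Local Notation subalgebra := (@subalgebra M B mul neg zero).
Local Notation atom := (@atom M mul zero).
Local Notation gen := (@gen M B mul neg zero).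

Definition tower h : Prop := forall n, n ∈ om ->
  app h n ∈ B /\ forall m, m ∈ n -> le (app h n) (app h m) /\ app h n <> app h m.

(** * From a sequence with infinitely many values to a tower *)

Section Halving.
Context {c : M -> M} (Dc : dfun1 c) (Bc : forall n, n ∈ om -> c n ∈ B).

Definition good t : Prop := t ∈ B /\ ~ Fin (img (fun n => mul t (c n)) om).
Lemma dpred_good : dpred1 good. Proof. unfold good; dfn. Qed.
Hint Resolve dpred_good : dfn.

Definition splits t n : Prop := mul t (c n) <> zero /\ mul t (c n) <> t.
Lemma dpred_splits : dpred2 splits. Proof. unfold splits; dfn. Qed.
Hint Resolve dpred_splits : dfn.

Definition next t : M := the (fun y => exists n, n ∈ om /\ splits t n /\
  (forall m, m ∈ n -> ~ splits t m) /\
  ((good (mul t (c n)) /\ y = mul t (c n)) \/ (~ good (mul t (c n)) /\ y = mul t (neg (c n))))).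
Lemma dfun_next : dfun1 next. Proof. unfold next; dfn. Qed.

(** If both parts had finitely many traces, [Fin_split] would leave finitely many traces on [t]. *)
Lemma good_split t b : good t -> b ∈ B -> good (mul t b) \/ good (mul t (neg b)).
Proof.
  intros [Ht Hg] Hb.
  destruct (classic (good (mul t b))) as [|H1]; auto.
  destruct (classic (good (mul t (neg b)))) as [|H2]; auto.
  destruct Hg; apply (Fin_split HB) with b; auto.
  - intros y Hy; apply in_img in Hy as [n [Hn ->]]; [auto | dfn].
  - apply NNPP; intros Hf; apply H1; split; auto; intros Hf'; apply Hf.
    eapply Fin_sub; [exact Hf'|].
    intros y; rewrite in_img by dfn; intros [x [Hx ->]].
    apply in_img in Hx as [n [Hn ->]]; [|dfn]; apply in_img; [dfn|].
    exists n; split; auto; apply (mulAC HB); auto.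
  - apply NNPP; intros Hf; apply H2; split; auto; intros Hf'; apply Hf.
    eapply Fin_sub; [exact Hf'|].
    intros y; rewrite in_img by dfn; intros [x [Hx ->]].
    apply in_img in Hx as [n [Hn ->]]; [|dfn]; apply in_img; [dfn|].
    exists n; split; auto; apply (mulAC HB); auto.
Qed.

Lemma next_spec t : good t -> good (next t) /\ le (next t) t /\ next t <> t.
Proof.
  intros Hg; pose proof Hg as [Ht Hinf].
  destruct (@om_least M (splits t)) as [n [Hn [Hs Hmin]]]; [dfn | |].
  (* If no [c n] splits [t], the only possible traces on [t] are [zero] and [t]. *)
  { apply NNPP; intros Hno; apply Hinf; apply Fin_sub with (upair zero t); [apply Fin_upair|].
    intros y Hy; apply in_img in Hy as [n [Hn ->]]; [|dfn]; apply in_upair.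
    apply NNPP; intros Hns; apply Hno; exists n; split; auto; split; auto. }
  assert (Hcn := Bc Hn).
  assert (Huniq : forall n', n' ∈ om -> splits t n' -> (forall m, m ∈ n' -> ~ splits t m) -> n' = n).
  { intros n' Hn' Hs' Hmin'; destruct (om_total Hn Hn') as [H | [H | H]]; auto.
    - destruct (Hmin' n H Hs).
    - destruct (Hmin n' H Hs'). }
  destruct (classic (good (mul t (c n)))) as [Hgc|Hgc].
  - replace (next t) with (mul t (c n)).
    + split; [auto | split; [apply (le_mul_l HB); auto | apply Hs]].
    + symmetry; apply the_eq; [exists n; auto 7|].
      intros z [n' [Hn' [Hs' [Hmin' Hz]]]]; rewrite (Huniq n') in Hz; auto; tauto.
  - replace (next t) with (mul t (neg (c n))).
    + split; [|split; [apply (le_mul_l HB); auto|]].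
      * destruct (good_split Hg Hcn); tauto.
      (* Removing nothing from [t] would mean that [c n] is disjoint from it, which [splits]
         excludes. *)
      * intros E; apply (proj1 Hs); rewrite <- E, <- (mulA HB), (mulC HB (neg (c n))), (mul_neg HB); auto.
        apply (mulx0 HB); auto.
    + symmetry; apply the_eq; [exists n; auto 7|].
      intros z [n' [Hn' [Hs' [Hmin' Hz]]]]; rewrite (Huniq n') in Hz; auto; tauto.
Qed.

Lemma tower_of_sequence : ~ Fin (img c om) -> exists h, tower h.
Proof.
  intros Hinf.
  destruct (recursion (neg zero) dfun_next) as [h [H0 HS]].
  assert (Hg : forall n, n ∈ om -> good (app h n)).
  { apply (@om_ind M (fun n => good (app h n))); [dfn | |].
    - rewrite H0; split; auto; intros Hf; apply Hinf.
      eapply Fin_sub; [exact Hf|].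
      intros y Hy; apply in_img in Hy as [n [Hn ->]]; auto; apply in_img; [dfn|].
      exists n; split; auto; rewrite (mulC HB); auto; symmetry; apply (le_one HB); auto.
    - intros n Hn Hn'; rewrite HS; auto; now apply next_spec. }
  exists h; intros n Hn; split; [apply Hg; auto|]; revert n Hn.
  apply (@om_ind M (fun n => forall m, m ∈ n -> le (app h n) (app h m) /\ app h n <> app h m)); [dfn | |].
  - intros m Hm; destruct (in_emp Hm).
  - intros n Hn IH m Hm.
    destruct (next_spec (Hg n Hn)) as [Hgn [Hle Hne]]; rewrite <- HS in Hgn, Hle, Hne by auto.
    apply in_suc in Hm as [Hm | ->]; auto.
    assert (Hmo : m ∈ om) by (exact (om_down Hn Hm)).
    assert (Bn := proj1 (Hg n Hn)); assert (Bm := proj1 (Hg m Hmo)); assert (Bs := proj1 Hgn).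
    destruct (IH m Hm) as [Hle' Hne']; split.
    + apply (le_trans HB) with (app h n); auto.
    (* If the values at [suc n] and [m] were equal, the value at [n] would be squeezed between them
       and coincide with that at [m]. *)
    + intros E; rewrite E in *; apply Hne'; apply (le_antisym HB); auto.
Qed.
End Halving.

(** * Splitting atoms along an increasing chain of finite subalgebras *)

Section Chain.
Context {Bs : M -> M} (DBs : dfun1 Bs).
Context (FBs : forall n, n ∈ om -> Fin (Bs n)).
Context (SBs : forall n, n ∈ om -> subalgebra (Bs n)).
Context (IBs : forall n, n ∈ om -> sub (Bs n) (Bs (suc n))).
Context (Binf : ~ Fin (union (img Bs om))).

Let Sub n : n ∈ om -> sub (Bs n) B.
Proof. intros Hn; apply SBs, Hn. Qed.

Let Up n : n ∈ om -> forall m, m ∈ n -> sub (Bs m) (Bs n).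
Proof. intros Hn; apply (increasing_sets DBs IBs Hn). Qed.

Definition split_atoms n : M := sep (Bs n) (fun a => atom (Bs n) a /\ ~ atom (Bs (suc n)) a).
Lemma dfun_split_atoms : dfun1 split_atoms. Proof. unfold split_atoms; dfn. Qed.
Hint Resolve dfun_split_atoms : dfn.

Lemma in_split_atoms n a : a ∈ split_atoms n <-> atom (Bs n) a /\ ~ atom (Bs (suc n)) a.
Proof.
  unfold split_atoms; rewrite in_sep by dfn; split; [tauto|].
  intros H; split; auto; apply H.
Qed.

Definition tagged n : M := img (fun a => pair n a) (split_atoms n).
Lemma dfun_tagged : dfun1 tagged. Proof. unfold tagged; dfn. Qed.
Hint Resolve dfun_tagged : dfn.

Lemma Fin_tagged n : n ∈ om -> Fin (tagged n).
Proof.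
  intros Hn; apply Fin_img; [dfn|]; apply Fin_sub with (Bs n); auto.
  intros a Ha; apply in_split_atoms in Ha; apply Ha.
Qed.

Definition nodes : M := union (img tagged om).
Lemma in_nodes p : p ∈ nodes <-> exists n a, n ∈ om /\ p = pair n a /\ a ∈ split_atoms n.
Proof.
  unfold nodes; rewrite in_union; split.
  - intros [C [HC Hp]]; apply in_img in HC as [n [Hn ->]]; [|dfn].
    apply in_img in Hp as [a [Ha ->]]; [|dfn]; eauto 7.
  - intros [n [a [Hn [-> Ha]]]]; exists (tagged n); rewrite !in_img by dfn; split; [exists n; auto | apply in_img; [dfn | exists a; auto]].
Qed.

(** Each level has finitely many nodes; hence an infinite set of nodes reaches arbitrarily high
    levels. *)
Lemma nodes_bounded I m : m ∈ om -> sub I nodes ->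
  (forall n a, n ∈ om -> pair n a ∈ I -> n ∈ m) -> Fin I.
Proof.
  intros Hm HI Hb; apply Fin_sub with (union (img tagged m)).
  - apply Fin_union; [apply Fin_img; [dfn | now apply Fin_om]|].
    intros x Hx; apply in_img in Hx as [n [Hn ->]]; [|dfn].
    apply Fin_tagged; exact (om_down Hm Hn).
  - intros p Hp; pose proof (HI p Hp) as Hp'; apply in_nodes in Hp' as [n [a [Hn [-> Ha]]]].
    apply in_union; exists (tagged n); rewrite !in_img by dfn; split; [exists n; split; auto; now apply (Hb n a) | apply in_img; [dfn | exists a; auto]].
Qed.

(** Otherwise no atom splits from some level [m] on, and by [atoms_determine] the chain stops
    growing at [Bs m], against the infinity of its union. *)
Lemma nodes_infinite : ~ Fin nodes.
Proof.
  intros HF.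
  assert (Hlev : exists m, m ∈ om /\ forall n a, n ∈ om -> pair n a ∈ nodes -> n ∈ m).
  { destruct (@Fin_om_bounded M (sep om (fun n => exists a, pair n a ∈ nodes))) as [m [Hm H]].
    - apply Fin_sub with (img (fun p => the (fun n => exists a, p = pair n a)) nodes).
      + apply Fin_img; auto; dfn.
      + intros n Hn; apply in_sep in Hn as [Hn [a Ha]]; [|dfn]; apply in_img; [dfn|].
        exists (pair n a); split; auto; symmetry; apply the_eq; eauto.
        intros z [a' E]; apply pair_inj in E; now symmetry.
    - intros n Hn; apply in_sep in Hn; [tauto | dfn].
    - exists m; split; auto; intros n a Hn Ha; apply H; rewrite in_sep by dfn; eauto. }
  destruct Hlev as [m [Hm Hlev]].
  assert (Hall : forall n, n ∈ om -> sub (Bs n) (Bs m)).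
  { apply (@om_ind M (fun n => sub (Bs n) (Bs m))); [dfn | |].
    - destruct (om_emp_min Hm) as [-> | H]; [intros x Hx; auto | apply Up; auto].
    - intros n Hn IH.
      destruct (om_total (om_suc Hn) Hm) as [H | [-> | H]]; [apply Up; auto | intros x Hx; auto |].
      intros x Hx; apply IH; revert x Hx; apply (atoms_determine HB); auto using om_suc.
      intros a Ha; apply NNPP; intros Hna.
      assert (Hnm : n ∈ m).
      { apply (Hlev n a); auto; apply in_nodes; exists n, a; rewrite in_split_atoms; auto. }
      apply (om_irrefl Hm); apply in_suc in H as [H | ->]; auto; eapply om_trans; eauto. }
  apply Binf, Fin_sub with (Bs m); auto.
  intros x Hx; apply in_union in Hx as [C [HC Hx]]; apply in_img in HC as [n [Hn ->]]; auto.
  eapply Hall; eauto.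
Qed.

Definition children p : M :=
  sep B (fun v => exists n a, p = pair n a /\ atom (Bs (suc n)) v /\ le v a).
Lemma dfun_children : dfun1 children. Proof. unfold children; dfn. Qed.

Lemma in_children n a v : n ∈ om -> v ∈ children (pair n a) <-> atom (Bs (suc n)) v /\ le v a.
Proof.
  intros Hn; unfold children; rewrite in_sep by dfn; split.
  - intros [_ [n' [a' [E H]]]]; now apply pair_inj in E as [<- <-].
  - intros H; split; eauto.
    apply (@Sub (suc n)); auto using om_suc; apply H.
Qed.

Lemma infinite_sequence : qpkw M ->
  exists c, dfun1 c /\ (forall n, n ∈ om -> c n ∈ B) /\ ~ Fin (img c om).
Proof.
  intros Q; destruct (Q nodes children dfun_children nodes_infinite) as [I [b [HI [Iinf Hb]]]].
  - intros p Hp; apply in_nodes in Hp as [n [a [Hn [-> Ha]]]].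
    apply in_split_atoms in Ha as [Ha Hna]; split.
    + apply Fin_sub with (Bs (suc n)); auto using om_suc.
      intros v Hv; apply in_children in Hv as [Hv _]; auto; apply Hv.
    + assert (Ha' : a ∈ Bs (suc n)) by (apply IBs; auto; apply Ha).
      destruct (two_atoms HB (FBs (om_suc Hn)) (SBs (om_suc Hn)) Ha' (proj1 (proj2 Ha)) Hna)
        as [u [v [Hu [Hua [Hv [Hva Hne]]]]]].
      exists u, v; rewrite !in_children; auto.
  - exists tagged; repeat split; [dfn | apply Fin_tagged].
  - pose (picked n e := exists a, pair n a ∈ I /\ e ∈ app b (pair n a)).
    assert (Dp : dpred2 picked) by (unfold picked; dfn).
    assert (HIn : forall n a, n ∈ om -> pair n a ∈ I -> atom (Bs n) a).
    { intros n a Hn Ha; apply HI, in_nodes in Ha as [n' [a' [_ [E Ha]]]].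
      apply pair_inj in E as [<- <-]; now apply in_split_atoms in Ha. }
    assert (Hpick : forall n a e, n ∈ om -> pair n a ∈ I -> e ∈ app b (pair n a) ->
      atom (Bs (suc n)) e /\ le e a).
    { intros n a e Hn Ha He; apply in_children; auto; destruct (Hb _ Ha) as [_ [Hs _]]; auto. }
    assert (HpB : forall n e, n ∈ om -> picked n e -> e ∈ B).
    { intros n e Hn [a [Ha He]]; apply (@Sub (suc n)); auto using om_suc.
      eapply Hpick; eauto. }
    (* The join of the picked atoms, taken inside the finite algebra [Bs (suc n)]. Antisymmetry
       makes it unique, so [the] turns it into a definable sequence. *)
    pose (lub n x := x ∈ Bs (suc n) /\ (forall e, picked n e -> le e x) /\
      forall y, y ∈ Bs (suc n) -> (forall e, picked n e -> le e y) -> le x y).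
    assert (Dl : dpred2 lub) by (unfold lub; dfn).
    pose (c n := the (lub n)).
    assert (Dc : dfun1 c) by (unfold c; dfn).
    assert (Hc : forall n, n ∈ om -> lub n (c n)).
    { intros n Hn.
      destruct (@least_above M B mul neg zero HB (Bs (suc n)) (picked n)) as [u Hu]; auto using om_suc.
      { dfn. } { eauto. }
      assert (E : c n = u).
      { apply the_eq; auto; intros z Hz.
        assert (SB := Sub (om_suc Hn)).
        apply (le_antisym HB); auto; [apply SB, Hz | apply SB, Hu | apply Hz | apply Hu];
          try apply Hu; apply Hz. }
      now rewrite E. }
    assert (Hcn : forall n a, n ∈ om -> pair n a ∈ I -> c n ∉ Bs n).
    { intros n a Hn Ha Hcb.
      assert (Hso := om_suc Hn).
      assert (SB := Sub Hso).
      destruct (Hb _ Ha) as [[u Hu] [_ [v [Hv Hvn]]]].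
      assert (Hat := HIn _ _ Hn Ha).
      apply in_children in Hv as [Hv Hva]; auto.
      destruct (Hpick _ _ _ Hn Ha Hu) as [Hua Hule].
      destruct (Hc n Hn) as [HcS [Hup Hmin]].
      assert (aB : a ∈ B) by (apply (Sub Hn), Hat).
      assert (vB : v ∈ B) by (apply SB, Hv).
      assert (uB : u ∈ B) by (apply SB, Hua).
      assert (cB : c n ∈ B) by (apply SB; auto).
      (* The omitted atom [v] is picked at no other node of level [n] either: it lies below [a], and
         distinct atoms of [Bs n] are disjoint. So [neg v] bounds every picked atom. *)
      assert (Hcv : le (c n) (neg v)).
      { apply Hmin; [apply SBs; auto; apply Hv|].
        intros e [a' [Ha' He]].
        destruct (Hpick _ _ _ Hn Ha' He) as [Hea Hele].
        assert (eB : e ∈ B) by (apply SB, Hea).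
        apply (le_neg_iff HB); auto.
        apply (atoms_disjoint HB) with (Bs (suc n)); auto.
        intros ->.
        assert (Hat' := HIn _ _ Hn Ha').
        assert (a'B : a' ∈ B) by (apply (Sub Hn), Hat').
        destruct (classic (a = a')) as [<- |Hne]; [contradiction|].
        destruct Hea as [_ [He0 _]]; apply He0, (le_zero HB); auto.
        rewrite <- (atoms_disjoint HB (SBs Hn) Hat Hat' Hne).
        apply (le_mul HB); auto. }
      (* If [c n] belonged to [Bs n], the atom [a] would be disjoint from it or below it. The picked
         [u] refutes the former, the omitted [v] the latter. *)
      assert (Hac : mul a (c n) = zero \/ mul a (c n) = a).
      { apply Hat; [apply SBs; auto; apply Hat | apply (le_mul_l HB); auto]. }
      destruct Hac as [E | E].
      - destruct Hua as [_ [Hu0 _]]; apply Hu0, (le_zero HB); auto.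
        rewrite <- E; apply (le_mul HB); auto; apply Hup; exists a; auto.
      - destruct Hv as [_ [Hv0 _]]; apply Hv0, (le_neg_self HB); auto.
        apply (le_trans HB) with a; auto; apply (le_trans HB) with (c n); auto. }
    exists c; split; [auto | split].
    { intros n Hn; apply (Sub (om_suc Hn)), (Hc n Hn). }
    intros HF.
    (* Finitely many values would all lie in one [Bs m]; by [Hcn] the set [I] would then have no
       node at level [m] or above. *)
    destruct (Fin_in_stage DBs Up HF) as [m [Hm Hs]].
    { intros y Hy; apply in_img in Hy as [n [Hn ->]]; auto.
      apply in_union; exists (Bs (suc n)); rewrite in_img by auto; split.
      - exists (suc n); auto using om_suc.
      - apply (Hc n Hn). }
    apply Iinf, (@nodes_bounded I m); auto.
    intros n a Hn Ha.
    assert (HcB : c n ∈ Bs m) by (apply Hs, in_img; eauto).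
    destruct (om_total Hn Hm) as [H | H]; auto.
    destruct (Hcn n a Hn Ha).
    destruct H as [-> | H]; auto; apply (Up Hn H); auto.
Qed.

End Chain.

(** * The chain generated by a sequence of finite subsets *)

Section Generation.
Context {f : M -> M} (Df : dfun1 f) (Ff : forall n, n ∈ om -> Fin (f n)).
Context (Bf : forall n, n ∈ om -> sub (f n) B).
Context (If : forall m n, m ∈ om -> n ∈ om -> f m = f n -> m = n).

Definition gens n : M := union (img f (suc n)).
Lemma dfun_gens : dfun1 gens. Proof. unfold gens; dfn. Qed.
Hint Resolve dfun_gens : dfn.

Definition stageB n : M := gen (gens n).
Lemma dfun_stageB : dfun1 stageB. Proof. unfold stageB; dfn. Qed.

Lemma in_gens n x : x ∈ gens n <-> exists m, m ∈ suc n /\ x ∈ f m.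
Proof.
  unfold gens; rewrite in_union; split.
  - intros [C [HC Hx]]; apply in_img in HC as [m [Hm ->]]; eauto.
  - intros [m [Hm Hx]]; exists (f m); rewrite in_img by auto; eauto.
Qed.

Lemma gens_sub n : n ∈ om -> sub (gens n) B.
Proof.
  intros Hn x Hx; apply in_gens in Hx as [m [Hm Hx]].
  apply (@Bf m); auto; eapply om_down; [|eassumption]; auto using om_suc.
Qed.

Lemma Fin_stageB n : n ∈ om -> Fin (stageB n).
Proof.
  intros Hn; apply (Fin_gen HB); [|now apply gens_sub].
  apply Fin_union; [apply Fin_img, Fin_om, om_suc; auto|].
  intros x Hx; apply in_img in Hx as [m [Hm ->]]; auto.
  apply Ff; eapply om_down; [|eassumption]; auto using om_suc.
Qed.

Lemma stageB_subalgebra n : subalgebra (stageB n).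
Proof. apply (gen_subalgebra HB). Qed.

Lemma stageB_suc n : sub (stageB n) (stageB (suc n)).
Proof.
  apply (gen_mono HB); intros x Hx; apply in_gens in Hx as [m [Hm Hx]].
  apply in_gens; exists m; split; auto; apply in_suc; auto.
Qed.

Lemma f_sub_stageB n : n ∈ om -> sub (f n) (stageB n).
Proof.
  intros Hn x Hx; apply (sub_gen HB); [now apply gens_sub|].
  apply in_gens; exists n; split; auto; apply suc_refl.
Qed.

(** A finite union would have a finite power set, but [f] maps [om] injectively into that power
    set. *)
Lemma stageB_infinite : ~ Fin (union (img stageB om)).
Proof.
  intros HF; apply Fin_power in HF; revert HF.
  apply inj_infinite with f; auto.
  intros n Hn; apply in_power; intros x Hx; apply in_union.
  exists (stageB n); split; [apply in_img; [apply dfun_stageB | eauto] | apply f_sub_stageB; auto].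
Qed.

Lemma tower_of_finite_subsets : qpkw M -> exists h, tower h.
Proof.
  intros Q.
  destruct (@infinite_sequence stageB) as [c [Dc [Bc Hc]]]; auto using
    dfun_stageB, Fin_stageB, stageB_subalgebra, stageB_suc, stageB_infinite.
  exact (tower_of_sequence Dc Bc Hc).
Qed.
End Generation.
End Towers.

(** * Interpretation of the formulas *)

(* [sat E e (Foo x y n)] computes to [sFoo E] at the values of [x] and [y], so the two
   are convertible; this is why the classical encodings of the connectives are kept. *)
Definition sand (P Q : Prop) : Prop := (P -> Q -> False) -> False.
Definition sor (P Q : Prop) : Prop := (P -> False) -> Q.
Definition siff (P Q : Prop) : Prop := sand (P -> Q) (Q -> P).
Definition sex {Dom : Type} (P : Dom -> Prop) : Prop := (forall x, P x -> False) -> False.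

Section Interpretation.
Context {Dom : Type} (E : Dom -> Dom -> Prop).

Declare Scope sem_scope.
Local Open Scope sem_scope.
Local Notation "x ≈ y" := (x = y) (at level 70, no associativity) : sem_scope.
Local Notation "x ∈ y" := (E x y) (at level 70, no associativity) : sem_scope.
Local Notation "¬ P" := (P -> False) (at level 75, right associativity) : sem_scope.
Local Notation "P ∧ Q" := (sand P Q) (at level 80, right associativity) : sem_scope.
Local Notation "P ∨ Q" := (sor P Q) (at level 85, right associativity) : sem_scope.
Local Notation "P ⇒ Q" := (P -> Q) (at level 99, Q at level 200, right associativity) : sem_scope.
Local Notation "P ⇔ Q" := (siff P Q) (at level 95, no associativity) : sem_scope.
Local Notation "∀ x , P" := (forall x : Dom, P)
  (at level 200, x name, P at level 200) : sem_scope.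
Local Notation "∃ x , P" := (sex (fun x => P))
  (at level 200, x name, P at level 200) : sem_scope.
Local Notation "∀ x ∈ A , P" := (forall x : Dom, E x A -> P)
  (at level 200, x name, A at level 60, P at level 200) : sem_scope.
Local Notation "∃ x ∈ A , P" := (sex (fun x => sand (E x A) P))
  (at level 200, x name, A at level 60, P at level 200) : sem_scope.

Definition sSubset (A B : Dom) : Prop := ∀ x ∈ A, x ∈ B.
Definition sIsEmpty (A : Dom) : Prop := ∀ x, ¬ x ∈ A.
Definition sNonempty (A : Dom) : Prop := ∃ x, x ∈ A.
Definition sDisjoint (A B : Dom) : Prop := ¬ ∃ x, x ∈ A ∧ x ∈ B.
Definition sIsUpair (p x y : Dom) : Prop := ∀ z, z ∈ p ⇔ (z ≈ x ∨ z ≈ y).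
Definition sIsUnion (U F : Dom) : Prop := ∀ x, x ∈ U ⇔ ∃ A ∈ F, x ∈ A.
Definition sIsInter2 (C A B : Dom) : Prop := ∀ x, x ∈ C ⇔ (x ∈ A ∧ x ∈ B).
Definition sIsSucc (s x : Dom) : Prop := ∀ z, z ∈ s ⇔ (z ∈ x ∨ z ≈ x).

Definition sInductive_set (I : Dom) : Prop :=
  (∃ e ∈ I, sIsEmpty e) ∧ (∀ x ∈ I, ∃ s ∈ I, sIsSucc s x).
Definition sIsOmega (w : Dom) : Prop :=
  ∀ x, x ∈ w ⇔ (∀ I, sInductive_set I ⇒ x ∈ I).

Definition sIsPair (p x y : Dom) : Prop :=
  ∃ a, ∃ b, sIsUpair a x x ∧ sIsUpair b x y ∧ sIsUpair p a b.
Definition sIsProd (P A B : Dom) : Prop :=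
  ∀ p, p ∈ P ⇔ ∃ x ∈ A, ∃ y ∈ B, sIsPair p x y.

Definition sApp (f x y : Dom) : Prop := ∃ p ∈ f, sIsPair p x y.
Definition sApp2 (f x y z : Dom) : Prop := ∃ p, sIsPair p x y ∧ sApp f p z.

Definition sIsFamily (f A : Dom) : Prop :=
  (∀ p ∈ f, ∃ x ∈ A, ∃ y, sIsPair p x y)
  ∧ (∀ x ∈ A, ∃ y, sApp f x y ∧ ∀ z, sApp f x z ⇒ z ≈ y).
Definition sIsFun (f A B : Dom) : Prop :=
  sIsFamily f A ∧ (∀ x ∈ A, ∀ y, sApp f x y ⇒ y ∈ B).
Definition sIsBij (f A B : Dom) : Prop :=
  sIsFun f A B
  ∧ (∀ y ∈ B, ∃ x ∈ A, sApp f x y ∧ ∀ z ∈ A, sApp f z y ⇒ z ≈ x).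

Definition sEquipotent (A B : Dom) : Prop := ∃ f, sIsBij f A B.
Definition sFinite (A : Dom) : Prop :=
  ∃ w, sIsOmega w ∧ ∃ n ∈ w, sEquipotent A n.
Definition sInfinite (A : Dom) : Prop := ¬ sFinite A.
Definition sDenumerable (A : Dom) : Prop :=
  ∃ w, sIsOmega w ∧ sEquipotent A w.
Definition sCountable (A : Dom) : Prop :=
  ∃ w, sIsOmega w ∧ ∃ s, sSubset s w ∧ sEquipotent A s.

Definition sDenumUnionOfFinite (A : Dom) : Prop :=
  ∃ F, sDenumerable F ∧ (∀ x ∈ F, sFinite x) ∧ sIsUnion A F.
Definition sCountableUnionOfFinite (A : Dom) : Prop :=
  ∃ F, sCountable F ∧ (∀ x ∈ F, sFinite x) ∧ sIsUnion A F.

Definition sexpr := (Dom -> Prop) -> Prop.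
Definition sevar (x : Dom) : sexpr := fun k => k x.
Definition seop1 (f : Dom) (s : sexpr) : sexpr :=
  fun k => s (fun a => ∃ b, sApp f a b ∧ k b).
Definition seop2 (f : Dom) (s t : sexpr) : sexpr :=
  fun k => s (fun a => t (fun b => ∃ c, sApp2 f a b c ∧ k c)).
Definition seeq (s t : sexpr) : Prop := s (fun a => t (fun b => a ≈ b)).

Local Notation "s ≡ t" := (seeq s t) (at level 70, no associativity) : sem_scope.

Definition sIsBooleanAlgebra (B add mul neg zero one : Dom) : Prop :=
  let p s t := seop2 add s t in
  let m s t := seop2 mul s t in
  let c s := seop1 neg s in
  let v := sevar in
  (∃ P, sIsProd P B B ∧ sIsFun add P B ∧ sIsFun mul P B)
  ∧ sIsFun neg B B ∧ zero ∈ B ∧ one ∈ B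
  ∧ (∀ x ∈ B, ∀ y ∈ B, ∀ z ∈ B,
       p (v x) (p (v y) (v z)) ≡ p (p (v x) (v y)) (v z) ∧ m (v x) (m (v y) (v z)) ≡ m (m (v x) (v y)) (v z)
       ∧ p (v x) (v y) ≡ p (v y) (v x)           ∧ m (v x) (v y) ≡ m (v y) (v x)
       ∧ p (v x) (m (v x) (v y)) ≡ (v x)         ∧ m (v x) (p (v x) (v y)) ≡ (v x)
       ∧ m (v x) (p (v y) (v z)) ≡ p (m (v x) (v y)) (m (v x) (v z))
       ∧ p (v x) (m (v y) (v z)) ≡ m (p (v x) (v y)) (p (v x) (v z))
       ∧ p (v x) (c (v x)) ≡ (v one)         ∧ m (v x) (c (v x)) ≡ (v zero)).

Definition sBA_lt (mul x y : Dom) : Prop := sevar x ≡ seop2 mul (sevar x) (sevar y) ∧ ¬ x ≈ y.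

Definition sIsTower (B mul t : Dom) : Prop :=
  ∃ w, sIsOmega w ∧ sIsFun t w B
  ∧ (∀ n ∈ w, ∀ m ∈ w, m ∈ n ⇒
       ∃ a, ∃ b, sApp t m a ∧ sApp t n b ∧ sBA_lt mul b a).

Definition sEveryInfiniteBAHasTower : Prop :=
  ∀ B, ∀ add, ∀ mul, ∀ neg, ∀ zero, ∀ one,
    sIsBooleanAlgebra B add mul neg zero one ⇒ sInfinite B ⇒
    ∃ t, sIsTower B mul t.

Definition sEveryInfiniteDenumUnionBAHasTower : Prop :=
  ∀ B, ∀ add, ∀ mul, ∀ neg, ∀ zero, ∀ one,
    sIsBooleanAlgebra B add mul neg zero one ⇒ sInfinite B ⇒
    sDenumUnionOfFinite B ⇒
    ∃ t, sIsTower B mul t.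

Definition sIsFinitePowerset (P X : Dom) : Prop :=
  ∀ x, x ∈ P ⇔ (sSubset x X ∧ sFinite x).

Definition sIQDI : Prop :=
  ∀ X, sInfinite X ⇒
    ∃ P, sIsFinitePowerset P X ∧ ∃ D, sSubset D P ∧ sDenumerable D.

Definition sAtLeastTwo (A : Dom) : Prop := ∃ x ∈ A, ∃ y ∈ A, ¬ x ≈ y.
Definition sProperSubset (A B : Dom) : Prop := sSubset A B ∧ ¬ A ≈ B.

Definition sQPKW : Prop :=
  ∀ J, ∀ A, sInfinite J ⇒ sIsFamily A J ⇒
    (∀ j ∈ J, ∃ a, sApp A j a ∧ sFinite a ∧ sAtLeastTwo a) ⇒
    sCountableUnionOfFinite J ⇒
    ∃ I, ∃ B, sSubset I J ∧ sInfinite I ∧ sIsFamily B I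
    ∧ (∀ j ∈ I, ∃ a, ∃ b, sApp A j a ∧ sApp B j b
                          ∧ sNonempty b ∧ sProperSubset b a).

Definition sIsTopology (X O : Dom) : Prop :=
  (∀ U ∈ O, sSubset U X) ∧ X ∈ O ∧ (∃ e ∈ O, sIsEmpty e)
  ∧ (∀ U ∈ O, ∀ V ∈ O, ∃ W ∈ O, sIsInter2 W U V)
  ∧ (∀ F, sSubset F O ⇒ ∃ W ∈ O, sIsUnion W F).

Definition sIsClosure (X O C A : Dom) : Prop :=
  ∀ x, x ∈ C ⇔ (x ∈ X ∧ ∀ U ∈ O, x ∈ U ⇒ ∃ y, y ∈ U ∧ y ∈ A).
Definition sIsInterior (X O I A : Dom) : Prop :=
  ∀ x, x ∈ I ⇔ (x ∈ X ∧ ∃ U ∈ O, x ∈ U ∧ sSubset U A).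
Definition sRegularOpen (X O U : Dom) : Prop :=
  sSubset U X ∧ ∃ C, sIsClosure X O C U ∧ sIsInterior X O U C.
Definition sDense (X O D : Dom) : Prop :=
  sSubset D X ∧ sIsClosure X O X D.

Definition sCellular (O C : Dom) : Prop :=
  (∀ U ∈ C, U ∈ O ∧ sNonempty U)
  ∧ (∀ U ∈ C, ∀ V ∈ C, ¬ U ≈ V ⇒ sDisjoint U V).

Definition sIsRegularMatrix (X O M : Dom) : Prop :=
  ∃ w, sIsOmega w ∧ sIsFamily M w
  ∧ (∀ n ∈ w, ∃ C, sApp M n C ∧ sFinite C ∧ sCellular O C
       ∧ (∀ U ∈ C, sRegularOpen X O U)
       ∧ ∃ D, sIsUnion D C ∧ sDense X O D)
  ∧ (∀ m ∈ w, ∀ n ∈ w, ¬ m ≈ n ⇒ ¬ ∃ C, sApp M m C ∧ sApp M n C).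

Definition sRegularMatrixGivesDenumerableCellularFamily : Prop :=
  ∀ X, ∀ O, sIsTopology X O ⇒
    (∃ M, sIsRegularMatrix X O M) ⇒
    ∃ C, sCellular O C ∧ sDenumerable C.

End Interpretation.

(** Extensionality turns the equivalence of connectives into an equality of functions, so that
    rewriting also reaches occurrences under binders. *)
Lemma sand_eq : sand = and.
Proof. extensionality P; extensionality Q; apply propositional_extensionality; unfold sand; tauto. Qed.
Lemma sor_eq : sor = or.
Proof. extensionality P; extensionality Q; apply propositional_extensionality; unfold sor; tauto. Qed.
Lemma siff_eq : siff = iff.
Proof.
  extensionality P; extensionality Q; apply propositional_extensionality.
  unfold siff; rewrite sand_eq; tauto.
Qed.
Lemma sex_eq Dom : @sex Dom = @ex Dom.
Proof.
  extensionality P; apply propositional_extensionality; unfold sex; split.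
  - intros H; apply NNPP; intros Hn; apply H; eauto.
  - intros [x Hx] H; eauto.
Qed.

(** * From satisfaction of the axioms to [zf_model] *)

Section Build.
Context {M : Type} {E : M -> M -> Prop} (e : nat -> M).
Context (H : forall f e', ZF f -> sat E e' f).

Lemma model_separation (P : M -> Prop) : definable_pred1 E P ->
  forall A, exists B, forall x, E x B <-> E x A /\ P x.
Proof.
  intros [f [r Hf]].
  pose proof (H (mix e r) (ZF_separation (ren under f))) as HS.
  (* The quantifiers over [A], [B] and [x] precede the schematic formula, so its parameters start at
     index 3. *)
  change (forall A, sex (fun B => forall x, siff (E x B) (sand (E x A)
    (sat E (consD x (consD B (consD A (mix e r)))) (ren (scons 0 (fun k => 3 + k)) (ren under f)))))) in HS.
  rewrite sex_eq, siff_eq, sand_eq in HS.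
  intros A; destruct (HS A) as [B HB]; exists B; intros x; rewrite HB, sat_ren.
  replace (fun k => consD x (consD B (consD A (mix e r))) (scons 0 (fun k => 3 + k) k))
    with (consD x (mix e r)) by (extensionality k; now destruct k).
  rewrite sat_ren, env_under, <- Hf; reflexivity.
Qed.

Lemma model_replacement (R : M -> M -> Prop) : definable_pred2 E R ->
  (forall x y z, R x y -> R x z -> y = z) ->
  forall A, exists B, forall y, E y B <-> exists x, E x A /\ R x y.
Proof.
  intros [f [r Hf]] HR.
  (* With two arguments [under] is applied twice, the second time below the variable that is already
     in place. *)
  pose (g := ren (up under) (ren under f)).
  assert (Hg : forall e' n i j, (forall k, e' (n + k) = mix e r k) ->
    sat E e' (ren (scons i (scons j (fun k => n + k))) g) <-> R (e' i) (e' j)).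
  { intros e' n i j He; unfold g; rewrite sat_ren.
    replace (fun k => e' (scons i (scons j (fun k => n + k)) k))
      with (consD (e' i) (consD (e' j) (mix e r))) by (extensionality k; destruct k as [|[|k]]; simpl; auto).
    rewrite sat_ren.
    replace (fun k => consD (e' i) (consD (e' j) (mix e r)) (up under k))
      with (consD (e' i) (mix (consD (e' j) e) r)) by (rewrite <- env_under; extensionality k; now destruct k).
    rewrite sat_ren, env_under, <- Hf; reflexivity. }
  pose proof (H (mix e r) (ZF_replacement g)) as HS.
  change ((forall x y z, sand
      (sat E (consD z (consD y (consD x (mix e r)))) (ren (scons 2 (scons 1 (fun k => 3 + k))) g))
      (sat E (consD z (consD y (consD x (mix e r)))) (ren (scons 2 (scons 0 (fun k => 3 + k))) g)) -> y = z) ->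
    forall A, sex (fun B => forall y, siff (E y B) (sex (fun x => sand (E x A)
      (sat E (consD x (consD y (consD B (consD A (mix e r))))) (ren (scons 0 (scons 1 (fun k => 4 + k))) g)))))) in HS.
  rewrite sex_eq, siff_eq, sand_eq in HS.
  intros A; destruct (HS (fun x y z Hxyz => match Hxyz with conj H1 H2 => HR x y z (proj1 (Hg _ _ _ _ (fun k => eq_refl)) H1)
    (proj1 (Hg _ _ _ _ (fun k => eq_refl)) H2) end) A) as [B HB].
  exists B; intros y; rewrite HB; clear HS HB.
  assert (Hx : forall x, sat E (consD x (consD y (consD B (consD A (mix e r))))) (ren (scons 0 (scons 1 (fun k => 4 + k))) g) <-> R x y).
  { intros x; apply Hg; reflexivity. }
  split; intros [x [HxA HxR]]; exists x; split; auto; now apply Hx.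
Qed.

(** Kept transparent: the theorem is finished by conversion, for which [mem] of this model must
    compute to [E]. *)
Definition build_model : zf_model.
Proof.
  refine {| dom := M; mem := E; d0 := e 0;
    zf_separation := model_separation; zf_replacement := model_replacement |}.
  - exact (fun x y Hxy => H e ZF_extensionality x y (fun z K => K (proj1 (Hxy z)) (proj2 (Hxy z)))).
  - pose proof (H e ZF_pairing) as HP.
    change (forall x y, sex (fun p => forall z, siff (E z p) (sor (z = x) (z = y)))) in HP.
    now rewrite sex_eq, siff_eq, sor_eq in HP.
  - pose proof (H e ZF_union) as HP.
    change (forall F, sex (fun U => forall x, siff (E x U) (sex (fun A => sand (E A F) (E x A))))) in HP.
    now rewrite sex_eq, siff_eq, sand_eq in HP.
  - pose proof (H e ZF_power) as HP.
    change (forall A, sex (fun P => forall x, siff (E x P) (forall z, E z x -> E z A))) in HP.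
    now rewrite sex_eq, siff_eq in HP.
  - pose proof (H e ZF_infinity) as HP.
    change (sex (fun I => sand (sex (fun e => sand (E e I) (forall z, E z e -> False)))
      (forall x, E x I -> sex (fun s => sand (E s I) (forall z, siff (E z s) (sor (E z x) (z = x))))))) in HP.
    now rewrite sex_eq, siff_eq, sand_eq, sor_eq in HP.
Defined.
End Build.

(** * Formulas of set theory read in a model *)

Section Decoding.
Context {M : zf_model}.
Implicit Types f x y z A B p n m : M.

Lemma sSubset_eq : sSubset (@mem M) = sub.
Proof. reflexivity. Qed.

Lemma sIsUpair_eq : sIsUpair (@mem M) = fun p x y => p = upair x y.
Proof.
  extensionality p; extensionality x; extensionality y; apply propositional_extensionality.
  unfold sIsUpair; rewrite siff_eq, sor_eq; split.
  - intros H; apply zf_ext; intros z; now rewrite H, in_upair.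
  - intros -> z; apply in_upair.
Qed.

Lemma sIsUnion_eq : sIsUnion (@mem M) = fun U F => U = union F.
Proof.
  extensionality U; extensionality F; apply propositional_extensionality.
  unfold sIsUnion; rewrite siff_eq, sex_eq, sand_eq; split.
  - intros H; apply zf_ext; intros z; now rewrite H, in_union.
  - intros -> z; apply in_union.
Qed.

Lemma sIsPair_eq : sIsPair (@mem M) = fun p x y => p = pair x y.
Proof.
  extensionality p; extensionality x; extensionality y; apply propositional_extensionality.
  unfold sIsPair; rewrite sex_eq, sand_eq, sIsUpair_eq; split.
  - intros [a [b [-> [-> ->]]]]; reflexivity.
  - intros ->; eexists; eexists; repeat split.
Qed.

Lemma sApp_eq : sApp (@mem M) = fun f x y => pair x y ∈ f.
Proof.
  extensionality f; extensionality x; extensionality y; apply propositional_extensionality.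
  unfold sApp; rewrite sex_eq, sand_eq, sIsPair_eq; split.
  - intros [p [Hp ->]]; exact Hp.
  - eauto.
Qed.

Lemma sApp2_eq : sApp2 (@mem M) = fun f x y z => pair (pair x y) z ∈ f.
Proof.
  extensionality f; extensionality x; extensionality y; extensionality z; apply propositional_extensionality.
  unfold sApp2; rewrite sex_eq, sand_eq, sIsPair_eq, sApp_eq; split.
  - intros [p [-> Hp]]; exact Hp.
  - eauto.
Qed.

Definition family f A : Prop :=
  (forall p, p ∈ f -> exists x, x ∈ A /\ exists y, p = pair x y)
  /\ forall x, x ∈ A -> forall y, pair x y ∈ f <-> y = app f x.

Lemma sIsFamily_eq : sIsFamily (@mem M) = family.
Proof.
  extensionality f; extensionality A; apply propositional_extensionality.
  unfold sIsFamily, family; rewrite sand_eq, !sex_eq, sApp_eq, sIsPair_eq.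
  split; intros [H1 H2]; split; auto; intros x Hx.
  - destruct (H2 x Hx) as [y [Hy Hu]].
    assert (E : app f x = y) by (apply the_eq; auto).
    intros z; rewrite E; split; [apply Hu | now intros ->].
  - exists (app f x); rewrite H2; auto; split; auto; intros z; rewrite H2; auto.
Qed.

Lemma family_lam A (F : M -> M) : dfun1 F -> family (lam A F) A.
Proof.
  intros DF; split.
  - intros p Hp; apply in_lam in Hp as [x [Hx ->]]; eauto.
  - intros x Hx y; rewrite app_lam by auto; rewrite in_lam by auto; split.
    + intros [x' [_ E]]; now apply pair_inj in E as [-> ->].
    + intros ->; eauto.
Qed.

Definition func f A B : Prop := family f A /\ forall x, x ∈ A -> app f x ∈ B.

Lemma sIsFun_eq : sIsFun (@mem M) = func.
Proof.
  extensionality f; extensionality A; extensionality B; apply propositional_extensionality.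
  unfold sIsFun, func; rewrite sand_eq, sApp_eq, sIsFamily_eq.
  split; intros [H1 H2]; split; auto; intros x Hx.
  - apply (H2 x Hx), H1; auto.
  - intros y Hy; apply H1 in Hy as ->; auto.
Qed.

Lemma func_lam A B (F : M -> M) : dfun1 F -> (forall x, x ∈ A -> F x ∈ B) -> func (lam A F) A B.
Proof. intros DF HF; split; [now apply family_lam | intros x Hx; rewrite app_lam; auto]. Qed.

Lemma sEquipotent_eq : sEquipotent (@mem M) = equip.
Proof.
  extensionality A; extensionality B; apply propositional_extensionality.
  unfold sEquipotent, sIsBij; rewrite !sex_eq, !sand_eq, sIsFun_eq, sApp_eq; split.
  - intros [f [[H1 H2] H3]]; exists f; repeat split; auto.
    + intros x x' Hx Hx' E.
      destruct (H3 (app f x)) as [z [Hz [_ Hu]]]; auto.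
      rewrite (Hu x), (Hu x'); auto; apply H1; auto.
    + intros y Hy; destruct (H3 y Hy) as [x [Hx [Hxy _]]]; exists x; split; auto.
      symmetry; apply H1; auto.
  (* The set [f] itself need not be a function with domain [A]; its trimmed graph is. *)
  - intros [f [H1 [H2 H3]]]; exists (lam A (app f)).
    assert (HF : func (lam A (app f)) A B) by (apply func_lam; [dfn | auto]).
    split; auto; intros y Hy; destruct (H3 y Hy) as [x [Hx <-]].
    exists x; split; auto; split.
    + apply HF; auto; rewrite app_lam; auto; dfn.
    + intros z Hz Hzx; apply HF in Hzx; auto; rewrite app_lam in Hzx; auto; dfn.
Qed.

Lemma sIsOmega_eq : sIsOmega (@mem M) = fun w => w = om.
Proof.
  assert (HI : sInductive_set (@mem M) = inductive).
  { extensionality I; apply propositional_extensionality.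
    unfold sInductive_set, inductive, sIsEmpty, sIsSucc; rewrite sand_eq, siff_eq, sor_eq, sex_eq; split.
    - intros [[e [HeI He]] HS]; split.
      + replace emp with e; auto; apply zf_ext; intros z; split; intros Hz; [destruct (He z Hz) | destruct (in_emp Hz)].
      + intros x Hx; destruct (HS x Hx) as [s [Hs Hz]].
        replace (suc x) with s; auto; apply zf_ext; intros z; now rewrite Hz, in_suc.
    - intros [H0 HS]; split; [exists emp; split; auto; intros x; apply in_emp|].
      intros x Hx; exists (suc x); split; auto; intros z; apply in_suc. }
  extensionality w; apply propositional_extensionality.
  unfold sIsOmega; rewrite siff_eq, HI; split.
  - intros H; apply zf_ext; intros z; now rewrite H, in_om.
  - intros -> z; apply in_om.
Qed.

Lemma sFinite_eq : sFinite (@mem M) = Fin.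
Proof.
  extensionality A; apply propositional_extensionality.
  unfold sFinite; rewrite sand_eq, !sex_eq, sIsOmega_eq, sEquipotent_eq; split.
  - intros [w [-> H]]; exact H.
  - intros H; exists om; auto.
Qed.

Lemma sInfinite_eq : sInfinite (@mem M) = fun A => ~ Fin A.
Proof. unfold sInfinite; now rewrite sFinite_eq. Qed.

Lemma sDenumerable_eq : sDenumerable (@mem M) = fun A => equip A om.
Proof.
  extensionality A; apply propositional_extensionality.
  unfold sDenumerable; rewrite sand_eq, sex_eq, sIsOmega_eq, sEquipotent_eq; split.
  - intros [w [-> H]]; exact H.
  - eauto.
Qed.

Lemma sCountable_eq : sCountable (@mem M) = fun A => exists s, sub s om /\ equip A s.
Proof.
  extensionality A; apply propositional_extensionality.
  unfold sCountable; rewrite sand_eq, !sex_eq, sIsOmega_eq, sEquipotent_eq, sSubset_eq; split.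
  - intros [w [-> H]]; exact H.
  - intros H; exists om; auto.
Qed.

Definition iqdi : Prop := forall X : M, ~ Fin X -> exists f,
  (forall n, n ∈ om -> Fin (app f n) /\ sub (app f n) X) /\
  (forall m n, m ∈ om -> n ∈ om -> app f m = app f n -> m = n).

Lemma iqdi_of_sIQDI : sIQDI (@mem M) -> iqdi.
Proof.
  unfold sIQDI, sIsFinitePowerset.
  rewrite sInfinite_eq, !sex_eq, sand_eq, siff_eq, sSubset_eq, sFinite_eq, sDenumerable_eq.
  intros H X HX; destruct (H X HX) as [P [HP [D [HD He]]]].
  destruct (equip_sym He) as [f [F1 [F2 _]]]; exists f; split; auto.
  intros n Hn; apply and_comm, HP, HD, F1, Hn.
Qed.

(** Each value is sent to the least index at which it occurs. *)
Lemma countable_range (F : M -> M) : dfun1 F -> exists s, sub s om /\ equip (img F om) s.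
Proof.
  intros DF.
  pose (g := fun y => the (fun n => n ∈ om /\ F n = y /\ forall m, m ∈ n -> F m <> y)).
  assert (Dg : dfun1 g) by (unfold g; dfn).
  assert (Hg : forall n, n ∈ om -> g (F n) ∈ om /\ F (g (F n)) = F n).
  { intros n Hn.
    destruct (@om_least M (fun m => F m = F n)) as [m [Hm [E Hmin]]]; [dfn | eauto |].
    replace (g (F n)) with m; auto; symmetry; apply the_eq; auto.
    intros z [Hz [Ez Hz']]; destruct (om_total Hz Hm) as [H | [H | H]]; auto.
    - destruct (Hmin z H Ez).
    - destruct (Hz' m H E). }
  exists (img g (img F om)); split.
  - intros x Hx; apply in_img in Hx as [y [Hy ->]]; auto.
    apply in_img in Hy as [n [Hn ->]]; auto; now apply Hg.
  - apply equip_intro with g; auto.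
    + intros x Hx; apply in_img; eauto.
    + intros x x' Hx Hx' E; apply in_img in Hx as [n [Hn ->]]; auto; apply in_img in Hx' as [n' [Hn' ->]]; auto.
      destruct (Hg n Hn) as [_ <-], (Hg n' Hn') as [_ <-]; congruence.
    + intros y Hy; apply in_img in Hy as [x [Hx ->]]; eauto.
Qed.

Lemma qpkw_of_sQPKW : sQPKW (@mem M) -> qpkw M.
Proof.
  unfold sQPKW, sCountableUnionOfFinite, sAtLeastTwo, sNonempty, sProperSubset.
  rewrite sInfinite_eq, !sex_eq, !sand_eq, sSubset_eq, sFinite_eq, sCountable_eq, sIsFamily_eq, sApp_eq, sIsUnion_eq.
  intros H J A DA HJ HA [F [DF [FF ->]]].
  destruct (H (union (img F om)) (lam (union (img F om)) A)) as [I [b [HI [Iinf [Hb HIb]]]]]; auto.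
  - now apply family_lam.
  - intros j Hj; exists (A j); split; [apply in_lam; eauto|].
    destruct (HA j Hj) as [HF [x [y [Hx [Hy Hxy]]]]]; split; eauto 7.
  - exists (img F om); split; [now apply countable_range | split; auto].
    intros x Hx; apply in_img in Hx as [n [Hn ->]]; auto.
  - exists I, b; split; auto; split; auto.
    intros j Hj; destruct (HIb j Hj) as [a [b' [Ha [Hb' [Hne [Hs Hn]]]]]].
    apply Hb in Hb' as ->; auto.
    apply in_lam in Ha as [j' [_ E]]; auto; apply pair_inj in E as [<- ->].
    split; auto; split; auto; apply NNPP; intros Hno; apply Hn, set_eq; auto.
    intros v Hv; apply NNPP; intros Hvn; eauto.
Qed.

End Decoding.

(** * Boolean algebras of a model and their reduction to meet and complement *)

Section BooleanDecoding.
Context {M : zf_model}.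
Implicit Types f x y z A B C t n m p : M.

Definition prod A B : M := union (img (fun x => img (fun y => pair x y) B) A).
Lemma in_prod A B p : p ∈ prod A B <-> exists x, x ∈ A /\ exists y, y ∈ B /\ p = pair x y.
Proof.
  unfold prod; rewrite in_union; split.
  - intros [C [HC Hp]]; apply in_img in HC as [x [Hx ->]]; [|dfn].
    apply in_img in Hp as [y [Hy ->]]; [eauto | dfn].
  - intros [x [Hx [y [Hy ->]]]]; exists (img (fun y => pair x y) B).
    split; apply in_img; try dfn; eauto.
Qed.
Lemma pair_in_prod A B x y : x ∈ A -> y ∈ B -> pair x y ∈ prod A B.
Proof. intros Hx Hy; apply in_prod; eauto. Qed.

Lemma sIsProd_eq : sIsProd (@mem M) = fun P A B => P = prod A B.
Proof.
  extensionality P; extensionality A; extensionality B; apply propositional_extensionality.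
  unfold sIsProd; rewrite siff_eq, sex_eq, sand_eq, sIsPair_eq; split.
  - intros H; apply zf_ext; intros z; now rewrite H, in_prod.
  - intros -> z; apply in_prod.
Qed.

(** An equality of expressions, so that nested terms collapse to their values from the inside
    outwards by rewriting. *)
Lemma seop2_val B f x y : func f (prod B B) B -> x ∈ B -> y ∈ B ->
  seop2 (@mem M) f (sevar x) (sevar y) = sevar (app f (pair x y)).
Proof.
  intros [[_ Hf] _] Hx Hy; extensionality k; apply propositional_extensionality.
  unfold seop2, sevar; rewrite sex_eq, sand_eq, sApp2_eq; split.
  - intros [z [Hz Hk]]; apply Hf in Hz as ->; auto using pair_in_prod.
  - intros Hk; eexists; split; [|exact Hk]; apply Hf; auto using pair_in_prod.
Qed.

Lemma seop1_val B f x : func f B B -> x ∈ B -> seop1 (@mem M) f (sevar x) = sevar (app f x).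
Proof.
  intros [[_ Hf] _] Hx; extensionality k; apply propositional_extensionality.
  unfold seop1, sevar; rewrite sex_eq, sand_eq, sApp_eq; split.
  - intros [z [Hz Hk]]; apply Hf in Hz as ->; auto.
  - intros Hk; eexists; split; [|exact Hk]; apply Hf; auto.
Qed.

Record boolalg B add mul neg zero one : Prop := {
  func_add : func add (prod B B) B;
  func_mul : func mul (prod B B) B;
  func_neg : func neg B B;
  zero_in : zero ∈ B;
  one_in : one ∈ B;
  ba_laws :
    let p x y := app add (pair x y) in
    let m x y := app mul (pair x y) in
    let c x := app neg x in
    forall x, x ∈ B -> forall y, y ∈ B -> forall z, z ∈ B ->
      p x (p y z) = p (p x y) z /\ m x (m y z) = m (m x y) z
      /\ p x y = p y x /\ m x y = m y x
      /\ p x (m x y) = x /\ m x (p x y) = x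
      /\ m x (p y z) = p (m x y) (m x z)
      /\ p x (m y z) = m (p x y) (p x z)
      /\ p x (c x) = one /\ m x (c x) = zero
}.

Lemma func_app2 B f x y : func f (prod B B) B -> x ∈ B -> y ∈ B -> app f (pair x y) ∈ B.
Proof. intros [_ H] Hx Hy; apply H, pair_in_prod; auto. Qed.

Lemma func_app1 B f x : func f B B -> x ∈ B -> app f x ∈ B.
Proof. intros [_ H]; apply H. Qed.

Lemma sIsBooleanAlgebra_iff B add mul neg zero one :
  sIsBooleanAlgebra (@mem M) B add mul neg zero one <-> boolalg B add mul neg zero one.
Proof.
  unfold sIsBooleanAlgebra; cbv zeta.
  rewrite sand_eq, sex_eq, sIsProd_eq, sIsFun_eq.
  split.
  - intros [[P [-> [Ha Hm]]] [Hn [H0 [H1 H]]]]; split; auto; cbv zeta.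
    intros x Hx y Hy z Hz; specialize (H x Hx y Hy z Hz).
    rewrite ?(seop1_val Hn Hx) in H.
    repeat first
      [ rewrite (@seop2_val B add) in H by auto 6 using func_app1, func_app2
      | rewrite (@seop2_val B mul) in H by auto 6 using func_app1, func_app2 ].
    exact H.
  - intros [Ha Hm Hn H0 H1 H]; split; [exists (prod B B); auto | do 3 (split; auto)].
    intros x Hx y Hy z Hz; specialize (H x Hx y Hy z Hz).
    rewrite ?(seop1_val Hn Hx).
    repeat first
      [ rewrite (@seop2_val B add) by auto 6 using func_app1, func_app2
      | rewrite (@seop2_val B mul) by auto 6 using func_app1, func_app2 ].
    exact H.
Qed.

Section Laws.
Context {B add mul neg zero one : M} (HB : boolalg B add mul neg zero one).
Local Notation "x ⊕ y" := (app add (pair x y)) (at level 50, left associativity).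
Local Notation "x ⊙ y" := (app mul (pair x y)) (at level 40, left associativity).
Local Notation "⊖ x" := (app neg x) (at level 35, right associativity).

Let Badd x y : x ∈ B -> y ∈ B -> x ⊕ y ∈ B.
Proof. apply func_app2, HB. Qed.
Let Bmul x y : x ∈ B -> y ∈ B -> x ⊙ y ∈ B.
Proof. apply func_app2, HB. Qed.
Let Bneg x : x ∈ B -> ⊖ x ∈ B.
Proof. apply func_app1, HB. Qed.
Let Bzero := zero_in HB.
Let Bone := one_in HB.
Hint Resolve Badd Bmul Bneg Bzero Bone : core.

Let addC x y : x ∈ B -> y ∈ B -> x ⊕ y = y ⊕ x.
Proof. intros Hx Hy; apply (ba_laws HB Hx Hy Hx). Qed.
Let mC x y : x ∈ B -> y ∈ B -> x ⊙ y = y ⊙ x.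
Proof. intros Hx Hy; apply (ba_laws HB Hx Hy Hx). Qed.
Let mA x y z : x ∈ B -> y ∈ B -> z ∈ B -> x ⊙ (y ⊙ z) = x ⊙ y ⊙ z.
Proof. intros Hx Hy Hz; apply (ba_laws HB Hx Hy Hz). Qed.
Let absorb_add x y : x ∈ B -> y ∈ B -> x ⊕ x ⊙ y = x.
Proof. intros Hx Hy; apply (ba_laws HB Hx Hy Hx). Qed.
Let absorb_mul x y : x ∈ B -> y ∈ B -> x ⊙ (x ⊕ y) = x.
Proof. intros Hx Hy; apply (ba_laws HB Hx Hy Hx). Qed.
Let distr x y z : x ∈ B -> y ∈ B -> z ∈ B -> x ⊙ (y ⊕ z) = x ⊙ y ⊕ x ⊙ z.
Proof. intros Hx Hy Hz; apply (ba_laws HB Hx Hy Hz). Qed.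
Let add_neg x : x ∈ B -> x ⊕ ⊖ x = one.
Proof. intros Hx; apply (ba_laws HB Hx Hx Hx). Qed.
Let m_neg x : x ∈ B -> x ⊙ ⊖ x = zero.
Proof. intros Hx; apply (ba_laws HB Hx Hx Hx). Qed.

Let mxx x : x ∈ B -> x ⊙ x = x.
Proof. intros Hx; rewrite <- (absorb_add Hx Hx) at 2; auto. Qed.
Let mx1 x : x ∈ B -> x ⊙ one = x.
Proof. intros Hx; rewrite <- (add_neg Hx); auto. Qed.
Let mx0 x : x ∈ B -> x ⊙ zero = zero.
Proof. intros Hx; rewrite <- (m_neg Hx), mA, mxx; auto. Qed.
Let addx0 x : x ∈ B -> x ⊕ zero = x.
Proof. intros Hx; rewrite <- (m_neg Hx); auto. Qed.

Let m_eq0 x y : x ∈ B -> y ∈ B -> x ⊙ y = zero <-> x ⊙ ⊖ y = x.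
Proof.
  intros Hx Hy; split; intros E.
  - rewrite <- (mx1 Hx) at 2; rewrite <- (add_neg Hy), distr, E, addC, addx0; auto.
  - rewrite <- E, <- mA, (mC (x := ⊖ y)), m_neg; auto.
Qed.

Let nK x : x ∈ B -> ⊖ ⊖ x = x.
Proof.
  intros Hx.
  assert (H1 : x ⊙ ⊖ ⊖ x = x) by (apply m_eq0; auto).
  rewrite <- H1 at 2; rewrite mC, <- (mx1 (x := ⊖ ⊖ x)) at 1; auto.
  rewrite <- (add_neg Hx), distr, (mC (y := ⊖ x)), m_neg, addx0; auto.
Qed.

Lemma balg_of_boolalg : balg B (fun x y => x ⊙ y) (fun x => ⊖ x) zero.
Proof. split; auto; dfn. Qed.

(** Needed because [subalgebra] speaks of meets and complements only: it yields closure under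
    joins. *)
Lemma de_morgan x y : x ∈ B -> y ∈ B -> x ⊕ y = ⊖ (⊖ x ⊙ ⊖ y).
Proof.
  intros Hx Hy; pose proof balg_of_boolalg as L.
  assert (Hle : forall x y, x ∈ B -> y ∈ B -> x ⊙ ⊖ (⊖ x ⊙ ⊖ y) = x /\ y ⊙ ⊖ (⊖ x ⊙ ⊖ y) = y).
  { clear x y Hx Hy; intros x y Hx Hy; split; apply (le_neg_sym L); auto.
    - apply (le_mul_l L); auto.
    - apply (le_mul_r L); auto. }
  apply (le_antisym L); auto.
  - destruct (Hle x y Hx Hy) as [H1 H2]; unfold le.
    rewrite mC, distr, !(mC (x := ⊖ (⊖ x ⊙ ⊖ y))), H1, H2; auto.
  - rewrite <- (nK (x := x ⊕ y)); auto; apply (le_neg_sym L); auto.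
    rewrite nK; auto; apply (le_mul L); auto; apply (le_neg_sym L); auto; rewrite nK; auto.
    + apply absorb_mul; auto.
    + rewrite addC; auto; apply absorb_mul; auto.
Qed.

End Laws.
End BooleanDecoding.

(** * The theorem in a model *)

Section Transfer.
Context {M : zf_model}.
Implicit Types f h x y z A B C D O U V X t n m p : M.

Definition is_tower B f t : Prop := func t om B /\
  forall n, n ∈ om -> forall m, m ∈ om -> m ∈ n ->
    pair (pair (app t n) (app t m)) (app t n) ∈ f /\ app t n <> app t m.

Lemma sIsTower_eq : sIsTower (@mem M) = is_tower.
Proof.
  extensionality B; extensionality f; extensionality t; apply propositional_extensionality.
  unfold sIsTower, sBA_lt, seeq, seop2, sevar.
  rewrite sand_eq, !sex_eq, sIsOmega_eq, sIsFun_eq, sApp_eq, sApp2_eq; split.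
  - intros [w [-> [Ht H]]]; split; auto; intros n Hn m Hm Hmn.
    destruct (H n Hn m Hm Hmn) as [a [b [Ha [Hb [[c [Hc <-]] Hne]]]]].
    apply Ht in Ha as ->; auto; apply Ht in Hb as ->; auto.
  - intros [Ht H]; exists om; split; auto; split; auto; intros n Hn m Hm Hmn.
    exists (app t m), (app t n); destruct (H n Hn m Hm Hmn) as [H1 H2].
    split; [apply Ht; auto | split; [apply Ht; auto | split; eauto]].
Qed.

(** The increasing enumeration of [A], by recursion with [nxt n] the least element of [A] beyond
    [n]. *)
Lemma infinite_subset_om A : sub A om -> ~ Fin A -> equip A om.
Proof.
  intros HA Hinf.
  assert (Hgt : forall n, n ∈ om -> exists k, k ∈ A /\ n ∈ k).
  { intros n Hn; apply NNPP; intros Hno; apply Hinf.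
    apply Fin_sub with (suc n); [apply Fin_om, om_suc, Hn|].
    intros k Hk; apply in_suc; destruct (om_total (HA k Hk) Hn) as [H | [H | H]]; auto.
    destruct Hno; eauto. }
  pose (nxt n := the (fun k => k ∈ A /\ n ∈ k /\ forall j, j ∈ k -> ~ (j ∈ A /\ n ∈ j))).
  assert (Dn : dfun1 nxt) by (unfold nxt; dfn).
  assert (Hn : forall n, n ∈ om -> nxt n ∈ A /\ n ∈ nxt n /\ forall j, j ∈ nxt n -> ~ (j ∈ A /\ n ∈ j)).
  { intros n Hn; destruct (@om_least M (fun k => k ∈ A /\ n ∈ k)) as [k [Hk [[Hk1 Hk2] Hmin]]]; [dfn | |].
    - destruct (Hgt n Hn) as [k [Hk1 Hk2]]; eauto.
    - replace (nxt n) with k; auto; symmetry; apply the_eq; auto.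
      intros z [Hz1 [Hz2 Hz3]]; destruct (om_total (HA z Hz1) Hk) as [H | [H | H]]; auto.
      + destruct (Hmin z H); auto.
      + destruct (Hz3 k H); auto. }
  destruct (@om_least M (fun k => k ∈ A)) as [a [Ha [HaA Hamin]]]; [dfn | |].
  { destruct (Hgt emp om_emp) as [k [Hk _]]; eauto. }
  destruct (recursion a Dn) as [h [H0 HS]].
  assert (HhA : forall n, n ∈ om -> app h n ∈ A).
  { apply (@om_ind M (fun n => app h n ∈ A)); [dfn | now rewrite H0 |].
    intros n Hno IH; rewrite HS; auto; apply Hn; auto. }
  assert (Hmono : forall n, n ∈ om -> forall m, m ∈ n -> app h m ∈ app h n).
  { apply (@om_ind M (fun n => forall m, m ∈ n -> app h m ∈ app h n)); [dfn | |].
    - intros m Hm; destruct (in_emp Hm).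
    - intros n Hno IH m Hm.
      assert (Hlt : app h n ∈ app h (suc n)) by (rewrite HS; auto; apply Hn; auto).
      apply in_suc in Hm as [Hm | ->]; auto.
      eapply om_trans; [apply HA, HhA, om_suc, Hno | exact Hlt | auto]. }
  (* That is, n ≤ h(n). A given [k] therefore lies below the value at [suc k], which bounds the
     search for its index. *)
  assert (Hge : forall n, n ∈ om -> n ∈ suc (app h n)).
  { apply (@om_ind M (fun n => n ∈ suc (app h n))); [dfn | |].
    - apply in_suc; destruct (om_emp_min (HA _ (HhA _ om_emp))) as [-> |]; auto.
    - intros n Hno IH.
      assert (Hlt : app h n ∈ app h (suc n)) by (apply Hmono; auto using om_suc, suc_refl).
      assert (Hso : app h (suc n) ∈ om) by auto using om_suc.
      assert (Hnn : n ∈ app h (suc n)).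
      { apply in_suc in IH as [IH | IH]; [eapply om_trans; eauto | now rewrite <- IH in Hlt]. }
      apply in_suc; destruct (om_suc_mono Hso Hnn); auto. }
  apply equip_sym, equip_intro with (app h); [dfn | auto | |].
  - intros m n Hm Hno E; destruct (om_total Hm Hno) as [H | [H | H]]; auto.
    + exfalso; apply (@om_irrefl M (app h n)); auto; rewrite <- E at 1; apply Hmono; auto.
    + exfalso; apply (@om_irrefl M (app h m)); auto; rewrite E at 1; apply Hmono; auto.
  - intros k Hk.
    enough (H : forall n, n ∈ om -> forall k, k ∈ A -> k ∈ app h n -> exists m, m ∈ om /\ app h m = k).
    { assert (Hko : k ∈ om) by auto.
      pose proof (Hge (suc k) (om_suc Hko)) as Hks; apply in_suc in Hks.
      apply (H (suc k)); auto using om_suc.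
      destruct Hks as [Hks | <-]; [|apply suc_refl].
      eapply om_trans; [| exact Hks | apply suc_refl]; auto using om_suc. }
    clear k Hk; apply (@om_ind M (fun n => forall k, k ∈ A -> k ∈ app h n -> exists m, m ∈ om /\ app h m = k)); [dfn | |].
    + intros k Hk Hk'; rewrite H0 in Hk'; destruct (Hamin k Hk' Hk).
    + intros n Hno IH k Hk Hk'; rewrite HS in Hk'; auto.
      destruct (om_total (HA k Hk) (HA _ (HhA n Hno))) as [H | [H | H]]; eauto.
      destruct (Hn (app h n)) as [_ [_ Hmin]]; auto; destruct (Hmin k Hk'); auto.
Qed.

(** Stages may repeat, so [F] is no bijection. Its range is equipotent with a subset of [om],
    infinite because finitely many finite stages would have a finite union. *)
Lemma denumerable_stages (F : M -> M) : dfun1 F -> (forall n, n ∈ om -> Fin (F n)) ->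
  ~ Fin (union (img F om)) -> equip (img F om) om.
Proof.
  intros DF FF Hinf; destruct (countable_range DF) as [s [Hs He]].
  apply equip_trans with s; auto; apply infinite_subset_om; auto.
  intros Hf; apply Hinf, Fin_union.
  - apply Fin_equip with s; auto using equip_sym.
  - intros x Hx; apply in_img in Hx as [n [Hn ->]]; auto.
Qed.

(** * Restricting a Boolean algebra to a subalgebra *)

Section Restriction.
Context {B add mul neg zero one : M} (HB : boolalg B add mul neg zero one).
Let L := balg_of_boolalg HB.
Context {C : M}
  (HC : @subalgebra M B (fun x y => app mul (pair x y)) (app neg) zero C).

Let SC : sub C B. Proof. apply HC. Qed.
Let Cmul x y : x ∈ C -> y ∈ C -> app mul (pair x y) ∈ C. Proof. apply HC. Qed.
Let Cneg x : x ∈ C -> app neg x ∈ C. Proof. apply HC. Qed.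
Let Czero : zero ∈ C. Proof. apply HC. Qed.
Let Cadd x y : x ∈ C -> y ∈ C -> app add (pair x y) ∈ C.
Proof. intros Hx Hy; rewrite (de_morgan HB); auto. Qed.
Let Cone : one ∈ C.
Proof.
  destruct (ba_laws HB (zero_in HB) (zero_in HB) (zero_in HB)) as (_ & _ & _ & _ & _ & _ & _ & _ & <- & _); auto.
Qed.

Definition restr f : M := lam (prod C C) (app f).

Lemma app_restr f x y : x ∈ C -> y ∈ C -> app (restr f) (pair x y) = app f (pair x y).
Proof. intros Hx Hy; apply app_lam; [dfn | now apply pair_in_prod]. Qed.

Lemma func_restr f : (forall x y, x ∈ C -> y ∈ C -> app f (pair x y) ∈ C) -> func (restr f) (prod C C) C.
Proof.
  intros Hf; apply func_lam; [dfn|].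
  intros p Hp; apply in_prod in Hp as [x [Hx [y [Hy ->]]]]; auto.
Qed.

Lemma boolalg_restr : boolalg C (restr add) (restr mul) (lam C (app neg)) zero one.
Proof.
  split; auto using func_restr.
  - apply func_lam; [dfn | auto].
  - cbv zeta; intros x Hx y Hy z Hz.
    rewrite (app_lam (A := C) (F := app neg)) by (auto; dfn).
    assert (Ra : forall x y, x ∈ C -> y ∈ C -> app (restr add) (pair x y) ∈ C)
      by (intros; rewrite app_restr; auto).
    assert (Rm : forall x y, x ∈ C -> y ∈ C -> app (restr mul) (pair x y) ∈ C)
      by (intros; rewrite app_restr; auto).
    rewrite !app_restr by auto 8.
    apply (ba_laws HB); auto.
Qed.

Lemma is_tower_restr t : is_tower C (restr mul) t -> is_tower B mul t.
Proof.
  intros [[Hf HtC] Ht]; split; [split; auto|].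
  intros n Hn m Hm Hmn; destruct (Ht n Hn m Hm Hmn) as [H1 H2]; split; auto.
  apply in_lam in H1 as [p [Hp E]]; [|dfn]; apply pair_inj in E as [<- E].
  apply (func_mul HB); auto using pair_in_prod.
Qed.
End Restriction.

Lemma infinite_BA_tower : @iqdi M -> sEveryInfiniteDenumUnionBAHasTower (@mem M) -> sEveryInfiniteBAHasTower (@mem M).
Proof.
  unfold sEveryInfiniteDenumUnionBAHasTower, sEveryInfiniteBAHasTower, sDenumUnionOfFinite.
  rewrite sInfinite_eq, !sex_eq, sand_eq, sDenumerable_eq, sFinite_eq, sIsUnion_eq, sIsTower_eq.
  intros Q H B add mul neg zero one HB HinfB; rewrite sIsBooleanAlgebra_iff in HB.
  destruct (Q B HinfB) as [f [Hf If]].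
  pose proof (balg_of_boolalg HB) as L.
  pose (Bs := @stageB M B (fun x y => app mul (pair x y)) (app neg) zero (app f)).
  assert (Df : dfun1 (app f)) by dfn.
  assert (DBs : dfun1 Bs) by exact (dfun_stageB L Df).
  assert (FBs : forall n, n ∈ om -> Fin (Bs n)).
  { intros n Hn; apply (Fin_stageB L Df); auto; intros k Hk; apply Hf; auto. }
  assert (Binf : ~ Fin (union (img Bs om))).
  { apply (stageB_infinite L Df); auto; intros k Hk; apply Hf; auto. }
  assert (SBs : forall n, @subalgebra M B (fun x y => app mul (pair x y)) (app neg) zero (Bs n)).
  { intros n; apply (gen_subalgebra L). }
  assert (Up : forall n, n ∈ om -> forall m, m ∈ n -> sub (Bs m) (Bs n)).
  { apply increasing_sets; auto; intros n _; apply (stageB_suc L Df). }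
  assert (Hin : forall x, x ∈ union (img Bs om) <-> exists n, n ∈ om /\ x ∈ Bs n).
  { intros x; rewrite in_union; split.
    - intros [C [HC Hx]]; apply in_img in HC as [n [Hn ->]]; eauto.
    - intros [n [Hn Hx]]; exists (Bs n); rewrite in_img by auto; eauto. }
  set (C := union (img Bs om)) in *.
  assert (HC : @subalgebra M B (fun x y => app mul (pair x y)) (app neg) zero C).
  { split; [|split; [|split]].
    - intros x Hx; apply Hin in Hx as [n [Hn Hx]]; now apply (SBs n).
    - apply Hin; exists emp; split; [apply om_emp | apply SBs].
    (* The later of the two stages contains both elements. *)
    - intros x y Hx Hy; apply Hin in Hx as [n [Hn Hx]]; apply Hin in Hy as [m [Hm Hy]].
      apply Hin; destruct (om_total Hn Hm) as [H1 | [-> | H1]].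
      + exists m; split; auto; apply (SBs m); [exact (Up m Hm n H1 x Hx) | exact Hy].
      + exists m; split; auto; apply (SBs m); [exact Hx | exact Hy].
      + exists n; split; auto; apply (SBs n); [exact Hx | exact (Up n Hn m H1 y Hy)].
    - intros x Hx; apply Hin in Hx as [n [Hn Hx]]; apply Hin; exists n; split; auto; now apply SBs. }
  destruct (H C (@restr C add) (@restr C mul) (lam C (app neg)) zero one) as [t Ht]; auto.
  - apply sIsBooleanAlgebra_iff; exact (boolalg_restr HB HC).
  - exists (img Bs om); split; [now apply denumerable_stages | split; auto].
    intros x Hx; apply in_img in Hx as [n [Hn ->]]; auto.
  - exists t; exact (is_tower_restr HB HC Ht).
Qed.

Lemma infinite_BA_tower_qpkw : @iqdi M -> qpkw M -> sEveryInfiniteBAHasTower (@mem M).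
Proof.
  unfold sEveryInfiniteBAHasTower.
  rewrite sInfinite_eq, sex_eq, sIsTower_eq.
  intros Q K B add mul neg zero one HB HinfB; rewrite sIsBooleanAlgebra_iff in HB.
  destruct (Q B HinfB) as [f [Hf If]].
  pose proof (balg_of_boolalg HB) as L.
  destruct (@tower_of_finite_subsets M B _ _ _ L (app f)) as [h Hh]; auto.
  { dfn. } { intros n Hn; apply Hf; auto. } { intros n Hn; apply Hf; auto. }
  assert (HhB : forall n, n ∈ om -> app h n ∈ B) by (intros n Hn; apply Hh; auto).
  exists (lam om (app h)); split.
  - apply func_lam; [dfn | auto].
  - intros n Hn m Hm Hmn; rewrite !app_lam by (auto; dfn).
    destruct (Hh n Hn) as [_ H]; destruct (H m Hmn) as [Hle Hne]; split; auto.
    apply (func_mul HB); auto using pair_in_prod.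
Qed.

(** * The Boolean algebra of regular open sets *)

Section RegularOpens.
Context {X O : M}.
Context (OX : forall U, U ∈ O -> sub U X) (XO : X ∈ O).
Context (OI : forall U V, U ∈ O -> V ∈ O -> exists W, W ∈ O /\ forall x, x ∈ W <-> x ∈ U /\ x ∈ V).
Context (OU : forall F, sub F O -> union F ∈ O).

Definition cap U V : M := sep U (fun x => x ∈ V).
Lemma dfun_cap : dfun2 cap. Proof. unfold cap; dfn. Qed.
Lemma in_cap U V x : x ∈ cap U V <-> x ∈ U /\ x ∈ V.
Proof. apply (@in_sep M U (fun x => x ∈ V)); dfn. Qed.

Lemma cap_open U V : U ∈ O -> V ∈ O -> cap U V ∈ O.
Proof.
  intros HU HV; destruct (OI HU HV) as [W [HW H]]; replace (cap U V) with W; auto.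
  apply zf_ext; intros x; now rewrite H, in_cap.
Qed.

(** The exterior, i.e. the complement of the closure. For open [U], applying it twice gives the
    interior of the closure. *)
Definition ext U : M := sep X (fun x => exists V, V ∈ O /\ x ∈ V /\ forall y, y ∈ V -> y ∉ U).
Lemma dfun_ext : dfun1 ext. Proof. unfold ext; dfn. Qed.
Hint Resolve dfun_ext dfun_cap : dfn.
Lemma in_ext U x : x ∈ ext U <-> exists V, V ∈ O /\ x ∈ V /\ forall y, y ∈ V -> y ∉ U.
Proof.
  unfold ext; rewrite in_sep by dfn; split; [tauto|].
  intros H; split; auto; destruct H as [V [HV [Hx _]]]; eapply OX; eauto.
Qed.

Lemma ext_open U : ext U ∈ O.
Proof.
  replace (ext U) with (union (sep O (fun V => forall y, y ∈ V -> y ∉ U))).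
  - apply OU; intros V HV; apply in_sep in HV; [tauto | dfn].
  - apply zf_ext; intros x; rewrite in_union, in_ext; split.
    + intros [V [HV Hx]]; apply in_sep in HV; [|dfn]; exists V; tauto.
    + intros [V [HV [Hx Hd]]]; exists V; rewrite in_sep by dfn; auto.
Qed.

Lemma ext_anti U V : sub U V -> sub (ext V) (ext U).
Proof.
  intros H x Hx; apply in_ext in Hx as [W [HW [Hx Hd]]]; apply in_ext.
  exists W; split; auto; split; auto; intros y Hy Hy'; eapply Hd; eauto.
Qed.

Lemma ext_disjoint U x : x ∈ U -> x ∈ ext U -> False.
Proof. intros Hx Hx'; apply in_ext in Hx' as [V [_ [HxV Hd]]]; eapply Hd; eauto. Qed.

Lemma sub_ext U V : U ∈ O -> (forall x, x ∈ U -> x ∉ V) -> sub U (ext V).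
Proof. intros HU H x Hx; apply in_ext; eauto. Qed.

Lemma sub_ext_ext U : U ∈ O -> sub U (ext (ext U)).
Proof. intros HU; apply sub_ext; auto; intros x Hx Hx'; exact (ext_disjoint Hx Hx'). Qed.

Definition regular_opens : M := sep (power X) (fun U => ext (ext U) = U).
Lemma in_RO U : U ∈ regular_opens <-> ext (ext U) = U.
Proof.
  unfold regular_opens; rewrite in_sep, in_power by dfn; split; [tauto|].
  intros H; split; auto; rewrite <- H; apply OX, ext_open.
Qed.

Lemma RO_open U : U ∈ regular_opens -> U ∈ O.
Proof. intros H; apply in_RO in H; rewrite <- H; apply ext_open. Qed.

Lemma cap_eq_l U V : sub U V -> cap U V = U.
Proof. intros H; apply zf_ext; intros x; rewrite in_cap; split; [tauto | auto]. Qed.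

Lemma sub_of_cap_eq U V : cap U V = U -> sub U V.
Proof. intros <- x Hx; apply in_cap in Hx; tauto. Qed.

Lemma RO_balg : balg regular_opens cap ext emp.
Proof.
  split.
  - apply dfun_cap.
  - apply dfun_ext.
  (* The exterior of the empty set is [X], whose exterior is empty again. *)
  - apply in_RO; apply set_eq; intros x Hx; [|destruct (in_emp Hx)].
    exfalso; assert (HxX : x ∈ X) by (eapply OX; [apply ext_open | exact Hx]).
    revert Hx; apply ext_disjoint.
    apply in_ext; exists X; split; auto; split; auto; intros y _ Hy; exact (in_emp Hy).
  - intros U V HU HV; pose proof (RO_open HU); pose proof (RO_open HV).
    apply in_RO in HU; apply in_RO in HV; apply in_RO; apply set_eq.
    + intros x Hx; apply in_cap; split; [rewrite <- HU | rewrite <- HV];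
        revert x Hx; do 2 apply ext_anti; intros x Hx; apply in_cap in Hx; tauto.
    + now apply sub_ext_ext, cap_open.
  - intros U HU; apply in_RO in HU; apply in_RO; now rewrite HU.
  - intros U V W _ _ _; apply zf_ext; intros x; rewrite !in_cap; tauto.
  - intros U V _ _; apply zf_ext; intros x; rewrite !in_cap; tauto.
  - intros U _; apply zf_ext; intros x; rewrite !in_cap; tauto.
  - intros U _; apply set_eq; intros x Hx; [apply in_cap in Hx; tauto | destruct (in_emp Hx)].
  - intros U V HU HV; split; intros E.
    + apply cap_eq_l, sub_ext; [now apply RO_open|].
      intros x Hx Hx'; apply (@in_emp M x); rewrite <- E; apply in_cap; auto.
    + apply set_eq; intros x Hx; [exfalso | destruct (in_emp Hx)].
      apply in_cap in Hx as [Hx Hx']; apply (sub_of_cap_eq E) in Hx; exact (ext_disjoint Hx' Hx).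
  - intros U HU; now apply in_RO.
Qed.

Lemma RO_of_sRegularOpen U : sRegularOpen (@mem M) X O U -> U ∈ regular_opens.
Proof.
  unfold sRegularOpen, sIsClosure, sIsInterior; rewrite sSubset_eq, sand_eq, siff_eq, !sex_eq.
  intros [HUX [C [HC HU]]]; apply in_RO, zf_ext; intros x; rewrite HU, in_ext.
  (* The closure [C] of [U] is the complement of [ext U] in [X]; so the interior of [C] is
     [ext (ext U)]. *)
  assert (HCe : forall V, V ∈ O -> sub V C <-> forall y, y ∈ V -> y ∉ ext U).
  { intros V HV; split.
    - intros H y Hy Hye; apply in_ext in Hye as [W [HW [HyW Hd]]].
      apply H, HC in Hy as [_ Hy]; destruct (Hy W HW HyW) as [z [Hz1 Hz2]]; eapply Hd; eauto.
    - intros H y Hy; apply HC; split; [eapply OX; eauto|].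
      intros W HW HyW; apply NNPP; intros Hno; apply (H y Hy), in_ext.
      exists W; split; auto; split; auto; intros z Hz Hz'; eauto. }
  split.
  - intros [V [HV [Hx Hd]]]; split; [eapply OX; eauto|]; exists V; rewrite HCe; auto.
  - intros [_ [V [HV [Hx Hd]]]]; exists V; rewrite HCe in Hd; auto.
Qed.

Lemma cellular_of_tower h : @tower M regular_opens cap h ->
  sex (fun C => sand (sCellular (@mem M) O C) (sDenumerable (@mem M) C)).
Proof.
  intros Hh.
  unfold sCellular, sNonempty, sDisjoint; rewrite !sex_eq, !sand_eq, sDenumerable_eq.
  pose proof RO_balg as L.
  assert (HhR : forall n, n ∈ om -> app h n ∈ regular_opens) by (intros n Hn; apply Hh; auto).
  (* The Boolean difference of consecutive members. If it were empty, [app h n] would be below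
     [app h (suc n)] and the two would coincide. *)
  pose (d n := cap (app h n) (ext (app h (suc n)))).
  assert (Dd : dfun1 d) by (unfold d; dfn).
  assert (Hne : forall n, n ∈ om -> exists x, x ∈ d n).
  { intros n Hn; apply NNPP; intros Hno.
    destruct (Hh (suc n) (om_suc Hn)) as [_ H]; destruct (H n (suc_refl n)) as [Hle Hneq].
    apply Hneq; apply (le_antisym L); auto using om_suc.
    apply (le_iff L); auto using om_suc.
    apply set_eq; intros x Hx; [destruct Hno; eauto | destruct (in_emp Hx)]. }
  assert (Hdis : forall m n x, n ∈ om -> m ∈ n -> x ∈ d m -> x ∈ d n -> False).
  { intros m n x Hn Hm Hxm Hxn; apply in_cap in Hxm as [_ Hxm]; apply in_cap in Hxn as [Hxn _].
    eapply ext_disjoint; [|exact Hxm].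
    (* For m < n, [d n] lies in [app h n], hence in [app h (suc m)], whose exterior contains
       [d m]. *)
    destruct (om_suc_mono Hn Hm) as [H | ->]; auto.
    destruct (Hh n Hn) as [_ Hle]; destruct (Hle _ H) as [Hle' _].
    exact (sub_of_cap_eq Hle' Hxn). }
  assert (Hdis' : forall m n x, m ∈ om -> n ∈ om -> x ∈ d m -> x ∈ d n -> m = n).
  { intros m n x Hm Hn Hxm Hxn; destruct (om_total Hm Hn) as [H | [H | H]]; auto;
      exfalso; [apply (Hdis m n x) | apply (Hdis n m x)]; auto. }
  exists (img d om); split; [split|].
  - intros U HU; apply in_img in HU as [n [Hn ->]]; auto; split; auto.
    apply cap_open; [apply RO_open | apply ext_open]; auto.
  - intros U HU V HV HUV [x [HxU HxV]].
    apply in_img in HU as [m [Hm ->]]; [|exact Dd]; apply in_img in HV as [n [Hn ->]]; [|exact Dd].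
    apply HUV; now rewrite (Hdis' m n x Hm Hn HxU HxV).
  - apply equip_sym, equip_intro with d; auto.
    + intros n Hn; apply in_img; eauto.
    + intros m n Hm Hn E; destruct (Hne m Hm) as [x Hx].
      apply (Hdis' m n x Hm Hn Hx); rewrite <- E; exact Hx.
    + intros y Hy; apply in_img in Hy as [n [Hn ->]]; eauto.
Qed.

End RegularOpens.

(** The rows of the matrix form an injective sequence of finite subsets of the algebra of regular
    open sets, the input of [tower_of_finite_subsets]. *)
Lemma regular_matrix_cellular : qpkw M -> sRegularMatrixGivesDenumerableCellularFamily (@mem M).
Proof.
  intros K X O HT HM.
  unfold sIsTopology in HT; rewrite !sand_eq, !sex_eq, sSubset_eq in HT.
  destruct HT as [OX [XO [_ [OI OU]]]].
  assert (OI' : forall U V, U ∈ O -> V ∈ O -> exists W, W ∈ O /\ forall x, x ∈ W <-> x ∈ U /\ x ∈ V).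
  { intros U V HU HV; destruct (OI U HU V HV) as [W HW]; exists W.
    unfold sIsInter2 in HW; now rewrite siff_eq, sand_eq in HW. }
  assert (OU' : forall F, sub F O -> union F ∈ O).
  { intros F HF; destruct (OU F HF) as [W [HW HE]]; rewrite sIsUnion_eq in HE; now rewrite <- HE. }
  unfold sIsRegularMatrix in HM; rewrite !sex_eq, !sand_eq, sIsOmega_eq, sIsFamily_eq, sFinite_eq, sApp_eq in HM.
  destruct HM as [A [w [-> [HA [HC Hinj]]]]].
  assert (Hn : forall n, n ∈ om -> Fin (app A n) /\ sub (app A n) (@regular_opens X O)).
  { intros n Hn; destruct (HC n Hn) as [C [HnC [HF [_ [HR _]]]]].
    apply HA in HnC as ->; auto; split; auto; intros U HU; apply RO_of_sRegularOpen; auto. }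
  destruct (@tower_of_finite_subsets M _ _ _ _ (RO_balg OX XO OI' OU') (app A)) as [h Hh]; auto.
  - dfn.
  - intros n Hno; apply Hn; auto.
  - intros n Hno; apply Hn; auto.
  - intros m n Hm Hno E; apply NNPP; intros Hne; apply (Hinj m Hm n Hno Hne).
    exists (app A m); split; apply HA; auto.
  - eapply cellular_of_tower; eauto.
Qed.

End Transfer.

Local Open Scope zf_scope.

Theorem theorem6p8 :
  ZF_proves (IQDI ⇒
    (EveryInfiniteBAHasTower ⇔ EveryInfiniteDenumUnionBAHasTower))
  /\ ZF_proves (IQDI ∧ QPKW ⇒ EveryInfiniteBAHasTower)
  /\ ZF_proves (QPKW ⇒ RegularMatrixGivesDenumerableCellularFamily).
Proof.
  repeat split; apply completeness; intros M E e H; pose (N := build_model e H).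
  - change (sIQDI (@mem N) -> siff (sEveryInfiniteBAHasTower (@mem N))
      (sEveryInfiniteDenumUnionBAHasTower (@mem N))).
    rewrite siff_eq; intros Q; split.
    + intros HT B add mul neg zero one HB Hinf _; eapply HT; eauto.
    + now apply infinite_BA_tower, iqdi_of_sIQDI.
  - change (sand (sIQDI (@mem N)) (sQPKW (@mem N)) -> sEveryInfiniteBAHasTower (@mem N)).
    rewrite sand_eq; intros [Q K]; apply infinite_BA_tower_qpkw.
    + now apply iqdi_of_sIQDI.
    + now apply qpkw_of_sQPKW.
  - change (sQPKW (@mem N) -> sRegularMatrixGivesDenumerableCellularFamily (@mem N)).
    intros K; now apply regular_matrix_cellular, qpkw_of_sQPKW.
Qed.
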